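(* Let $m,q\ge 1$, $m+q=n+1$, let $K\subset\mathbb{R}^m$ be a convex body such that the convex cylinder $C=K\times\mathbb{R}^q\subset\mathbb{R}^{n+1}$ has boundary of class $C^{2,\alpha}$, and let $E\subset C$ be an isoperimetric region. Then either the closure of $\partial E\cap\operatorname{int}(C)$ is connected, or $q=1$ and $E$ is a slab in $K\times\mathbb{R}$, i.e. $E=K\times I$ for some compact interval $I\subset\mathbb{R}$.
   Context: A convex body is a compact convex set with non-empty interior. For measurable $E\subset C$, $|E|$ denotes the $(n+1)$-dimensional Hausdorff (Lebesgue) measure, called volume. The relative perimeter of $E$ in the interior of $C$ is $P_C(E)=\sup\{\int_E \operatorname{div}\xi\, dH^{n+1} : \xi \text{ smooth vector field with compact support in } \operatorname{int}(C),\ |\xi|\le 1\}$. The isoperimetric profile is $I_C(v)=\inf\{P_C(E): E\subset C,\ |E|=v\}$, and $E\subset C$ is an isoperimetric region (of volume $|E|\in(0,\infty)$) if $P_C(E)=I_C(|E|)$. An isoperimetric region is always represented by a closed set that includes its points of density one and contains no points of density zero. *)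

(* Defs.v *)
From HB Require Import structures.
From mathcomp Require Import all_boot all_order all_algebra.
From mathcomp Require Import all_classical all_reals all_analysis.

Set Implicit Arguments.
Unset Strict Implicit.
Unset Printing Implicit Defensive.

Import Order.TTheory GRing.Theory Num.Theory.
Import numFieldNormedType.Exports.

Local Open Scope classical_set_scope.
Local Open Scope ring_scope.

(* The library norm `|x| on 'rV[R]_d is the sup norm. It induces the Euclidean
   topology, but lengths and balls below are taken with the Euclidean norm. *)
Definition enorm (R : realType) (d : nat) (x : 'rV[R]_d) : R :=
  Num.sqrt (\sum_i x 0 i ^+ 2).

Definition eball (R : realType) (d : nat) (p : 'rV[R]_d) (r : R) :
    set 'rV[R]_d :=
  [set x | enorm (x - p) < r].

Definition boundary (T : topologicalType) (A : set T) : set T :=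
  closure A `\` interior A.

Definition convex_body (R : realType) (d : nat) (K : set 'rV[R]_d) : Prop :=
  [/\ compact K,
      convex_set (K : set (convex_lmodType 'rV[R]_d)) &
      interior K !=set0].

(* A x B, as a set of R^(m + q) *)
Definition prod_set (R : realType) (m q : nat)
    (A : set 'rV[R]_m) (B : set 'rV[R]_q) : set 'rV[R]_(m + q) :=
  [set x | A (lsubmx x) /\ B (rsubmx x)].

Section lebesgue.
Context (R : realType) (d : nat).
Local Open Scope ereal_scope.

Definition box (p : 'rV[R]_d * 'rV[R]_d) : set 'rV[R]_d :=
  [set x | forall i, (p.1 0 i <= x 0 i <= p.2 0 i)%R].

Definition box_volume (p : 'rV[R]_d * 'rV[R]_d) : R :=
  (\prod_(i < d) Num.max 0 (p.2 0 i - p.1 0 i))%R.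

Definition box_cover (X : set 'rV[R]_d) : set (set ('rV[R]_d * 'rV[R]_d)) :=
  [set S | countable S /\ X `<=` \bigcup_(p in S) box p].

Definition lebesgue_outer (X : set 'rV[R]_d) : \bar R :=
  ereal_inf [set \esum_(p in S) (box_volume p)%:E | S in box_cover X].

Lemma box_volume_ge0 p : 0 <= (box_volume p)%:E.
Proof. by rewrite lee_fin; apply: prodr_ge0 => i _; rewrite le_max lexx. Qed.

Lemma lebesgue_outer_ge0 X : 0 <= lebesgue_outer X.
Proof.
apply: le_ereal_inf_tmp => _ [S _ <-].
by apply: esum_ge0 => p _; exact: box_volume_ge0.
Qed.

Lemma lebesgue_outer0 : lebesgue_outer set0 = 0.
Proof.
apply/eqP; rewrite eq_le lebesgue_outer_ge0 andbT.
by apply: ereal_inf_lbound; exists set0; [split|rewrite esum_set0].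
Qed.

Lemma le_lebesgue_outer :
  {homo lebesgue_outer : A B / A `<=` B >-> A <= B}.
Proof.
move=> A B AB; apply/ereal_inf_le_tmp => _ [S [cS BS] <-].
by exists S => //; split => //; exact: subset_trans AB BS.
Qed.

Lemma lebesgue_outer_sigma_subadditive : sigma_subadditive lebesgue_outer.
Proof.
move=> A; have [[i Ai]|] := pselect (exists i, lebesgue_outer (A i) = +oo).
  rewrite (eseries_pinfty _ _ Ai) ?leey// => n _.
  by rewrite -ltNye (lt_le_trans _ (lebesgue_outer_ge0 _)).
rewrite -forallNE => Afin.
suff H (e : {posnum R}) : lebesgue_outer (\bigcup_n A n) <=
    \sum_(i <oo) lebesgue_outer (A i) + e%:num%:E.
  by apply/lee_addgt0Pr => _/posnumP[].
rewrite (le_trans _ (epsilon_trick _ _ _))//; last first.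
  by move=> n; exact: lebesgue_outer_ge0.
pose P n S := box_cover (A n) S /\ \esum_(p in S) (box_volume p)%:E <=
  lebesgue_outer (A n) + (e%:num / (2 ^ n.+1)%:R)%:E.
have [G PG] : {G & forall n, P n (G n)}.
  apply: (@choice _ _ P) => n.
  have en0 : (0 < e%:num / (2 ^ n.+1)%:R)%R by [].
  have fA : lebesgue_outer (A n) \is a fin_num.
    by rewrite ge0_fin_numE ?lebesgue_outer_ge0// ltey; apply/eqP/Afin.
  have [_ [S AS <-] Sle] := lb_ereal_inf_adherent en0 fA.
  by exists S; split => //; exact/ltW.
apply: (@le_trans _ _ (\esum_(p in \bigcup_n G n) (box_volume p)%:E)).
  apply: ereal_inf_lbound; exists (\bigcup_n G n) => //; split.
    by apply: bigcup_countable => // n _; exact: (PG n).1.1.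
  move=> x [n _ Anx]; have [p Gp px] := (PG n).1.2 _ Anx.
  by exists p => //; exists n.
rewrite (seqDU_bigcup_eq G) nneseries_sum_bigcup; last 2 first.
  - exact: trivIset_seqDU.
  - by move=> p; exact: box_volume_ge0.
apply: lee_nneseries => [n _ _|n _].
  by apply: esum_ge0 => p _; exact: box_volume_ge0.
apply: le_trans (PG n).2; rewrite esum_mkcond [leRHS]esum_mkcond.
apply: le_esum => p _; case: ifPn => [|_]; last first.
  by case: ifP => // _; exact: box_volume_ge0.
by rewrite inE => -[Gp _]; rewrite mem_set.
Qed.

HB.instance Definition _ := isOuterMeasure.Build R 'rV[R]_d lebesgue_outer
  lebesgue_outer0 lebesgue_outer_ge0 le_lebesgue_outer
  lebesgue_outer_sigma_subadditive.

End lebesgue.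

(* R^d with its Lebesgue sigma-algebra: the Caratheodory measurable sets of the
   outer measure. This type is convertible to 'rV[R]_d. *)
Notation lebesgue_space R d := (caratheodory_type (@lebesgue_outer R d)).

Definition volume (R : realType) (d : nat) :
  set (lebesgue_space R d) -> \bar R := @lebesgue_outer R d.

HB.instance Definition _ (R : realType) (d : nat) :=
  isMeasure.Build _ _ _ (@volume R d)
    (@caratheodory_measure0 _ _ (@lebesgue_outer R d))
    (@caratheodory_measure_ge0 _ _ (@lebesgue_outer R d))
    (@caratheodory_measure_sigma_additive _ _ (@lebesgue_outer R d)).

Section regularity.
Context (R : realType) (d : nat).
Implicit Types f : 'rV[R]_d -> R.

Definition partial (i : 'I_d) f : 'rV[R]_d -> R := 'D_(delta_mx 0 i) f.

(* All partial derivatives of order less than k exist and are continuous, and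
   those of order k exist and satisfy P. *)
Fixpoint partials_of_class (P : ('rV[R]_d -> R) -> Prop) (k : nat) f : Prop :=
  if k is k'.+1 then
    [/\ continuous f,
        forall i x, derivable f x (delta_mx 0 i) &
        forall i, partials_of_class P k' (partial i f)]
  else P f.

Definition smooth f : Prop := forall k, partials_of_class (fun h => continuous h) k f.

Definition locally_holder (alpha : R) f : Prop :=
  forall p, exists r M : R, 0 < r /\
    {in eball p r &, forall x y, `|f x - f y| <= M * enorm (x - y) `^ alpha}.

Definition of_class_holder (k : nat) (alpha : R) f : Prop :=
  partials_of_class (locally_holder alpha) k f.

End regularity.

(* Near each boundary point, after relabelling and reorienting the coordinate
   axes, the interior of C lies strictly above the graph of a C^{k,alpha}
   function of the other d - 1 coordinates. *)
Definition boundary_of_class_holder (R : realType) (d k : nat) (alpha : R)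
    (C : set 'rV[R]_d) : Prop :=
  forall p, boundary C p ->
    exists (r : R) (i : 'I_d) (s : bool) (g : 'rV[R]_d.-1 -> R),
      [/\ 0 < r, of_class_holder k alpha g &
          forall x, eball p r x ->
            (interior C x <-> g (col' i x) < (-1) ^+ s * x 0 i)].

Section isoperimetry.
Context (R : realType) (d : nat).
Implicit Types (C E : set 'rV[R]_d) (xi : 'rV[R]_d -> 'rV[R]_d).

Definition divergence xi (x : 'rV[R]_d) : R :=
  \sum_(i < d) partial i (fun y => xi y 0 i) x.

Definition test_field C xi : Prop :=
  [/\ forall i, smooth (fun x => xi x 0 i),
      compact (closure [set x | xi x != 0]),
      closure [set x | xi x != 0] `<=` interior C &
      forall x, enorm (xi x) <= 1].

Definition lebesgue_measurable E : Prop :=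
  measurable (E : set (lebesgue_space R d)).

Local Open Scope ereal_scope.

Definition rel_perimeter C E : \bar R :=
  ereal_sup [set \int[@volume R d]_(x in E) (divergence xi x)%:E
            | xi in test_field C].

Definition isoperimetric_profile C (v : \bar R) : \bar R :=
  ereal_inf [set rel_perimeter C E
            | E in [set E | [/\ lebesgue_measurable E, E `<=` C &
                                volume E = v]]].

Definition isoperimetric_region C E : Prop :=
  [/\ lebesgue_measurable E, E `<=` C, 0 < volume E < +oo &
      rel_perimeter C E = isoperimetric_profile C (volume E)].

Definition has_density E (x : 'rV[R]_d) (theta : R) : Prop :=
  (fine (volume (E `&` eball x r)) / fine (volume (eball x r)))%R
    @[r --> (0 : R)^'+] --> theta.

Definition standard_representative E : Prop :=
  [/\ closed E,
      forall x, has_density E x 1%R -> E x &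
      forall x, has_density E x 0%R -> ~ E x].

End isoperimetry.

(* The slab K x I with I = [a, b]; the second factor is a subset of R^q and is
   the interval [a, b] itself when q = 1. *)
Definition slab (R : realType) (m q : nat) (K : set 'rV[R]_m) (a b : R) :
    set 'rV[R]_(m + q) :=
  prod_set K [set y : 'rV[R]_q | forall j, y 0 j \in `[a, b]].

(* Main.v *)
Require Import Defs.
From HB Require Import structures.
From mathcomp Require Import all_boot all_order all_algebra.
From mathcomp Require Import all_classical all_reals all_analysis.
From mathcomp Require Import measurable_realfun ring lra.

Set Implicit Arguments.
Unset Strict Implicit.
Unset Printing Implicit Defensive.

Import Order.TTheory GRing.Theory Num.Theory.
Import numFieldNormedType.Exports.

Local Open Scope classical_set_scope.
Local Open Scope ring_scope.

(* Write P for the perimeter in the interior O of C, and + for the symmetric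
   difference. If the closure of the boundary of E in O is the union of two
   disjoint nonempty closed sets F1 and F2, then, O being convex, lifting mod 2
   along segments gives E = G1 + G2 in O with G1 and G2 locally constant off F1
   and F2, and cutting test fields off near F1 and F2 shows
   P(G1) + P(G2) <= P(E).
   Suppose that G1 and G2, or both complements, have finite volume. Stretching
   along R^q the one with the smaller ratio of perimeter to volume until it has
   the volume of E then contradicts the minimality of E: the stretching bounds are
   strict unless some set of finite positive volume has no perimeter in the
   directions of R^q, which is impossible because it would be invariant under
   translations in these directions.
   Otherwise G1 and its complement have infinite volume. The translates G1 + k e
   along an axis of R^q converge to a set of zero perimeter, hence to the empty set
   or to everything, so the volume of (G1 + k e) + G1 tends to infinity.
   Thus E_k = (G1 + k e) + G2 has P(E_k) <= P(E) and, for large k, more volume than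
   E. Shrinking E_k along R^q contradicts minimality if q > 1, and if q = 1 it shows
   that E_k has no perimeter in the directions of K. In the limit the same holds for
   G2, G1 and E, so E = K x A for a closed set A of finite measure. A gap in A would
   split E into two sets of finite volume, which was excluded; so A is a compact
   interval. *)

(** * Lebesgue measure and diagonal affine maps *)

(** Perimeter is only ever a supremum of fluxes of test fields, so each estimate is proved by
    building new fields out of old ones; no reduced boundary or trace appears. Convexity of O enters
    through segments: it kills the monodromy of the mod 2 lift and leaves only trivial sets without
    perimeter. The exponents decide the outcome. A stretching by lam along R^q, applied as a
    preimage, divides volume by lam^q and multiplies perimeter by at most max(1, lam) / lam^q. For
    lam < 1 this bound is strict unless the set has no perimeter along R^q. For lam > 1 the factor
    is lam^(1 - q), below 1 if q > 1 and equal to 1 if q = 1. In that borderline case only perimeter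
    in the directions of K can give a gain, and this is where slabs come from. The obstacle is that
    a part of the boundary may bound a set of infinite volume, which no stretching brings to the
    volume of E; far translates then supply a competitor whose volume is finite. Statements up to
    null sets become pointwise at the end because a standard representative has mass near each of
    its points. *)

Lemma outer_measure_bigcup_countable (R : realType) (T : Type) (I : choiceType)
    (mu : {outer_measure set T -> \bar R}) (S : set I) (F : I -> set T) :
  countable S ->
  (mu (\bigcup_(p in S) F p) <= \esum_(p in S) mu (F p))%E.
Proof.
move=> /countable_injP[f finj].
pose Sn n := [set p | S p /\ f p = n].
have SE : S = \bigcup_n Sn n.
  by apply/seteqP; split=> [p Sp|p [n _ []//]]; exists (f p).
have tS : trivIset setT Sn by move=> i j _ _ [p [[_ <-] [_ <-]]].
rewrite {2}SE nneseries_sum_bigcup//; last by move=> i; exact: outer_measure_ge0.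
have -> : \bigcup_(p in S) F p = \bigcup_n \bigcup_(p in Sn n) F p.
  apply/seteqP; split=> [x [p Sp Fx]|x [n _ [p [Sp _] Fx]]]; last by exists p.
  by exists (f p) => //; exists p.
apply: le_trans (outer_measure_sigma_subadditive _ _) _.
apply: lee_nneseries => [n _ _|n _]; first exact: outer_measure_ge0.
have [->|/set0P[p Snp]] := eqVneq (Sn n) set0.
  by rewrite bigcup_set0 outer_measure0 esum_set0.
have -> : Sn n = [set p].
  apply/seteqP; split=> [r [Sr fr]|_ -> //].
  case: Snp => Sp fp; apply: finj; rewrite ?inE//.
  by rewrite fr fp.
by rewrite bigcup_set1 esum_set1// outer_measure_ge0.
Qed.

Lemma ge0_esumZl (R : realType) (T : choiceType) (S : set T) (a : T -> \bar R)
    (k : R) : 0 <= k -> (forall x, 0 <= a x)%E ->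
  (\esum_(p in S) (k%:E * a p) <= k%:E * \esum_(p in S) a p)%E.
Proof.
move=> k0 a0; apply: ge_ereal_sup => _ [F [finF FS] <-].
rewrite -ge0_mule_fsumr//; apply: lee_wpmul2l; first by rewrite lee_fin.
by apply: ereal_sup_ubound; exists F.
Qed.

Section diagonal_maps.
Context (R : realType) (d : nat).
Implicit Types (c t z : 'rV[R]_d) (A X : set 'rV[R]_d).

(** Translations and stretchings along the axes are both of this form, and such maps send boxes to
    boxes, so their effect on volume is read off from box covers. *)
Definition dmap c t z : 'rV[R]_d := \row_i (c 0 i * z 0 i + t 0 i).

Definition dpos c := forall i, 0 < c 0 i.
Definition ddet c : R := \prod_i c 0 i.
Definition dminv c : 'rV[R]_d := \row_i (c 0 i)^-1.
Definition dmtrans c t : 'rV[R]_d := \row_i (- (t 0 i / c 0 i)).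

Lemma dpos_inv c : dpos c -> dpos (dminv c).
Proof. by move=> c0 i; rewrite mxE invr_gt0. Qed.

Lemma ddet_gt0 c : dpos c -> 0 < ddet c.
Proof. by move=> c0; apply: prodr_gt0 => i _. Qed.

Lemma ddet_inv c : ddet (dminv c) = (ddet c)^-1.
Proof. by rewrite /ddet -prodfV; apply: eq_bigr => i _; rewrite mxE. Qed.

Lemma dmapK c t : dpos c -> cancel (dmap c t) (dmap (dminv c) (dmtrans c t)).
Proof.
move=> c0 z; apply/rowP => i; rewrite !mxE.
have := c0 i; move: (c 0 i) => u u0; field; lra.
Qed.

Lemma dmapVK c t : dpos c -> cancel (dmap (dminv c) (dmtrans c t)) (dmap c t).
Proof.
move=> c0 z; apply/rowP => i; rewrite !mxE.
have := c0 i; move: (c 0 i) => u u0; field; lra.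
Qed.

Lemma box_volume_dmap c t (p : 'rV[R]_d * 'rV[R]_d) : dpos c ->
  box_volume (dmap c t p.1, dmap c t p.2) = ddet c * box_volume p.
Proof.
move=> c0; rewrite /box_volume -big_split/=; apply: eq_bigr => i _.
rewrite !mxE maxr_pMr ?mulr0; last exact/ltW/c0.
by congr Num.max; ring.
Qed.

(** The inverse map carries a box cover of [A] to a box cover of the preimage and divides each box
    volume by [ddet c]. One inequality suffices, since the inverse map yields the other. *)
Lemma lebesgue_outer_dmap_le c t A : dpos c ->
  (lebesgue_outer (dmap c t @^-1` A) <= (ddet c)^-1%:E * lebesgue_outer A)%E.
Proof.
move=> c0; rewrite muleC -lee_pdivrMr ?invr_gt0 ?ddet_gt0// invrK.
apply: le_ereal_inf_tmp => _ [S [cS AS] <-].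
rewrite -lee_pdivlMr ?ddet_gt0//.
set c' := dminv c; set t' := dmtrans c t; have c'0 : dpos c' by exact: dpos_inv.
pose f (p : 'rV[R]_d * 'rV[R]_d) := (dmap c' t' p.1, dmap c' t' p.2).
have finj : injective f.
  move=> [p1 p2] [r1 r2] [e1 e2].
  by rewrite -(dmapVK t c0 p1) -(dmapVK t c0 p2) e1 e2 !dmapVK.
apply: (@le_trans _ _ (\esum_(p in f @` S) (box_volume p)%:E)%E); last first.
  rewrite esum_image; last by move=> p r _ _; exact: finj.
  under eq_esum do rewrite box_volume_dmap// EFinM ddet_inv.
  rewrite muleC; apply: ge0_esumZl; first by rewrite invr_ge0 ltW ?ddet_gt0.
  by move=> p; exact: box_volume_ge0.
apply: ereal_inf_lbound; exists (f @` S) => //; split.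
  exact: sub_countable (card_image_le _ _) cS.
move=> z /AS[p Sp pz]; exists (f p); first by exists p.
move=> i; rewrite /= !mxE; have := pz i; rewrite !mxE.
have := c0 i; move: (c 0 i) (z 0 i) => u v u0 /andP[h1 h2].
have -> : u^-1 * p.1 0 i - t 0 i / u = (p.1 0 i - t 0 i) / u by ring.
have -> : u^-1 * p.2 0 i - t 0 i / u = (p.2 0 i - t 0 i) / u by ring.
by rewrite ler_pdivlMr// ler_pdivrMr//; apply/andP; split; lra.
Qed.

Lemma lebesgue_outer_dmap c t A : dpos c ->
  lebesgue_outer (dmap c t @^-1` A) = ((ddet c)^-1%:E * lebesgue_outer A)%E.
Proof.
move=> c0; apply/eqP; rewrite eq_le lebesgue_outer_dmap_le//=.
rewrite muleC -lee_pdivlMr ?invr_gt0 ?ddet_gt0// invrK muleC.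
have := @lebesgue_outer_dmap_le (dminv c) (dmtrans c t) (dmap c t @^-1` A)
  (dpos_inv c0).
rewrite ddet_inv invrK; congr (_ <= _)%E; congr lebesgue_outer.
by apply/seteqP; split => z; rewrite /= dmapVK.
Qed.

Lemma lebesgue_measurableP A :
  lebesgue_measurable A <-> (@lebesgue_outer R d).-caratheodory A.
Proof. by []. Qed.

(** The Caratheodory condition is transported: every test set is itself a preimage under the
    bijection, and the outer measure only picks up a constant factor. *)
Lemma measurable_dmap c t A : dpos c -> lebesgue_measurable A ->
  lebesgue_measurable (dmap c t @^-1` A).
Proof.
move=> c0 /lebesgue_measurableP mA; apply/lebesgue_measurableP => X.
have [X' ->] : exists X', X = dmap c t @^-1` X'.
  exists (dmap (dminv c) (dmtrans c t) @^-1` X).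
  by apply/seteqP; split => z; rewrite /= dmapK.
have h B := lebesgue_outer_dmap t B c0.
apply: etrans (_ : _ = ((ddet c)^-1%:E * lebesgue_outer (X' `&` A)
  + (ddet c)^-1%:E * lebesgue_outer (X' `&` ~` A))%E) _; last first.
  by congr (_ + _)%E; exact: esym (h _).
rewrite h.
by rewrite -muleDr// ?ge0_adde_def ?inE ?lebesgue_outer_ge0// (mA X').
Qed.

End diagonal_maps.

(** * Boxes, Borel sets and continuous functions *)

Section boxes.
Context (R : realType) (d : nat).
Implicit Types (p : 'rV[R]_d * 'rV[R]_d) (A X : set 'rV[R]_d).

Lemma lebesgue_outer_box p : (lebesgue_outer (box p) <= (box_volume p)%:E)%E.
Proof.
apply: ereal_inf_lbound; exists [set p].
  by split; [exact: countable1|rewrite bigcup_set1].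
by rewrite esum_set1// box_volume_ge0.
Qed.

(** Each box of a cover of the test set is cut at height [a] into [lo] and [hi]. The [Num.max 0] in
    [box_volume] keeps the volumes additive even when a piece is empty. *)
Lemma measurable_halfspace (i : 'I_d) (a : R) :
  lebesgue_measurable [set z : 'rV[R]_d | z 0 i <= a].
Proof.
apply/lebesgue_measurableP/le_caratheodory_measurable => X.
set H := [set z | _].
apply: le_ereal_inf_tmp => _ [S [cS XS] <-].
pose lo p := (p.1, \row_j (if j == i then Num.min (p.2 0 j) a else p.2 0 j)).
pose hi p := (\row_j (if j == i then Num.max (p.1 0 j) a else p.1 0 j), p.2).
have volE p : ((box_volume p)%:E = (box_volume (lo p))%:E + (box_volume (hi p))%:E)%E.
  rewrite -EFinD /box_volume (bigD1 i)//= [in RHS](bigD1 i)//=.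
  rewrite [X in _ = (_ + X)%:E](bigD1 i)//= !mxE eqxx.
  rewrite [X in _ = (_ * X + _)%:E](eq_bigr (fun j => Num.max 0 (p.2 0 j - p.1 0 j))); last first.
    by move=> j ji; rewrite !mxE (negbTE ji).
  rewrite [X in _ = (_ + _ * X)%:E](eq_bigr (fun j => Num.max 0 (p.2 0 j - p.1 0 j))); last first.
    by move=> j ji; rewrite !mxE (negbTE ji).
  rewrite -mulrDl; congr (_ * _)%:E.
  move: (p.1 0 i) (p.2 0 i) => u v; rewrite /Num.max /Num.min.
  case: (ltP v a) => ?; case: (ltP u a) => ?; repeat (case: ltP => ?); lra.
rewrite (eq_esum (fun p _ => volE p)) esumD; last 2 first.
- by move=> p _; exact: box_volume_ge0.
- by move=> p _; exact: box_volume_ge0.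
apply: leeD.
- apply: (@le_trans _ _ (lebesgue_outer (\bigcup_(p in S) box (lo p)))).
    apply: le_outer_measure => z [/XS[p Sp pz] Hz]; exists p => // j.
    have := pz j; rewrite /= mxE; case: eqP => // -> /andP[-> ?] /=.
    by rewrite le_min; apply/andP.
  apply: le_trans (outer_measure_bigcup_countable _ _ cS) _.
  by apply: le_esum => p _; exact: lebesgue_outer_box.
- apply: (@le_trans _ _ (lebesgue_outer (\bigcup_(p in S) box (hi p)))).
    apply: le_outer_measure => z [/XS[p Sp pz] /negP Hz]; exists p => // j.
    have := pz j; rewrite /= mxE; case: eqP => // -> /andP[? ->].
    by rewrite ge_max andbT; apply/andP; split => //; rewrite ltW// ltNge.
  apply: le_trans (outer_measure_bigcup_countable _ _ cS) _.
  by apply: le_esum => p _; exact: lebesgue_outer_box.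
Qed.

Lemma rv_ballP (z w : 'rV[R]_d) (r : R) :
  ball z r w <-> 0 < r /\ forall i, `|z 0 i - w 0 i| < r.
Proof.
split=> [[r0 h]|[r0 h]]; split => // i; first exact: h.
by move=> j; rewrite (ord1 i); exact: h.
Qed.

Lemma le_coord (x : 'rV[R]_d) i : `|x 0 i| <= `|x|.
Proof.
rewrite [leRHS]/Num.norm /= mx_normrE.
by apply: (le_bigmax _ (fun ij : 'I_1 * 'I_d => `|x ij.1 ij.2|) (0, i)).
Qed.

Lemma rv_normP (x : 'rV[R]_d) (r : R) : 0 <= r ->
  `|x| <= r <-> forall i, `|x 0 i| <= r.
Proof.
move=> r0; split=> [h i|h]; first exact: le_trans (le_coord x i) h.
rewrite [leLHS]/Num.norm /= mx_normrE; apply/bigmax_leP; split => // -[i j] _ /=.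
by rewrite (ord1 i).
Qed.

Lemma rv_ball_norm (z w : 'rV[R]_d) (r : R) : ball z r w <-> `|z - w| < r.
Proof. by rewrite -ball_normE. Qed.

Lemma rv_openP (U : set 'rV[R]_d) :
  open U <-> forall z, U z -> exists2 r, 0 < r & forall w, `|z - w| < r -> U w.
Proof.
rewrite openE; split=> [oU z /oU /nbhs_ballP[r /= r0 zr]|h z /h[r r0 zr]].
  by exists r => // w zw; apply: zr; apply/rv_ball_norm.
by apply/nbhs_ballP; exists r => // w /rv_ball_norm; exact: zr.
Qed.

(** Closed lattice cubes. Their overlap along faces is harmless, since they only serve as countable
    covers by sets of small diameter. *)
Definition cell (n : nat) (k : {ffun 'I_d -> int}) : 'rV[R]_d * 'rV[R]_d :=
  (\row_i ((k i)%:~R / n.+1%:R), \row_i (((k i)%:~R + 1) / n.+1%:R)).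

Lemma cell_cover n z : exists k, box (cell n k) z.
Proof.
exists [ffun i => Num.floor (z 0 i * n.+1%:R)] => i.
rewrite !mxE /= !ffunE ler_pdivrMr// ler_pdivlMr// floor_le_tmp/=.
rewrite -(intrD _ _ 1); exact/ltW/floorD1_gt.
Qed.

Lemma cell_small n k z w : box (cell n k) z -> box (cell n k) w ->
  `|z - w| <= n.+1%:R^-1.
Proof.
move=> hz hw; apply/rv_normP => [|i]; first by rewrite invr_ge0.
have := hz i; have := hw i; rewrite !mxE /= mulrDl mul1r ler_norml.
by move: (_ / _) => u; move: (_^-1) => v; lra.
Qed.

Lemma measurable_coord (i : 'I_d) :
  measurable_fun [set: lebesgue_space R d] (fun z : lebesgue_space R d => (z : 'rV[R]_d) 0 i).
Proof.
apply: (measurability _ (measurable_realfun.RGenOInfty.measurableE R)) => _ [_ [a ->] <-].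
rewrite setTI; have := measurableC (measurable_halfspace i a).
congr measurable; apply/seteqP; split => z /=; rewrite in_itv/= andbT.
  by move=> /negP; rewrite -ltNge.
by move=> h; apply/negP; rewrite -ltNge.
Qed.

Lemma measurable_box p : lebesgue_measurable (box p).
Proof.
have -> : box p = \bigcap_(i in [set: 'I_d]) [set z | p.1 0 i <= z 0 i <= p.2 0 i].
  by apply/seteqP; split => [z h i _|z h i] /=; exact: h.
apply: (@fin_bigcap_measurable _ (lebesgue_space R d)) => // i _.
have := @measurable_coord i measurableT `[p.1 0 i, p.2 0 i]%classic.
by rewrite setTI; move=> /(_ (measurable_itv _)).
Qed.

(** An open set is the union of the countably many lattice cubes it contains, the mesh being chosen
    below the radius of a ball around the given point. *)
Lemma measurable_open (U : set 'rV[R]_d) : open U -> lebesgue_measurable U.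
Proof.
move=> /rv_openP oU.
pose F (nk : nat * {ffun 'I_d -> int}) := box (cell nk.1 nk.2) `&`
  [set z | box (cell nk.1 nk.2) `<=` U].
have -> : U = \bigcup_nk F nk.
  apply/seteqP; split=> [z Uz|z [nk _ [h]]]; last exact.
  have [r r0 rU] := oU _ Uz.
  pose n := Num.trunc r^-1; have [k zk] := cell_cover n z.
  exists (n, k) => //; split => // w wk; apply: rU.
  apply: le_lt_trans (cell_small zk wk) _.
  rewrite invf_plt ?posrE//; exact: truncnS_gt.
apply: (@countable_bigcupT_measurable _ (lebesgue_space R d)) => // nk.
have [h|h] := pselect (box (cell nk.1 nk.2) `<=` U).
  have -> : F nk = box (cell nk.1 nk.2) by apply/seteqP; split=> z // [].
  exact: measurable_box.
have -> : F nk = set0 by apply/seteqP; split=> z // [].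
exact: measurable0.
Qed.

Lemma measurable_closed (U : set 'rV[R]_d) : closed U -> lebesgue_measurable U.
Proof.
move=> cU; rewrite -(setCK U).
by apply: (@measurableC _ (lebesgue_space R d)); apply: measurable_open; exact: closed_openC.
Qed.

Lemma measurable_continuous (f : 'rV[R]_d -> R) : continuous f ->
  measurable_fun [set: lebesgue_space R d] (f : lebesgue_space R d -> R).
Proof.
move=> cf; apply: (measurability _ (measurable_realfun.RGenOpens.measurableE R)).
move=> _ [_ [a [b ->]] <-]; rewrite setTI.
by apply: measurable_open; apply: open_comp => // z _; exact: cf.
Qed.

(** Measurability for the product sigma-algebra, as Fubini requires for a kernel [k (z - w)]: an
    open set of the product is a countable union of products of cubes. *)
Lemma measurable_continuous2 (f : 'rV[R]_d * 'rV[R]_d -> R) : continuous f ->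
  measurable_fun [set: lebesgue_space R d * lebesgue_space R d]
    (f : lebesgue_space R d * lebesgue_space R d -> R).
Proof.
move=> cf; apply: (measurability _ (measurable_realfun.RGenOpens.measurableE R)).
move=> _ [_ [a [b ->]] <-]; rewrite setTI.
set U := (X in measurable X).
have oU : open (U : set ('rV[R]_d * 'rV[R]_d)) by apply: open_comp => // z _; exact: cf.
pose F (nk : nat * ({ffun 'I_d -> int} * {ffun 'I_d -> int})) :=
  (box (cell nk.1 nk.2.1) `*` box (cell nk.1 nk.2.2)) `&`
  [set z | box (cell nk.1 nk.2.1) `*` box (cell nk.1 nk.2.2) `<=` U].
have -> : U = \bigcup_nk F nk.
  apply/seteqP; split=> [[z1 z2] Uz|z [nk _ [h]]]; last exact.
  move: oU; rewrite openE => /(_ _ Uz) /nbhs_ballP[r /= r0 rU].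
  pose n := Num.trunc r^-1.
  have [k1 zk1] := cell_cover n z1; have [k2 zk2] := cell_cover n z2.
  exists (n, (k1, k2)) => //; split => // -[w1 w2] [/= wk1 wk2]; apply: rU.
  have nr : n.+1%:R^-1 < r by rewrite invf_plt ?posrE//; exact: truncnS_gt.
  split; apply/rv_ball_norm.
    exact: le_lt_trans (cell_small zk1 wk1) _.
  exact: le_lt_trans (cell_small zk2 wk2) _.
apply: countable_bigcupT_measurable => // nk.
have [h|h] := pselect (box (cell nk.1 nk.2.1) `*` box (cell nk.1 nk.2.2) `<=` U).
  have -> : F nk = box (cell nk.1 nk.2.1) `*` box (cell nk.1 nk.2.2).
    by apply/seteqP; split=> z // [].
  by apply: measurableX; exact: measurable_box.
have -> : F nk = set0 by apply/seteqP; split=> z // [].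
exact: measurable0.
Qed.

End boxes.

Lemma measurable_bigcup_countable d (T : measurableType d) (I : Type) (D : set I)
    (F : I -> set T) : countable D -> (forall i, D i -> measurable (F i)) ->
  measurable (\bigcup_(i in D) F i).
Proof.
move=> /countable_injP[f finj] mF.
have -> : \bigcup_(i in D) F i = \bigcup_n \bigcup_(i in [set i | D i /\ f i = n]) F i.
  apply/seteqP; split=> [x [p Sp Fx]|x [n _ [p [Sp _] Fx]]]; last by exists p.
  by exists (f p) => //; exists p.
apply: bigcupT_measurable => n.
have [->|/set0P[p [Dp fp]]] := eqVneq [set i | D i /\ f i = n] set0.
  by rewrite bigcup_set0.
have -> : [set i | D i /\ f i = n] = [set p].
  apply/seteqP; split=> [r [Sr fr]|_ -> //].
  by apply: finj; rewrite ?inE// fr fp.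
by rewrite bigcup_set1; exact: mF.
Qed.

(** * Translations, positivity on open sets and approximation by boxes *)

Section volume.
Context (R : realType) (d : nat).
Implicit Types (p : 'rV[R]_d * 'rV[R]_d) (A B X : set 'rV[R]_d) (u t : 'rV[R]_d).

(** Written as a preimage, so the set itself moves by [- u]. *)
Definition sh u A : set 'rV[R]_d := [set z | A (z + u)].

Lemma sh_dmap u A : sh u A = dmap (const_mx 1) u @^-1` A.
Proof.
apply/funext => z; rewrite /sh /preimage /=; congr A.
by apply/rowP => i; rewrite !mxE mul1r.
Qed.

Lemma dpos1 : dpos (const_mx 1 : 'rV[R]_d).
Proof. by move=> i; rewrite mxE. Qed.

Lemma ddet1 : ddet (const_mx 1 : 'rV[R]_d) = 1.
Proof. by rewrite /ddet big1// => i _; rewrite mxE. Qed.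

Lemma volume_dmap c t A : dpos c ->
  (volume (dmap c t @^-1` A) = (ddet c)^-1%:E * volume A)%E.
Proof. by move=> c0; exact: lebesgue_outer_dmap. Qed.

Lemma volume_sh u A : volume (sh u A) = volume A.
Proof. by rewrite sh_dmap volume_dmap ?ddet1 ?invr1 ?mul1e//; exact: dpos1. Qed.

Lemma measurable_sh u A : lebesgue_measurable A -> lebesgue_measurable (sh u A).
Proof. by rewrite sh_dmap; apply: measurable_dmap; exact: dpos1. Qed.

Lemma shsh u t A : sh u (sh t A) = sh (u + t) A.
Proof. by apply/funext => z; rewrite /sh /= addrA. Qed.

Lemma sh0 A : sh 0 A = A.
Proof. by apply/funext => z; rewrite /sh /= addr0. Qed.

Lemma le_volume A B : A `<=` B -> (volume A <= volume B)%E.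
Proof. exact: le_lebesgue_outer. Qed.

Lemma volume_ge0 A : (0 <= volume A)%E.
Proof. exact: lebesgue_outer_ge0. Qed.

Lemma volume_bigcup_countable (I : choiceType) (S : set I) (F : I -> set 'rV[R]_d) :
  countable S -> (volume (\bigcup_(p in S) F p) <= \esum_(p in S) volume (F p))%E.
Proof. exact: outer_measure_bigcup_countable. Qed.

Lemma volumeU_le A B : (volume (A `|` B) <= volume A + volume B)%E.
Proof. exact: (outer_measureU2 (@lebesgue_outer R d)). Qed.

Lemma volume_bigcup_seq (I : choiceType) (s : seq I) (F : I -> set 'rV[R]_d) :
  (volume (\bigcup_(p in [set` s]) F p) <= \sum_(p <- s) volume (F p))%E.
Proof.
elim: s => [|i s IH]; first by rewrite set_nil bigcup_set0 big_nil measure0.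
rewrite big_cons (_ : [set` i :: s] = i |` [set` s]); last first.
  apply/seteqP; split=> j; rewrite /= inE; first by move=> /orP[/eqP|]; [left|right].
  by move=> [->|->]; rewrite ?eqxx ?orbT.
rewrite bigcup_setU1; apply: le_trans (volumeU_le _ _) _.
exact: leeD.
Qed.

Lemma volume_box p : (volume (box p) <= (box_volume p)%:E)%E.
Proof. exact: lebesgue_outer_box. Qed.

Lemma volume_bounded A (M : R) : (forall z, A z -> `|z| <= M) -> (volume A < +oo)%E.
Proof.
move=> AM; apply: le_lt_trans (ltry (box_volume (const_mx (- M), const_mx M))).
apply: le_trans (volume_box _); apply: le_volume => z /AM zM i.
by rewrite !mxE -ler_norml (le_trans (le_coord z i)).
Qed.

(** If [U] were null, all sufficiently small cubes would be null, as they can be translated into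
    [U], and then so would the whole space. The positive volume of [A] stands in for the exact
    volume of some box; in the end it comes from the isoperimetric region. *)
Lemma volume_open_gt0 A (U : set 'rV[R]_d) : (0 < volume A)%E -> open U ->
  U !=set0 -> (0 < volume U)%E.
Proof.
move=> A0 /rv_openP oU [z /oU[r r0 zU]]; rewrite lt_neqAle volume_ge0 andbT eq_sym.
apply: contraTneq A0 => U0; rewrite -leNgt.
pose n := Num.trunc r^-1.
have nr : n.+1%:R^-1 < r by rewrite invf_plt ?posrE//; exact: truncnS_gt.
apply: (@le_trans _ _ (volume (\bigcup_k box (@cell R d n k)))).
  by apply: le_volume => w _; have [k] := cell_cover n w; exists k.
apply: le_trans (volume_bigcup_countable _ _) _; first exact: countableP.
rewrite esum1// => k _; apply/eqP; rewrite eq_le volume_ge0 andbT -U0.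
rewrite -(volume_sh (z - (cell R n k).1) U); apply: le_volume => w wk; apply: zU.
apply: le_lt_trans nr; rewrite (_ : _ - _ = (cell R n k).1 - w); last by apply/rowP => i; rewrite !mxE; ring.
apply: cell_small (wk) => i; rewrite lexx /= !mxE mulrDl lerDl.
by rewrite mul1r invr_ge0.
Qed.

(** A countable box cover exceeds the volume of [A] by at most e/2, and a finite subfamily carries
    all but e/2 of its total volume. *)
Lemma volume_approx A (e : R) : 0 < e -> (volume A < +oo)%E -> lebesgue_measurable A ->
  exists s : seq ('rV[R]_d * 'rV[R]_d),
    (volume (A `+` \bigcup_(p in [set` s]) box p) <= e%:E)%E.
Proof.
move=> e0 Afin mA; have e20 : 0 < e / 2 by rewrite divr_gt0.
have Afn : volume A \is a fin_num by rewrite ge0_fin_numE ?volume_ge0.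
have [_ [S [cS AS] <-] Sle] := lb_ereal_inf_adherent e20 Afn.
have Sfn : (\esum_(p in S) (box_volume p)%:E)%E \is a fin_num.
  rewrite ge0_fin_numE ?esum_ge0// => [|p _]; last exact: box_volume_ge0.
  apply: lt_trans Sle _; rewrite -[ereal_inf _]/(volume A).
  by rewrite -(fineK Afn) -EFinD ltry.
have [_ [F [finF FS] <-] Fle] := ub_ereal_sup_adherent e20 Sfn.
have /finite_seqP[s Fs] := finF; exists s; rewrite -Fs.
have mS : lebesgue_measurable (\bigcup_(p in S) box p).
  by apply: measurable_bigcup_countable => // p _; exact: measurable_box.
have mF : lebesgue_measurable (\bigcup_(p in F) box p).
  by apply: (@fin_bigcup_measurable _ (lebesgue_space R d)) => // p _; exact: measurable_box.
have vS : (volume (\bigcup_(p in S) box p) <= \esum_(p in S) (box_volume p)%:E)%E.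
  apply: le_trans (volume_bigcup_countable _ cS) _.
  by apply: le_esum => p _; exact: volume_box.
have SA : (volume (\bigcup_(p in S) box p `\` A) <= (e / 2)%:E)%E.
  rewrite (measureD mS mA); last by apply: le_lt_trans vS _; rewrite -ge0_fin_numE ?esum_ge0// => p _; exact: box_volume_ge0.
  rewrite (setIidr AS) leeBlDr//; apply: le_trans vS _.
  by rewrite addeC; exact: ltW.
have AF : (volume (A `\` \bigcup_(p in F) box p) <= (e / 2)%:E)%E.
  apply: (@le_trans _ _ (volume (\bigcup_(p in S `&` ~` F) box p))).
    apply: le_volume => z [/AS[p Sp zp] zF]; exists p => //; split => // Fp.
    by apply: zF; exists p.
  apply: le_trans (volume_bigcup_countable _ _) _.
    by apply: sub_countable cS; apply: subset_card_le; exact: subIsetl.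
  apply: (@le_trans _ _ (\esum_(p in S `&` ~` F) (box_volume p)%:E)).
    by apply: le_esum => p _; exact: volume_box.
  move: Fle; rewrite -[ereal_sup _]/(\esum_(p in S) (box_volume p)%:E).
  rewrite (esumID F S) => [|p _]; last exact: box_volume_ge0.
  rewrite (setIidr FS) esum_fset// => [|p _]; last exact: box_volume_ge0.
  rewrite fsumEFin//; set x := (\esum_(_ in _) _)%E.
  case: x => [x||]//; last by rewrite leNye.
  rewrite -[X in (X < _)%E]/((\sum_(i \in F) box_volume i + x - e / 2)%:E).
  by rewrite lte_fin lee_fin; lra.
apply: (@le_trans _ _ (volume ((\bigcup_(p in S) box p `\` A) `|` (A `\` \bigcup_(p in F) box p)))).
  apply: le_volume => z [[Az nz]|[[p Fp zp] nA]]; first by right.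
  by left; split => //; exists p => //; exact: FS.
by apply: le_trans (volumeU_le _ _) _; rewrite (splitr e) EFinD leeD.
Qed.

Lemma volume_sigma_finite : sigma_finite setT (@volume R d).
Proof.
exists (fun n => box (const_mx (- n%:R), const_mx n%:R)).
  apply/seteqP; split => // z _; exists (Num.trunc `|z|).+1 => // i.
  rewrite !mxE /= -ler_norml; apply: le_trans (le_coord z i) _.
  exact/ltW/truncnS_gt.
move=> n; split; first exact: measurable_box.
by apply: le_lt_trans (volume_box _) _; exact: ltry.
Qed.

HB.instance Definition _ :=
  @Measure_isSigmaFinite.Build _ (lebesgue_space R d) R (@volume R d) volume_sigma_finite.

End volume.

(** * Integrals of bounded functions with bounded support *)

Section bounded_integrable.
Context d (T : measurableType d) (R : realType) (mu : {measure set T -> \bar R}).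
Context (A : set T) (f : T -> R) (M : R) (mA : measurable A).
Context (Afin : (mu A < +oo)%E) (mf : measurable_fun setT f).
Context (fM : forall x, `|f x| <= M) (fA : forall x, ~ A x -> f x = 0).

Let cst_indic_integrable : mu.-integrable setT (EFin \o (fun x => `|M| * \1_A x)).
Proof.
apply/integrableP; split.
  apply/measurable_EFinP/measurable_funM; first exact: measurable_cst.
  exact: measurable_indic.
rewrite (eq_integral (fun x => `|M|%:E * (\1_A x)%:E)%E); last first.
  by move=> x _ /=; rewrite normrM normr_id -EFinM (ger0_norm (ler0n _ _)).
rewrite ge0_integralZl_EFin//; last exact/measurable_EFinP/measurable_indic.
by rewrite integral_indic// setIT lte_mul_pinfty.
Qed.

Let f_le x : `|f x| <= `|M| * \1_A x.
Proof.
rewrite indicE; case: (boolP (x \in A)) => [_|]; last first.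
  by rewrite notin_setE => /fA ->; rewrite normr0 mulr0.
by rewrite mulr1 (le_trans (fM x))// ler_norm.
Qed.

Lemma bounded_fin_integrable : mu.-integrable setT (EFin \o f).
Proof.
apply: le_integrable cst_indic_integrable => //; first exact/measurable_EFinP.
by move=> x _ /=; rewrite lee_fin normrM normr_id (ger0_norm (ler0n _ _)) f_le.
Qed.

Lemma le_norm_Rintegral_bounded : `|Rintegral mu setT f| <= `|M| * fine (mu A).
Proof.
apply: le_trans (le_normr_Rintegral _ bounded_fin_integrable) _ => //.
have -> : `|M| * fine (mu A) = Rintegral mu setT (fun x => `|M| * \1_A x).
  rewrite RintegralZl//.
    by rewrite /Rintegral integral_indic// setIT.
  apply/integrableP; split; first exact/measurable_EFinP/measurable_indic.
  rewrite (eq_integral (fun x => (\1_A x)%:E)); last first.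
    by move=> x _ /=; rewrite (ger0_norm (ler0n _ _)).
  by rewrite integral_indic// setIT.
apply: le_Rintegral => //.
have : mu.-integrable setT (abse \o (EFin \o f)).
  exact: integrable_abse bounded_fin_integrable.
by apply: eq_integrable.
Qed.

End bounded_integrable.

(** The pushforward of [mu] under [phi] is [k] times [mu]. The formula for nonnegative functions is
    applied to the positive and negative parts, whose integrals are finite. *)
Lemma Rintegral_pushforward d (T : measurableType d) (R : realType)
    (mu : {measure set T -> \bar R}) (phi : T -> T) (k : R) (f : T -> R) :
  measurable_fun setT phi -> 0 <= k ->
  (forall A, measurable A -> mu (phi @^-1` A) = (k%:E * mu A)%E) ->
  mu.-integrable setT (EFin \o f) ->
  Rintegral mu setT (f \o phi) = k * Rintegral mu setT f.
Proof.
move=> mphi k0 muphi intf.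
have mf : measurable_fun setT f by exact/measurable_EFinP/(measurable_int _ intf).
have key (g : T -> \bar R) : measurable_fun setT g -> (forall x, 0 <= g x)%E ->
    (\int[mu]_x g (phi x) = k%:E * \int[mu]_x g x)%E.
  move=> mg g0.
  have := ge0_integral_pushforward mphi mu measurableT (measurable_funTS mg) (fun x _ => g0 x).
  rewrite preimage_setT => <-.
  rewrite -(@ge0_integral_mscale _ _ _ mu _ measurableT (NngNum k0))//.
  by apply: eq_measure_integral => A mA _ /=; rewrite /pushforward muphi.
rewrite /Rintegral integralE [in RHS]integralE.
have mfE : measurable_fun setT (EFin \o f) by exact/measurable_EFinP.
rewrite -[fun x => ((f \o phi) x)%:E]/((EFin \o f) \o phi) funepos_comp funeneg_comp.
rewrite key//; last exact: measurable_funepos.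
rewrite key//; last exact: measurable_funeneg.
rewrite -muleBr//; last first.
  by apply: fin_num_adde_defr; exact: (integrable_fin_num measurableT (integrable_funepos measurableT intf)).
rewrite fineM// fin_numB; apply/andP; split.
  exact: (integrable_fin_num measurableT (integrable_funepos measurableT intf)).
exact: (integrable_fin_num measurableT (integrable_funeneg measurableT intf)).
Qed.

Lemma Rintegral_fubini d1 d2 (T1 : measurableType d1) (T2 : measurableType d2)
    (R : realType) (m1 : {sigma_finite_measure set T1 -> \bar R})
    (m2 : {sigma_finite_measure set T2 -> \bar R}) (h : T1 * T2 -> R)
    (A : set T1) (B : set T2) (M : R) :
  measurable A -> measurable B -> (m1 A < +oo)%E -> (m2 B < +oo)%E ->
  measurable_fun setT h -> (forall x, `|h x| <= M) ->
  (forall x, ~ A x.1 -> h x = 0) -> (forall x, ~ B x.2 -> h x = 0) ->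
  Rintegral m1 setT (fun x => Rintegral m2 setT (fun y => h (x, y))) =
  Rintegral m2 setT (fun y => Rintegral m1 setT (fun x => h (x, y))).
Proof.
move=> mA mB Afin Bfin mh hM hA hB.
have int1 x : m2.-integrable setT (EFin \o (fun y => h (x, y))).
  apply: (@bounded_fin_integrable _ _ _ _ B _ M) => // [|y nB]; last exact: hB.
  exact: measurableT_comp mh (measurable_pair1 x).
have int2 y : m1.-integrable setT (EFin \o (fun x => h (x, y))).
  apply: (@bounded_fin_integrable _ _ _ _ A _ M) => // [|x nA]; last exact: hA.
  exact: measurableT_comp mh (measurable_pair2 y).
have inth : (m1 \x m2)%E.-integrable setT (EFin \o h).
  apply: (@bounded_fin_integrable _ _ _ _ (A `*` B) _ M) => //.
  - exact: measurableX.
  - rewrite [ltLHS](_ : _ = m1 A * m2 B)%E; last exact: product_measure1E.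
    by rewrite lte_mul_pinfty// ge0_fin_numE.
  - move=> x nAB; have [Ax|/hA//] := pselect (A x.1).
    by apply: hB => Bx; apply: nAB.
rewrite /Rintegral; congr fine.
transitivity (\int[m1]_x \int[m2]_y (h (x, y))%:E)%E.
  by apply: eq_integral => x _; rewrite fineK// (integrable_fin_num _ (int1 x)).
rewrite (Fubini inth); apply: eq_integral => y _.
by rewrite fineK// (integrable_fin_num _ (int2 y)).
Qed.

(** * Rules for integrals of tame functions *)

Section integral.
Context (R : realType) (d : nat).
Local Notation rV := 'rV[R]_d.
Local Notation L := (lebesgue_space R d).
Implicit Types (f g : rV -> R) (A B : set rV).

Definition lmfun f : Prop := measurable_fun [set: L] (f : L -> R).

(** A single [M] bounds both the values and the support. Such functions are integrable and stable
    under sums, translations and products with bounded measurable functions, so integrability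
    reduces to closure properties. *)
Definition tame f : Prop :=
  lmfun f /\ exists M : R, forall z, `|f z| <= M /\ (M < `|z| -> f z = 0).

(** [Rintegral] takes the real part of an extended integral; on [tame] functions nothing is lost. *)
Definition intg f : R := Rintegral (@volume R d) setT f.

Lemma tame_integrable f : tame f ->
  (@volume R d).-integrable setT (EFin \o (f : L -> R)).
Proof.
move=> [mf [M hM]].
have M0 : 0 <= M by apply: le_trans (hM 0).1.
pose Q := box (const_mx (- M), const_mx M : rV).
have mQ : lebesgue_measurable Q by exact: measurable_box.
apply: (@bounded_fin_integrable _ L R (@volume R d) Q f M) => //.
- by apply: le_lt_trans (volume_box _) _; rewrite ltry.
- by move=> x; exact: (hM x).1.
- move=> x nQ; apply: (hM x).2; rewrite ltNge; apply/negP => h; apply: nQ => i.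
  by rewrite !mxE /= -ler_norml (le_trans (le_coord _ i)).
Qed.

Lemma lmfunD f g : lmfun f -> lmfun g -> lmfun (fun z => f z + g z).
Proof. exact: measurable_funD. Qed.

Lemma lmfunM f g : lmfun f -> lmfun g -> lmfun (fun z => f z * g z).
Proof. exact: measurable_funM. Qed.

Lemma lmfun_cst (a : R) : lmfun (fun=> a).
Proof. exact: measurable_cst. Qed.

Lemma lmfun_indic A : lebesgue_measurable A -> lmfun \1_A.
Proof. by move=> mA; exact: (measurable_indic (mA : measurable (A : set L))). Qed.

Lemma tameM g f (M : R) : lmfun g -> (forall z, `|g z| <= M) -> tame f ->
  tame (fun z => g z * f z).
Proof.
move=> mg gM [mf [N hN]]; split; first exact: lmfunM.
have M0 : 0 <= M by apply: le_trans (gM 0).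
exists (Num.max (M * N) N) => z; split.
  rewrite normrM le_max ler_pM//; exact: (hN z).1.
by rewrite gt_max => /andP[_ /(hN z).2 ->]; rewrite mulr0.
Qed.

Lemma tameZ (a : R) f : tame f -> tame (fun z => a * f z).
Proof. by apply: (@tameM (fun=> a) f `|a|) => //; exact: lmfun_cst. Qed.

Lemma tameD f g : tame f -> tame g -> tame (fun z => f z + g z).
Proof.
move=> [mf [M hM]] [mg [N hN]]; split; first exact: lmfunD.
exists (Num.max (M + N) (Num.max M N)) => z; split.
  rewrite le_max (le_trans (ler_normD _ _))//.
  by rewrite lerD ?(hM z).1 ?(hN z).1.
by rewrite !gt_max => /and3P[_ /(hM z).2 -> /(hN z).2 ->]; rewrite addr0.
Qed.

Lemma tame0 : tame (fun=> 0).
Proof.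
split; first exact: lmfun_cst.
by exists 0 => z; rewrite normr0.
Qed.

Lemma tameB f g : tame f -> tame g -> tame (fun z => f z - g z).
Proof.
move=> tf tg; rewrite (_ : (fun z => _) = (fun z => f z + -1 * g z)).
  by apply: tameD => //; exact: tameZ.
by apply/funext => z; rewrite mulN1r.
Qed.

Lemma tame_sum (I : Type) (s : seq I) (P : pred I) (F : I -> rV -> R) :
  (forall i, tame (F i)) -> tame (fun z => \sum_(i <- s | P i) F i z).
Proof.
move=> tF; elim: s => [|i s IH].
  by under eq_fun do rewrite big_nil; exact: tame0.
under eq_fun do rewrite big_cons; case: (P i) => //; exact: tameD.
Qed.

Lemma tame_norm f : tame f -> tame (fun z => `|f z|).
Proof.
move=> [mf [M hM]]; split; first exact: measurableT_comp.
by exists M => z; rewrite normr_id; split; [exact: (hM z).1|move/(hM z).2->; rewrite normr0].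
Qed.

Lemma normr_indic A z : `|\1_A z| <= 1 :> R.
Proof. by rewrite indicE; case: (_ \in _); rewrite ?normr1 ?normr0. Qed.

Lemma tame_indicM A f : lebesgue_measurable A -> tame f -> tame (fun z => \1_A z * f z).
Proof. by move=> mA; apply: tameM (normr_indic A); exact: lmfun_indic. Qed.

Lemma tame_indic A M : lebesgue_measurable A -> (forall z, A z -> `|z| <= M) ->
  tame (\1_A : rV -> R).
Proof.
move=> mA AM; split; first exact: lmfun_indic.
exists (Num.max 1 M) => z; split; first by rewrite le_max normr_indic.
rewrite gt_max => /andP[_ zM]; rewrite indicE memNset// => /AM.
by rewrite leNgt zM.
Qed.

Lemma intgD f g : tame f -> tame g ->
  intg (fun z => f z + g z) = intg f + intg g.
Proof. by move=> tf tg; apply: RintegralD => //; exact: tame_integrable. Qed.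

Lemma intgB f g : tame f -> tame g ->
  intg (fun z => f z - g z) = intg f - intg g.
Proof. by move=> tf tg; apply: RintegralB => //; exact: tame_integrable. Qed.

Lemma intgZ (a : R) f : tame f -> intg (fun z => a * f z) = a * intg f.
Proof. by move=> tf; apply: RintegralZl => //; exact: tame_integrable. Qed.

Lemma intg0 : intg (fun=> 0) = 0.
Proof. by rewrite /intg Rintegral_cst// mul0r. Qed.

Lemma intgN f : tame f -> intg (fun z => - f z) = - intg f.
Proof.
by move=> tf; under eq_fun do rewrite -mulN1r; rewrite intgZ// mulN1r.
Qed.

Lemma intg_sum (I : Type) (s : seq I) (P : pred I) (F : I -> rV -> R) :
  (forall i, tame (F i)) ->
  intg (fun z => \sum_(i <- s | P i) F i z) = \sum_(i <- s | P i) intg (F i).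
Proof.
move=> tF; elim: s => [|i s IH].
  by under eq_fun do rewrite big_nil; rewrite intg0 big_nil.
under eq_fun do rewrite big_cons; rewrite big_cons; case: ifPn => // _.
by rewrite intgD ?IH//; exact: tame_sum.
Qed.

Lemma le_intg f g : tame f -> tame g -> (forall z, f z <= g z) -> intg f <= intg g.
Proof. by move=> tf tg fg; apply: le_Rintegral => //; exact: tame_integrable. Qed.

Lemma intg_ge0 f : (forall z, 0 <= f z) -> 0 <= intg f.
Proof. by move=> f0; apply: Rintegral_ge0. Qed.

Lemma le_norm_intg f : tame f -> `|intg f| <= intg (fun z => `|f z|).
Proof. by move=> tf; apply: le_normr_Rintegral => //; exact: tame_integrable. Qed.

Lemma intg_indic A : lebesgue_measurable A -> intg \1_A = fine (volume A).
Proof.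
move=> mA; rewrite /intg /Rintegral integral_indic ?setIT//.
Qed.

Lemma intg_bound f A (M : R) : tame f -> lebesgue_measurable A ->
  (volume A < +oo)%E -> (forall z, `|f z| <= M) -> (forall z, ~ A z -> f z = 0) ->
  `|intg f| <= `|M| * fine (volume A).
Proof. by move=> [mf _] mA Afin; exact: (@le_norm_Rintegral_bounded _ L R (@volume R d) A f M). Qed.

Lemma integral_intg A f : lebesgue_measurable A -> tame f ->
  (\int[@volume R d]_(z in A) (f z)%:E)%E = (intg (fun z => \1_A z * f z))%:E.
Proof.
move=> mA tf; rewrite /intg /Rintegral fineK; last first.
  by apply: integrable_fin_num => //; apply: tame_integrable; exact: tame_indicM.
rewrite [LHS]integral_mkcond; apply: eq_integral => z _; rewrite patchE indicE.
by case: ifPn; rewrite ?mul1r ?mul0r.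
Qed.

Lemma lmfun_dmap c t f : dpos c -> lmfun f -> lmfun (f \o dmap c t).
Proof.
move=> c0 mf _ Y mY; rewrite setTI.
have := mf measurableT Y mY; rewrite setTI => h.
exact: (measurable_dmap t c0 h).
Qed.

Lemma tame_dmap c t f : dpos c -> tame f -> tame (f \o dmap c t).
Proof.
move=> c0 [mf [M hM]]; split; first exact: lmfun_dmap.
have M0 : 0 <= M by apply: le_trans (hM 0).1.
have [N hN] : exists N, forall z, `|dmap c t z| <= M -> `|z| <= N.
  exists (\sum_i ((M + `|t 0 i|) / c 0 i)) => z zM.
  have T0 i : 0 <= (M + `|t 0 i|) / c 0 i by rewrite divr_ge0 ?addr_ge0// ltW.
  apply/rv_normP => [|i]; first exact: sumr_ge0.
  rewrite (bigD1 i)//=; apply: le_trans (_ : (M + `|t 0 i|) / c 0 i <= _); last first.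
    by rewrite lerDl; apply: sumr_ge0.
  rewrite ler_pdivlMr// -(ger0_norm (ltW (c0 i))) -normrM mulrC.
  have := le_trans (le_coord (dmap c t z) i) zM; rewrite mxE => h.
  rewrite -[_ * _](addrK (t 0 i)); apply: le_trans (ler_normB _ _) _.
  by rewrite lerD2r.
exists (Num.max M N) => z; split; first by rewrite le_max (hM _).1.
rewrite gt_max => /andP[_ zN]; apply: (hM _).2; rewrite ltNge.
by apply/negP => /hN; rewrite leNgt zN.
Qed.

Lemma intg_dmap c t f : dpos c -> tame f ->
  intg (f \o dmap c t) = (ddet c)^-1 * intg f.
Proof.
move=> c0 tf; apply: (@Rintegral_pushforward _ L R (@volume R d) (dmap c t)).
- by move=> _ Y mY; rewrite setTI; apply: measurable_dmap.
- by rewrite invr_ge0 ltW ?ddet_gt0.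
- by move=> A _; exact: volume_dmap.
- exact: tame_integrable.
Qed.

Lemma dmap1 u (z : rV) : dmap (const_mx 1) u z = z + u.
Proof. by apply/rowP => i; rewrite !mxE mul1r. Qed.

Lemma sh_dmapE u f : (fun z => f (z + u)) = f \o dmap (const_mx 1) u.
Proof. by apply/funext => z; rewrite /= dmap1. Qed.

Lemma continuous_subl (k : rV -> R) (z : rV) : continuous k ->
  continuous (fun w : rV => k (z - w)).
Proof.
move=> ck w; have cz : {for w, continuous (fun w : rV => z - w)}.
  by apply: continuousB; [exact: cst_continuous|exact: cvg_id].
exact: continuous_comp cz (ck _).
Qed.

Lemma continuous_subr (k : rV -> R) (w : rV) : continuous k ->
  continuous (fun z : rV => k (z - w)).
Proof.
move=> ck z; have cz : {for z, continuous (fun z : rV => z - w)}.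
  by apply: continuousB; [exact: cvg_id|exact: cst_continuous].
exact: continuous_comp cz (ck _).
Qed.

Lemma tame_sh u f : tame f -> tame (fun z => f (z + u)).
Proof.
by rewrite sh_dmapE; apply: tame_dmap; exact: dpos1.
Qed.

Lemma intg_sh u f : tame f -> intg (fun z => f (z + u)) = intg f.
Proof.
by move=> tf; rewrite sh_dmapE intg_dmap ?ddet1 ?invr1 ?mul1r//; exact: dpos1.
Qed.

Lemma intg_fubini (k : rV -> R) M f g : continuous k -> (forall z, `|k z| <= M) ->
  tame f -> tame g ->
  intg (fun z => f z * intg (fun w => k (z - w) * g w)) =
  intg (fun w => g w * intg (fun z => k (z - w) * f z)).
Proof.
move=> ck kM tf tg.
have mk := measurable_continuous ck.
have M0 : 0 <= M by apply: le_trans (kM 0).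
have [mf [N hN]] := tf; have [mg [P hP]] := tg.
have tkg z : tame (fun w => k (z - w) * g w).
  apply: (@tameM _ _ M) => //; apply: measurable_continuous.
  exact: continuous_subl.
have tkf w : tame (fun z => k (z - w) * f z).
  apply: (@tameM _ _ M) => //; apply: measurable_continuous.
  exact: continuous_subr.
pose h (x : L * L) := f x.1 * k ((x.1 : rV) - x.2) * g x.2.
have -> : (fun z => f z * intg (fun w => k (z - w) * g w)) =
    fun z => intg (fun w => h (z, w)).
  by apply/funext => z; rewrite -intgZ//; congr intg; apply/funext => w; rewrite /h/= mulrA.
have -> : (fun w => g w * intg (fun z => k (z - w) * f z)) =
    fun w => intg (fun z => h (z, w)).
  apply/funext => w; rewrite -intgZ//; congr intg; apply/funext => z; rewrite /h/=.
  by rewrite mulrC [k _ * _]mulrC.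
pose Q r : set rV := box (const_mx (- r), const_mx r).
have Qfin r : (volume (Q r) < +oo)%E by apply: le_lt_trans (volume_box _) _; exact: ltry.
have QP r (z : rV) : 0 <= r -> ~ Q r z -> r < `|z|.
  move=> r0 nQ; rewrite ltNge; apply/negP => zr; apply: nQ => i.
  by rewrite !mxE /= -ler_norml (le_trans (le_coord _ i)).
have N0 : 0 <= N by apply: le_trans (hN 0).1.
have P0 : 0 <= P by apply: le_trans (hP 0).1.
apply: (@Rintegral_fubini _ _ L L R (@volume R d) (@volume R d) h (Q N) (Q P) (N * M * P)) => //.
- exact: measurable_box.
- exact: measurable_box.
- exact: Qfin.
- exact: Qfin.
- apply: measurable_funM; first apply: measurable_funM.
  + exact: measurableT_comp mf measurable_fst.
  + apply: (@measurable_continuous2 _ _ (fun x => k (x.1 - x.2))) => x.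
    have cx : {for x, continuous (fun x : rV * rV => x.1 - x.2)}.
      by apply: continuousB; [exact: cvg_fst|exact: cvg_snd].
    exact: continuous_comp cx (ck _).
  + exact: measurableT_comp mg measurable_snd.
- move=> x; rewrite !normrM !ler_pM ?mulr_ge0//; [exact: (hN _).1|exact: (hP _).1].
- by move=> x /(QP _ _ N0)/(hN _).2; rewrite /h => ->; rewrite !mul0r.
- by move=> x /(QP _ _ P0)/(hP _).2; rewrite /h => ->; rewrite mulr0.
Qed.

End integral.

(** * Smooth functions *)

(** In this form differentiation passes under an integral sign: Taylor remainders with a uniform
    constant integrate to a quadratic remainder. *)
Lemma is_derive_quad (R : realType) (V : normedModType R) (f : V -> R) (x v : V)
    (df C e : R) : 0 < e ->
  (forall h, `|h| < e -> `|f (h *: v + x) - f x - h * df| <= C * h ^+ 2) ->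
  is_derive x v f df.
Proof.
move=> e0 H.
have lim0 : (fun h : R => h^-1 *: ((f \o shift x) (h *: v) - f x)) @ 0^' --> df.
  apply/cvgrPdist_le => eps eps0; near=> h.
  have h0 : h != 0 by near: h; exact: nbhs_dnbhs_neq.
  have he : `|h| < e.
    by near: h; apply: dnbhs0_lt.
  have hC : `|h| < eps / (`|C| + 1).
    by near: h; apply: dnbhs0_lt; rewrite divr_gt0// ltr_wpDl.
  have := H h he; rewrite -[(f \o shift x) (h *: v)]/(f (h *: v + x)).
  move: (f (h *: v + x) - f x) => a; rewrite -[h^-1 *: a]/(h^-1 * a) => Ha.
  rewrite -(ler_pM2l (_ : 0 < `|h|)) ?normr_gt0// -normrM mulrBr mulrA divff// mul1r.
  rewrite distrC; apply: le_trans Ha _.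
  rewrite -real_normK ?num_real// expr2 mulrCA ler_pM2l ?normr_gt0//.
  move: hC; rewrite ltr_pdivlMr ?ltr_wpDl// => hC.
  have := normr_ge0 h; have := ler_norm C; nra.
have cv : derivable f x v by apply/cvg_ex; exists df.
by apply: DeriveDef => //; exact: cvg_lim lim0.
Unshelve. all: by end_near. Qed.

(** * The function exp(-1/x) and its derivatives *)

Section flat.
Context (R : realType).
Implicit Types (p : {poly R}) (x : R).

(** For p = 1 this is exp(-1/x) extended by 0. A polynomial factor in 1/x is carried along because
    differentiation then stays in the family, sending p to X^2 (p - p'). *)
Definition flat p x : R := if 0 < x then p.[x^-1] * expR (- x^-1) else 0.

Lemma horner_le p (y : R) : 1 <= y ->
  `|p.[y]| <= (\sum_(i < size p) `|p`_i|) * y ^+ size p.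
Proof.
move=> y1; rewrite horner_coef mulr_suml; apply: le_trans (ler_norm_sum _ _ _) _.
apply: ler_sum => i _; rewrite normrM ler_wpM2l// ger0_norm ?exprn_ge0 ?(le_trans _ y1)//.
by rewrite ler_weXn2l// ltnW.
Qed.

(** With y = 1/x, one term of the exponential series gives exp(-y) <= (n + 2)! / y^(n + 2). This
    absorbs the growth y^n of [p] and leaves y^(-2) = x^2, so the derivative at 0 is 0. *)
Lemma flat_quad p : exists C, forall x, `|x| < 1 -> `|flat p x| <= C * x ^+ 2.
Proof.
pose n := size p; pose S := \sum_(i < size p) `|p`_i|.
have S0 : 0 <= S by exact: sumr_ge0.
exists (S * (n.+2)`!%:R) => x x1; rewrite /flat; case: ifPn => x0; last first.
  by rewrite normr0 mulr_ge0// ?sqr_ge0// mulr_ge0.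
have y1 : 1 <= x^-1 by rewrite invf_ge1//; move: x1; rewrite ltr_norml => /andP[_ /ltW].
set y := x^-1 in y1 *; have y0 : 0 < y by rewrite invr_gt0.
have -> : x ^+ 2 = y ^- 2 by rewrite /y exprVn invrK.
have ey : expR (- y) <= n.+2`!%:R / y ^+ n.+2.
  rewrite expRN -[leRHS]invf_div lef_pV2 ?posrE ?expR_gt0 ?divr_gt0 ?exprn_gt0// ?ltr0n ?fact_gt0//.
  by apply: le_trans (expR_ge1Dxn n.+1 (ltW y0)); rewrite lerDr.
rewrite normrM (ger0_norm (expR_ge0 _)).
apply: (@le_trans _ _ (S * y ^+ n * (n.+2`!%:R / y ^+ n.+2))).
  by apply: ler_pM => //; exact: horner_le.
rewrite -!mulrA ler_wpM2l// mulrCA ler_wpM2l//.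
by rewrite -addn2 exprD invfM mulrA mulfV ?mul1r// expf_neq0 ?gt_eqF.
Qed.

Lemma is_derive_flat p x :
  is_derive x 1 (flat p) (flat ('X^2 * (p - p^`())) x).
Proof.
case: (ltrgtP 0 x) => x0.
- pose g (t : R) := p.[t^-1] * expR (- t^-1).
  have xn0 : x != 0 by rewrite gt_eqF.
  have dV : is_derive x 1 (fun t : R => t^-1) (- x ^- 2).
    by apply: is_derive_eq (is_deriveV xn0 (is_derive_id x 1)) _; rewrite /GRing.scale/= mulr1.
  have dp : is_derive x 1 (fun t : R => p.[t^-1]) (p^`().[x^-1] * - x ^- 2).
    exact: (@is_derive1_comp R (horner p) (fun t => t^-1) x _ _ (is_derive_poly p _) dV).
  have dVN : is_derive x 1 (fun t : R => - t^-1) (x ^- 2).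
    by apply: is_derive_eq (is_deriveN dV) _; rewrite opprK.
  have de : is_derive x 1 (fun t : R => expR (- t^-1)) (expR (- x^-1) * x ^- 2).
    exact: (@is_derive1_comp R expR (fun t => - t^-1) x _ _ (is_derive_expR _) dVN).
  have dg : is_derive x 1 g (flat ('X^2 * (p - p^`())) x).
    apply: is_derive_eq (is_deriveM dp de) _.
    rewrite /flat x0 !hornerE /GRing.scale/= exprVn; ring.
  apply: near_eq_is_derive dg; near=> t.
  have t0 : 0 < t by near: t; exact: lt_nbhsr.
  by rewrite /flat t0.
- have fl : flat p x = 0 by rewrite /flat ltNge ltW.
  rewrite [X in is_derive _ _ _ X](_ : _ = 0); last by rewrite /flat ltNge ltW.
  apply: (@is_derive_quad _ _ _ _ _ _ 0 (- x)); first by rewrite oppr_gt0.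
  move=> h; rewrite ltr_norml opprK => /andP[_ hx].
  have -> : flat p (h *: 1 + x) = 0.
    rewrite /flat -[h *: 1]/(h * 1) mulr1 ifN// -leNgt; lra.
  by rewrite fl mulr0 !subr0 normr0 mul0r.
- have fl q : flat q x = 0 by rewrite /flat -x0 ltxx.
  have [C HC] := flat_quad p.
  apply: (@is_derive_quad _ _ _ _ _ _ C 1) => // h h1.
  by rewrite !fl mulr0 !subr0 -x0 addr0 -[h *: 1]/(h * 1) mulr1; exact: HC.
Unshelve. all: by end_near. Qed.

Lemma flat_ge0 x : 0 <= flat 1 x.
Proof. by rewrite /flat; case: ifP => // _; rewrite hornerC mul1r expR_ge0. Qed.

Lemma flat_le0 p x : x <= 0 -> flat p x = 0.
Proof. by move=> x0; rewrite /flat ltNge x0. Qed.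

Lemma flat_incr x y : 0 < x -> x <= y -> 0 < flat 1 x <= flat 1 y.
Proof.
move=> x0 xy; rewrite /flat x0 (lt_le_trans x0 xy) !hornerC !mul1r expR_gt0/=.
by rewrite ler_expR lerN2 lef_pV2 ?posrE// (lt_le_trans x0).
Qed.

End flat.

(** * Closure properties of smooth functions *)

Section calculus.
Context (R : realType) (d : nat).
Local Notation rV := 'rV[R]_d.
Implicit Types (f g : rV -> R) (z w : rV).

Definition e_ (i : 'I_d) : rV := delta_mx 0 i.

Lemma e_E i j : e_ i 0 j = (i == j)%:R.
Proof. by rewrite mxE eqxx/= eq_sym. Qed.

Local Notation Ck := (partials_of_class (fun h : rV -> R => continuous h)).

Lemma rv_continuous (T : pseudoMetricType R) (f : rV -> T) :
  (forall z e, 0 < e -> exists2 r, 0 < r & forall w, `|z - w| < r -> ball (f z) e (f w)) ->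
  continuous f.
Proof.
move=> H z A /nbhs_ballP[e /= e0 eA]; have [r r0 rf] := H z e e0.
by apply/nbhs_ballP; exists r => // w /rv_ball_norm zw; apply/eA/rf.
Qed.

Lemma smoothP f : smooth f <-> [/\ continuous f,
  forall i x, derivable f x (e_ i) & forall i, smooth (partial i f)].
Proof.
split=> [sf|[cf df pf]].
  have [cf df pf] := sf 1%N; split => // i k.
  by have [_ _] := sf k.+1; exact.
by case=> [|k] //=; split => // i; exact: pf.
Qed.

Lemma smooth_continuous f : smooth f -> continuous f.
Proof. by move=> /smoothP[]. Qed.

Lemma smooth_derivable f : smooth f -> forall i x, derivable f x (e_ i).
Proof. by move=> /smoothP[]. Qed.

Lemma smooth_partial f i : smooth f -> smooth (partial i f).
Proof. by move=> /smoothP[]. Qed.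

(** Smoothness by coinduction: it suffices to exhibit a class of functions that is stable under
    partial derivatives. *)
Lemma smooth_coind (S : (rV -> R) -> Prop) :
  (forall f, S f -> [/\ continuous f, forall i x, derivable f x (e_ i) &
     forall i, S (partial i f)]) ->
  forall f, S f -> smooth f.
Proof.
move=> H f Sf k; elim: k f Sf => [f /H[]//|k IH f /H[cf df pf]].
by split => // i; exact: IH.
Qed.

Lemma smooth_cst (a : R) : smooth (fun _ : rV => a).
Proof.
apply: (smooth_coind (S := fun f => exists a, f = fun=> a)); last by exists a.
move=> _ [b ->]; split.
- exact: cst_continuous.
- by move=> i x; exact: derivable_cst.
- by move=> i; exists 0; apply/funext => x; exact: derive_cst.
Qed.

Lemma smoothD f g : smooth f -> smooth g -> smooth (fun z => f z + g z).
Proof.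
move=> sf sg; apply: (smooth_coind (S := fun h => exists f g, [/\ smooth f, smooth g &
  h = fun z => f z + g z])); last by exists f, g.
move=> _ [{sf sg}f [{}g [/smoothP[cf df pf] /smoothP[cg dg pg] ->]]]; split.
- by move=> z; exact: continuousD (cf z) (cg z).
- by move=> i x; exact: derivableD.
- move=> i; exists (partial i f), (partial i g); split => //.
  by apply/funext => x; exact: deriveD.
Qed.

Lemma partialD f g i : smooth f -> smooth g ->
  partial i (fun z => f z + g z) = fun z => partial i f z + partial i g z.
Proof.
by move=> /smoothP[_ df _] /smoothP[_ dg _]; apply/funext => x; exact: deriveD.
Qed.

Lemma partialM f g i : smooth f -> smooth g ->
  partial i (fun z => f z * g z) = fun z => f z * partial i g z + g z * partial i f z.
Proof.
by move=> /smoothP[_ df _] /smoothP[_ dg _]; apply/funext => x; exact: deriveM.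
Qed.

(** Coinduction would require a class containing all finite sums of products. Induction on the order
    avoids this, since functions of a fixed order are closed under sums ([CkD]). *)
Lemma smoothM f g : smooth f -> smooth g -> smooth (fun z => f z * g z).
Proof.
move=> sf sg k; elim: k f g sf sg => [|k IH] f g sf sg.
  have cf := smooth_continuous sf; have cg := smooth_continuous sg.
  by move=> z; exact: continuousM (cf z) (cg z).
have [cf df pf] := (smoothP f).1 sf; have [cg dg pg] := (smoothP g).1 sg.
split.
- by move=> z; exact: continuousM (cf z) (cg z).
- by move=> i x; exact: derivableM.
- move=> i; rewrite partialM//.
  have CkD : forall n f1 f2, Ck n f1 -> Ck n f2 -> Ck n (fun z => f1 z + f2 z).
    elim=> [f1 f2 c1 c2 z|n IHn f1 f2 [c1 d1 p1] [c2 d2 p2]].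
      exact: continuousD (c1 z) (c2 z).
    split.
    + by move=> z; exact: continuousD (c1 z) (c2 z).
    + by move=> j x; exact: derivableD.
    + move=> j; rewrite (_ : partial j _ = fun z => partial j f1 z + partial j f2 z).
        exact: (IHn _ _ (p1 j) (p2 j)).
      by apply/funext => x; exact: deriveD.
  by apply: CkD; apply: IH.
Qed.

Lemma smoothZ (a : R) f : smooth f -> smooth (fun z => a * f z).
Proof. by move=> sf; apply: smoothM => //; exact: smooth_cst. Qed.

Lemma partial_cst (a : R) i : partial i (fun _ : rV => a) = fun=> 0.
Proof. by apply/funext => x; exact: derive_cst. Qed.

Lemma partialZ (a : R) f i : smooth f ->
  partial i (fun z => a * f z) = fun z => a * partial i f z.
Proof.
move=> sf; rewrite partialM//; last exact: smooth_cst.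
by rewrite partial_cst; apply/funext => z; rewrite mulr0 addr0.
Qed.

Lemma smoothN f : smooth f -> smooth (fun z => - f z).
Proof. by move=> sf; under eq_fun do rewrite -mulN1r; exact: smoothZ. Qed.

Lemma smoothB f g : smooth f -> smooth g -> smooth (fun z => f z - g z).
Proof. by move=> sf sg; apply: smoothD => //; exact: smoothN. Qed.

Lemma partialN f i : smooth f -> partial i (fun z => - f z) = fun z => - partial i f z.
Proof.
move=> sf; under eq_fun do rewrite -mulN1r; rewrite partialZ//.
by apply/funext => z; rewrite mulN1r.
Qed.

Lemma partialB f g i : smooth f -> smooth g ->
  partial i (fun z => f z - g z) = fun z => partial i f z - partial i g z.
Proof. by move=> sf sg; rewrite partialD// ?partialN//; exact: smoothN. Qed.

Lemma smooth_prod (I : Type) (s : seq I) (F : I -> rV -> R) :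
  (forall i, smooth (F i)) -> smooth (fun z => \prod_(i <- s) F i z).
Proof.
move=> sF; elim: s => [|i s IH].
  by under eq_fun do rewrite big_nil; exact: smooth_cst.
by under eq_fun do rewrite big_cons; exact: smoothM.
Qed.

(** This recognises as smooth a function given by different smooth formulas in different regions,
    such as a product with an indicator. *)
Lemma smooth_local f :
  (forall z, exists2 g, smooth g & \forall w \near z, g w = f w) -> smooth f.
Proof.
apply: (smooth_coind (S := fun f => forall z, exists2 g, smooth g &
  \forall w \near z, g w = f w)) => {}f H; split.
- move=> z; have [g sg gf] := H z.
  rewrite /continuous_at -(nbhs_singleton gf).
  apply: (@cvg_trans _ (g w @[w --> z])); last exact: smooth_continuous.
  exact: (near_eq_cvg gf).
- move=> i z; have [g sg gf] := H z.
  by apply: near_eq_derivable gf _; exact: smooth_derivable.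
- move=> i z; have [g sg gf] := H z; exists (partial i g); first exact: smooth_partial.
  by apply: filterS (near_join gf) => w; exact: near_eq_derive.
Qed.

Lemma partial_local f g i z : (\forall w \near z, f w = g w) ->
  partial i f z = partial i g z.
Proof. exact: near_eq_derive. Qed.

Lemma is_derive_line f i z (t : R) : derivable f (z + t *: e_ i) (e_ i) ->
  is_derive t 1 (fun s : R => f (z + s *: e_ i)) (partial i f (z + t *: e_ i)).
Proof.
move=> df.
have eqf : (fun h : R => h^-1 *: ((f \o shift (z + t *: e_ i)) (h *: e_ i) - f (z + t *: e_ i))) =
   (fun h : R => h^-1 *: (((fun s : R => f (z + s *: e_ i)) \o shift t) (h *: (1 : R)) -
      f (z + t *: e_ i))).
  apply/funext => h; congr (_ *: (f _ - _)) => /=.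
  by rewrite -[h *: 1]/(h * 1) mulr1 scalerDl addrCA addrC.
apply: DeriveDef; first by rewrite /derivable -eqf.
by rewrite /partial /derive -eqf.
Qed.

(** A line in direction [e_ i] goes to a line in the same direction run at speed [c 0 i], so the
    one-variable chain rule is enough. *)
Lemma smooth_dmap f c t : smooth f -> smooth (f \o dmap c t) /\
  forall i, partial i (f \o dmap c t) = fun z => c 0 i * (partial i f \o dmap c t) z.
Proof.
have dmap_e i z (h : R) : dmap c t (h *: e_ i + z) = (h * c 0 i) *: e_ i + dmap c t z.
  apply/rowP => j; rewrite !mxE eqxx/= eq_sym; case: eqP => [->|_]; rewrite /=; ring.
have cdmap : continuous (dmap c t).
  apply: rv_continuous => z e e0; exists (e / (`|c| + 1)).
    by rewrite divr_gt0// ltr_wpDl.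
  move=> w zw; apply/rv_ballP; split=> // i; rewrite !mxE.
  rewrite opprD addrACA subrr addr0 -mulrBr normrM.
  move: zw; rewrite ltr_pdivlMr ?ltr_wpDl// => zw.
  apply: le_lt_trans zw; rewrite mulrC ler_pM//.
    by have := le_coord (z - w) i; rewrite !mxE.
  by apply: le_trans (le_coord c i) _; rewrite lerDl.
have der g i z : smooth g -> is_derive z (e_ i) (g \o dmap c t) (c 0 i * partial i g (dmap c t z)).
  move=> sg.
  have L := @is_derive_line g i (dmap c t z) 0.
  rewrite scale0r addr0 in L; have {}L := L (@smooth_derivable g sg i _).
  have dl : is_derive (0 : R) (1 : R) (fun h : R => h * c 0 i) (c 0 i).
    have := @is_deriveM R _ id (cst (c 0 i)) (0 : R) 1 _ _ (is_derive_id _ _) (is_derive_cst _ _ _).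
    by rewrite scaler0 add0r /GRing.scale/= mulr1.
  rewrite -{1}(mul0r (c 0 i)) in L.
  have := @is_derive1_comp R (fun s => g (dmap c t z + s *: e_ i)) (fun h => h * c 0 i) 0 _ _ L dl.
  rewrite mulrC => H.
  have eqf : (fun h : R => h^-1 *: (((g \o dmap c t) \o shift z) (h *: e_ i) - (g \o dmap c t) z)) =
   (fun h : R => h^-1 *: ((((fun s => g (dmap c t z + s *: e_ i)) \o (fun h => h * c 0 i)) \o shift 0) (h *: (1 : R)) -
      ((fun s => g (dmap c t z + s *: e_ i)) \o (fun h => h * c 0 i)) 0)).
    apply/funext => h; congr (_ *: (_ - _)) => /=.
      by rewrite dmap_e addr0 -[h *: 1]/(h * 1) mulr1 addrC.
    by rewrite mul0r scale0r addr0.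
  apply: DeriveDef.
    by have [] := H; rewrite /derivable -eqf.
  by have [_] := H; rewrite /derive -eqf => ->.
have pE g i : smooth g -> partial i (g \o dmap c t) = fun z => c 0 i * (partial i g \o dmap c t) z.
  by move=> sg; apply/funext => z; have [_] := der g i z sg.
move=> sf; split; last by move=> i; exact: pE.
apply: (smooth_coind (S := fun h => exists a g, smooth g /\ h = fun z => a * (g \o dmap c t) z)); last first.
  by exists 1, f; split => //; apply/funext => z; rewrite mul1r.
move=> _ [a [g [sg ->]]]; split.
- have cg := smooth_continuous sg; move=> z.
  have cc : {for z, continuous (g \o dmap c t)} by exact: continuous_comp (cdmap z) (cg _).
  exact: (continuousM (@cst_continuous _ _ a z) cc).
- move=> i z; have [dg _] := der g i z sg.
  exact: (derivableM (derivable_cst a z (e_ i)) dg).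
- move=> i; exists (a * c 0 i), (partial i g); split; first exact: smooth_partial.
  apply/funext => z; have [dg vg] := der g i z sg.
  rewrite {1}/partial (deriveM (derivable_cst a z (e_ i)) dg) derive_cst scaler0 addr0 vg.
  by rewrite -mulrA.
Qed.

Lemma smooth_flat p i (a b : R) : smooth (fun z : rV => flat p (a * z 0 i + b)).
Proof.
apply: (smooth_coind (S := fun f => exists k p, f = fun z : rV => k * flat p (a * z 0 i + b))); last first.
  by exists 1, p; apply/funext => z; rewrite mul1r.
have der (q : {poly R}) j (z : rV) : is_derive z (e_ j) (fun z : rV => flat q (a * z 0 i + b))
    ((j == i)%:R * a * flat ('X^2 * (q - q^`())) (a * z 0 i + b)).
  pose u (h : R) := a * (z 0 i + h * (j == i)%:R) + b.
  have du : is_derive (0 : R) (1 : R) u (a * (j == i)%:R).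
    apply: (@is_derive_quad _ _ _ _ _ _ 0 1) => // h _; rewrite /u.
    rewrite -[h *: 1]/(h * 1) mulr1 addr0 mul0r.
    rewrite (_ : _ - _ - _ = 0); first by rewrite normr0 mul0r.
    by move: ((j == i)%:R : R) => k; ring.
  have H := @is_derive1_comp R (flat q) u 0 _ _ (is_derive_flat q (u 0)) du.
  have eqf : (fun h : R => h^-1 *: (((fun z : rV => flat q (a * z 0 i + b)) \o shift z) (h *: e_ j) - flat q (a * z 0 i + b))) =
     (fun h : R => h^-1 *: (((flat q \o u) \o shift 0) (h *: (1 : R)) - (flat q \o u) 0)).
    apply/funext => h; rewrite /u /= !mxE eqxx/= -[h *: 1]/(h * 1) mulr1 addr0 mul0r addr0.
    by rewrite addrC [i == j]eq_sym.
  have u0 : u 0 = a * z 0 i + b by rewrite /u mul0r addr0.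
  apply: DeriveDef.
    by have [] := H; rewrite /derivable -eqf.
  have [_] := H; rewrite /derive -eqf => ->; rewrite u0; ring.
move=> _ [k [q ->]]; split.
- move=> z; apply: (continuousM (@cst_continuous _ _ k z)).
  apply: (@continuous_comp _ _ _ (fun z : rV => a * z 0 i + b) (flat q)).
    apply: continuousD; last exact: cst_continuous.
    apply: continuousM; first exact: cst_continuous.
    exact: coord_continuous.
  apply/differentiable_continuous/derivable1_diffP.
  by have [] := is_derive_flat q (a * z 0 i + b).
- move=> j z; have [dg _] := der q j z.
  exact: (derivableM (derivable_cst k z (e_ j)) dg).
- move=> j; exists (k * ((j == i)%:R * a)), ('X^2 * (q - q^`())).
  apply/funext => z; have [dg vg] := der q j z.
  rewrite {1}/partial (deriveM (derivable_cst k z (e_ j)) dg) derive_cst scaler0 addr0 vg.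
  by rewrite /GRing.scale/= !mulrA.
Qed.

(** The points [h k] pass from [x] to [y] one coordinate at a time, with the one-variable mean value
    theorem on each leg. The legs stay in the ball because sup-norm balls are boxes. *)
Lemma coord_path f (M : 'I_d -> R) (c x y : rV) (r : R) :
  (forall i z, derivable f z (e_ i)) ->
  (forall i z, `|c - z| < r -> `|partial i f z| <= M i) ->
  `|c - x| < r -> `|c - y| < r ->
  `|f y - f x| <= \sum_i M i * `|y 0 i - x 0 i|.
Proof.
move=> df fM cx cy.
have r0 : 0 < r by exact: le_lt_trans cx.
pose h k : rV := \row_i (if (i < k)%N then y 0 i else x 0 i).
have mono i (a : R) : `|c 0 i - x 0 i| < r -> `|c 0 i - y 0 i| < r ->
    Num.min (x 0 i) (y 0 i) <= a <= Num.max (x 0 i) (y 0 i) -> `|c 0 i - a| < r.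
  by rewrite !ltr_norml ge_min le_max => /andP[? ?] /andP[? ?] /andP[/orP[?|?] /orP[?|?]]; apply/andP; split; lra.
have cx' i : `|c 0 i - x 0 i| < r.
  by apply: le_lt_trans cx; have := le_coord (c - x) i; rewrite !mxE.
have cy' i : `|c 0 i - y 0 i| < r.
  by apply: le_lt_trans cy; have := le_coord (c - y) i; rewrite !mxE.
have step k (kd : (k < d)%N) :
    `|f (h k.+1) - f (h k)| <= M (Ordinal kd) * `|y 0 (Ordinal kd) - x 0 (Ordinal kd)|.
  set i := Ordinal kd.
  pose z := h k - x 0 i *: e_ i.
  have hz s : z + s *: e_ i = \row_j (if j == i then s else h k 0 j).
    apply/rowP => j; rewrite !mxE eqxx/= eq_sym.
    case: eqP => [<-|_]; rewrite ?mulr1 ?mulr0 ?subr0 ?addr0//.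
    by rewrite ltnn subrr add0r.
  have hk : h k = z + x 0 i *: e_ i by rewrite subrK.
  have hk1 : h k.+1 = z + y 0 i *: e_ i.
    rewrite hz; apply/rowP => j; rewrite !mxE ltnS leq_eqVlt -(inj_eq val_inj) /=.
    by case: (eqVneq (val j) k) => //= jk; congr (y 0 _); exact: val_inj.
  have zin s : Num.min (x 0 i) (y 0 i) <= s <= Num.max (x 0 i) (y 0 i) -> `|c - (z + s *: e_ i)| < r.
    move=> hs; rewrite hz; apply/rv_ball_norm/rv_ballP; split=> // j; rewrite mxE.
    case: eqP => [->|_]; first exact: mono.
    by rewrite mxE; case: ifP.
  pose phi s := f (z + s *: e_ i).
  have dphi (s : R) : is_derive s (1 : R) phi (partial i f (z + s *: e_ i)) by exact: is_derive_line.
  have cphi (A : set R) : {within A, continuous phi}.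
    apply: continuous_subspaceT => s; apply/differentiable_continuous/derivable1_diffP.
    by have [] := dphi s.
  rewrite hk hk1 -/(phi _) -/(phi (x 0 i)).
  have [xy|yx] := leP (x 0 i) (y 0 i).
    have [s /[!in_itv]/= sxy ->] := MVT_segment xy (fun s _ => dphi s) (cphi _).
    rewrite normrM ler_wpM2r// fM// zin//.
    by rewrite (min_idPl xy) (max_idPr xy).
  have [s /[!in_itv]/= sxy E] := MVT_segment (ltW yx) (fun s _ => dphi s) (cphi _).
  rewrite distrC E normrM [leRHS]mulrC [leRHS]mulrC distrC ler_wpM2r// fM// zin//.
  by rewrite (min_idPr (ltW yx)) (max_idPl (ltW yx)).
have hd : h d = y by apply/rowP => i; rewrite mxE ltn_ord.
have h0 : h 0 = x by apply/rowP => i; rewrite mxE ltn0.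
have main k (kd : (k <= d)%N) : `|f (h k) - f (h 0)| <= \sum_(i < d | (i < k)%N) M i * `|y 0 i - x 0 i|.
  elim: k kd => [_|k IH kd].
    by rewrite subrr normr0 big_pred0// => i; rewrite ltn0.
  rewrite (bigD1 (Ordinal kd))//= -[f _ - _](subrKA (f (h k))).
  apply: le_trans (ler_normD _ _) _; apply: lerD; first exact: step.
  apply: le_trans (IH (ltnW kd)) _; rewrite le_eqVlt; apply/orP; left; apply/eqP; apply: eq_bigl => i.
  by rewrite ltnS [RHS]andbC -(inj_eq val_inj)/= ltn_neqAle.
rewrite -hd -h0; apply: le_trans (main d _) _ => //.
by rewrite le_eqVlt; apply/orP; left; apply/eqP; apply: eq_big => // i; rewrite ?ltn_ord// hd h0.
Qed.

End calculus.

Arguments e_ {R d} i.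

(** * Convolution and mollifiers *)

Section compactly_supported.
Context (R : realType) (d : nat).
Local Notation rV := 'rV[R]_d.
Implicit Types (f g phi k : rV -> R) (z w u : rV).

Definition CS phi : Prop := smooth phi /\ exists M : R, forall z, M < `|z| -> phi z = 0.

Lemma near_norm_gt (M : R) z : M < `|z| -> \forall w \near z, M < `|w|.
Proof.
move=> Mz; apply/nbhs_ballP; exists (`|z| - M); first by rewrite /= subr_gt0.
by move=> w /rv_ball_norm zw; have := ler_distD w z 0; rewrite !subr0; lra.
Qed.

Lemma CS_smooth phi : CS phi -> smooth phi. Proof. by case. Qed.

Lemma CS_partial phi i : CS phi -> CS (partial i phi).
Proof.
move=> [sp [M hM]]; split; first exact: smooth_partial.
exists M => z Mz; rewrite (@partial_local _ _ _ (fun=> 0)) ?partial_cst//.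
by apply: filterS (near_norm_gt Mz) => w /hM.
Qed.

Lemma CSM f phi : smooth f -> CS phi -> CS (fun z => f z * phi z).
Proof.
move=> sf [sp [M hM]]; split; first exact: smoothM.
by exists M => z /hM ->; rewrite mulr0.
Qed.

Lemma CSZ (a : R) phi : CS phi -> CS (fun z => a * phi z).
Proof. by apply: CSM; exact: smooth_cst. Qed.

Lemma CSN phi : CS phi -> CS (fun z => - phi z).
Proof. by move=> /(CSZ (-1)); under eq_fun do rewrite mulN1r. Qed.

Lemma CS_sh u phi : CS phi -> CS (fun z => phi (z + u)).
Proof.
move=> [sp [M hM]]; split.
  by rewrite sh_dmapE; have [] := smooth_dmap (const_mx 1) u sp.
exists (M + `|u|) => z zM; apply: hM; have := ler_normB (z + u) u.
by rewrite addrK; lra.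
Qed.

Lemma partial_sh u phi i : smooth phi ->
  partial i (fun z => phi (z + u)) = fun z => partial i phi (z + u).
Proof.
move=> sp; rewrite sh_dmapE; have [_ ->] := smooth_dmap (const_mx 1) u sp.
by apply/funext => z /=; rewrite mxE mul1r dmap1.
Qed.

Lemma CS_bounded phi : CS phi -> exists2 C, 0 <= C & forall z, `|phi z| <= C.
Proof.
move=> [/smooth_continuous cp [M hM]].
pose A := [set z : rV | `|z| <= `|M|].
have cA : compact A.
  apply: bounded_closed_compact.
    by exists `|M|; split; rewrite ?num_real// => y My z /le_trans; apply; exact: ltW.
  have -> : A = Num.norm @^-1` [set x | x <= `|M|] by [].
  by apply: closed_comp => [z _|]; [exact: norm_continuous|exact: closed_le].
have A0 : A !=set0 by exists 0; rewrite /A/= normr0.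
have ca : {within A, continuous (fun z => `|phi z|)}.
  apply: continuous_subspaceT => z; apply: continuous_comp; first exact: cp.
  exact: norm_continuous.
have [c _ hc] := EVT_max_rV A0 cA ca; exists `|phi c| => // z.
have [zA|nzA] := leP `|z| `|M|; first by apply: hc; rewrite inE.
by rewrite hM ?normr0// (le_lt_trans (ler_norm M)).
Qed.

Lemma CS_tame phi : CS phi -> tame phi.
Proof.
move=> cp; have [C C0 hC] := CS_bounded cp; have [sp [M hM]] := cp.
split; first by apply: measurable_continuous; exact: smooth_continuous.
exists (Num.max C M) => z; split; first by rewrite le_max hC.
by rewrite gt_max => /andP[_ /hM].
Qed.

Lemma CS_lip phi : CS phi -> exists2 C, 0 <= C & forall x y, `|phi x - phi y| <= C * `|x - y|.
Proof.
move=> cp.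
have B i : exists C, 0 <= C /\ forall z, `|partial i phi z| <= C.
  by have [C C0 hC] := CS_bounded (CS_partial i cp); exists C.
have [M hM] := choice B; exists (\sum_i M i) => [|x y].
  by apply: sumr_ge0 => i _; exact: (hM i).1.
apply: le_trans (@coord_path _ _ phi M 0 y x (`|x| + `|y| + 1) _ _ _ _) _.
- by move=> i z; apply: smooth_derivable; exact: CS_smooth.
- by move=> i z _; exact: (hM i).2.
- by rewrite sub0r normrN; have := normr_ge0 x; lra.
- by rewrite sub0r normrN; have := normr_ge0 y; lra.
rewrite mulr_suml; apply: ler_sum => i _; rewrite ler_wpM2l//; first exact: (hM i).1.
by have := le_coord (x - y) i; rewrite !mxE.
Qed.

Lemma norm_e (h : R) (i : 'I_d) : `|h *: (e_ i : rV)| <= `|h|.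
Proof.
apply/rv_normP => // j; rewrite mxE e_E; case: eqP; rewrite ?mulr1 ?mulr0 ?normr0//.
Qed.

(** Mean value theorem along [e_ i] and the Lipschitz bound of the partial derivative. The constant
    is uniform in [z], as integration over [z] demands. *)
Lemma CS_taylor phi i : CS phi -> exists2 C, 0 <= C & forall z (h : R),
  `|phi (z + h *: e_ i) - phi z - h * partial i phi z| <= C * h ^+ 2.
Proof.
move=> cp; have [C C0 hC] := CS_lip (CS_partial i cp); exists C => // z h.
pose psi (s : R) := phi (z + s *: e_ i).
have dpsi (s : R) : is_derive (s : R) (1 : R) psi (partial i phi (z + s *: e_ i)).
  by apply: is_derive_line; apply: smooth_derivable; exact: CS_smooth.
have cpsi (A : set R) : {within A, continuous psi}.
  apply: continuous_subspaceT => s; apply/differentiable_continuous/derivable1_diffP.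
  by have [] := dpsi s.
have main (c : R) : `|c| <= `|h| -> `|h * partial i phi (z + c *: e_ i) - h * partial i phi z| <= C * h ^+ 2.
  move=> ch; rewrite -mulrBr normrM -real_normK ?num_real// expr2 mulrCA ler_wpM2l//.
  apply: le_trans (hC _ _) _; rewrite addrC addKr ler_wpM2l//.
  exact: le_trans (norm_e _ _) ch.
have z0 : phi z = psi 0 by rewrite /psi scale0r addr0.
have [h0|h0] := leP 0 h.
  have [c /[!in_itv]/= ch E] := MVT_segment h0 (fun s _ => dpsi s) (cpsi _).
  rewrite -/(psi h) z0 E subr0 mulrC; apply: main.
  by case/andP: ch => c0 ch; rewrite !ger0_norm.
have [c /[!in_itv]/= ch E] := MVT_segment (ltW h0) (fun s _ => dpsi s) (cpsi _).
rewrite -/(psi h) z0 -[psi h - _]opprB E sub0r mulrN opprK mulrC; apply: main.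
by case/andP: ch => c0 ch; rewrite !ler0_norm ?lerN2// ltW.
Qed.

(** Divide by [h] and let it tend to 0. First-order inequalities are extracted in this way from
    estimates with a second-order error. *)
Lemma le_of_quad (a b C : R) :
  (forall h : R, 0 < h -> h <= 1 -> h * a <= h * b + C * h ^+ 2) -> a <= b.
Proof.
move=> H; apply/ler_addgt0Pl => e e0.
have h0 : 0 < Num.min 1 (e / (`|C| + 1)) by rewrite lt_min ltr01 divr_gt0// ltr_wpDl.
have h1 : Num.min 1 (e / (`|C| + 1)) <= 1 by rewrite ge_min lexx.
have := H _ h0 h1; have : Num.min 1 (e / (`|C| + 1)) <= e / (`|C| + 1) by rewrite ge_min lexx orbT.
move: (Num.min _ _) h0 h1 => h h0 h1; rewrite ler_pdivlMr ?ltr_wpDl// => hC.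
rewrite expr2 mulrCA -mulrDr ler_pM2l// => /le_trans; apply.
have := ler_norm C; nra.
Qed.

(** By translation invariance the difference quotient has integral 0, and it differs from the
    partial derivative by O(h) on a bounded set. One inequality suffices, since [- phi] is also
    admissible. *)
Lemma intg_partial phi i : CS phi -> intg (partial i phi) = 0.
Proof.
move=> cp.
suff H psi : CS psi -> intg (partial i psi) <= 0.
  apply/eqP; rewrite eq_le H//= -oppr_le0 -intgN; last exact/CS_tame/CS_partial.
  by rewrite -partialN; [exact/H/CSN|exact: CS_smooth].
move=> {cp} cp {phi}; have [C C0 hC] := CS_taylor i cp.
have [sp [M hM]] := cp.
pose Q : set rV := [set z | `|z| <= `|M| + 1].
have mQ : lebesgue_measurable Q.
  apply: measurable_closed; rewrite (_ : Q = Num.norm @^-1` [set x | x <= `|M| + 1])//.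
  by apply: closed_comp => [z _|]; [exact: norm_continuous|exact: closed_le].
have Qfin : (volume Q < +oo)%E by apply: (@volume_bounded _ _ _ (`|M| + 1)).
have tp := CS_tame cp; have tpp := CS_tame (CS_partial i cp).
apply: (@le_of_quad _ _ (C * fine (volume Q))) => h h0 h1; rewrite mulr0 add0r.
pose r z := psi (z + h *: e_ i) - psi z - h * partial i psi z.
have tr : tame r by apply: tameB; [apply: tameB => //; exact: tame_sh|exact: tameZ].
have Er : intg r = - (h * intg (partial i psi)).
  rewrite intgB ?intgB ?intgZ ?intg_sh ?subrr ?sub0r//; first exact: tame_sh.
    by apply: tameB => //; exact: tame_sh.
  exact: tameZ.
have : `|intg r| <= `|C * h ^+ 2| * fine (volume Q).
  apply: intg_bound => // [z|z nQ]; first exact: hC.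
  have zM : `|M| + 1 < `|z| by rewrite ltNge; apply/negP.
  have Mz : M < `|z| by apply: le_lt_trans zM; have := ler_norm M; lra.
  rewrite /r (hM z)// subr0 (hM (z + _)); last first.
    have := ler_normB (z + h *: e_ i) (h *: e_ i); rewrite addrK.
    by have := norm_e h i; rewrite (ger0_norm (ltW h0)); have := ler_norm M; lra.
  have [_ [N hN]] := CS_partial i cp.
  rewrite (@partial_local _ _ _ (fun=> 0)) ?partial_cst ?mulr0 ?subr0//.
  by apply: filterS (near_norm_gt Mz) => w /hM.
rewrite Er normrN (ger0_norm (mulr_ge0 C0 (sqr_ge0 h))) mulrAC.
by apply: le_trans; exact: ler_norm.
Qed.

End compactly_supported.

Section convolution.
Context (R : realType) (d : nat).
Local Notation rV := 'rV[R]_d.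
Implicit Types (f g k : rV -> R) (z w u : rV).

Definition convol k g z : R := intg (fun w => k (z - w) * g w).

Lemma tame_conv k g z : CS k -> tame g -> tame (fun w => k (z - w) * g w).
Proof.
move=> ck tg; have [C C0 hC] := CS_bounded ck.
apply: (@tameM _ _ _ _ C) => //; apply: measurable_continuous.
by apply: continuous_subl; apply: smooth_continuous; exact: CS_smooth.
Qed.

Lemma convB k g x y : CS k -> tame g ->
  convol k g x - convol k g y = intg (fun w => (k (x - w) - k (y - w)) * g w).
Proof.
move=> ck tg; rewrite /convol -intgB; try exact: tame_conv.
by congr intg; apply/funext => w; rewrite mulrBl.
Qed.

Lemma intg_mul_le f g (C : R) : tame (fun z => f z * g z) -> tame g ->
  0 <= C -> (forall z, `|f z| <= C) ->
  `|intg (fun z => f z * g z)| <= C * intg (fun z => `|g z|).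
Proof.
move=> tf tg C0 fC; apply: le_trans (le_norm_intg tf) _; rewrite -intgZ; last exact: tame_norm.
apply: le_intg; [exact: tame_norm|by apply: tameZ; exact: tame_norm|].
by move=> z; rewrite normrM ler_wpM2r.
Qed.

Lemma conv_continuous k g : CS k -> tame g -> continuous (convol k g).
Proof.
move=> ck tg; have [C C0 hC] := CS_lip ck.
apply: rv_continuous => z e e0.
pose G := intg (fun z => `|g z|); have G0 : 0 <= G by apply: intg_ge0.
have CG : 0 < C * G + 1 by rewrite ltr_wpDl// mulr_ge0.
exists (e / (C * G + 1)) => [|w zw]; first by rewrite divr_gt0.
rewrite -ball_normE /= convB//.
have zw0 := normr_ge0 (z - w).
apply: le_lt_trans (intg_mul_le (C := C * `|z - w|) _ tg _ _) _.
- under eq_fun do rewrite mulrBl; apply: tameB; exact: tame_conv.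
- exact: mulr_ge0.
- by move=> u; apply: le_trans (hC _ _) _; rewrite opprB addrA subrK.
- by move: zw; rewrite ltr_pdivlMr// -/G; nra.
Qed.

(** All derivatives fall on the kernel, whose Taylor remainder is uniform; hence convolution makes
    any tame [g] smooth. *)
Lemma is_derive_conv k g i z : CS k -> tame g ->
  is_derive z (e_ i) (convol k g) (convol (partial i k) g z).
Proof.
move=> ck tg; have [C C0 hC] := CS_taylor i ck; have cpk := CS_partial i ck.
pose G := intg (fun z => `|g z|).
apply: (@is_derive_quad _ _ _ _ _ _ (C * G) 1) => // h _.
rewrite convB// -[convol (partial i k) g z]/(intg (fun w => partial i k (z - w) * g w)).
rewrite -intgZ; last exact: tame_conv.
have t1 : tame (fun w => (k (h *: e_ i + z - w) - k (z - w)) * g w).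
  by under eq_fun do rewrite mulrBl; apply: tameB; exact: tame_conv.
have t2 : tame (fun w => h * (partial i k (z - w) * g w)) by apply: tameZ; exact: tame_conv.
rewrite -intgB// (_ : (fun w => _ - _) =
    (fun w => (k (z - w + h *: e_ i) - k (z - w) - h * partial i k (z - w)) * g w)).
  rewrite mulrAC; apply: intg_mul_le => //.
    have := tameB t1 t2; congr tame; apply/funext => w.
    by rewrite mulrA -mulrBl; congr ((k _ - _ - _) * _); rewrite -addrA addrC.
  by apply: mulr_ge0 => //; exact: sqr_ge0.
apply/funext => w; rewrite mulrA -mulrBl; congr ((k _ - _ - _) * _).
by rewrite -addrA addrC.
Qed.

Lemma conv_smooth k g : CS k -> tame g -> smooth (convol k g).
Proof.
move=> ck tg; apply: (smooth_coind (S := fun h => exists2 k, CS k & h = convol k g)); last by exists k.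
move=> _ [{}k {}ck ->]; split; first exact: conv_continuous.
  by move=> i z; have [] := is_derive_conv i z ck tg.
move=> i; exists (partial i k); first exact: CS_partial.
by apply/funext => z; have [_] := is_derive_conv i z ck tg.
Qed.

Lemma partial_conv k g i : CS k -> tame g -> partial i (convol k g) = convol (partial i k) g.
Proof. by move=> ck tg; apply/funext => z; have [_] := is_derive_conv i z ck tg. Qed.

Lemma conv_supp k g (e : R) z : (forall u, e <= `|u| -> k u = 0) ->
  (forall w, `|z - w| < e -> g w = 0) -> convol k g z = 0.
Proof.
move=> ke ge; rewrite /convol (_ : (fun w => _) = fun=> 0) ?intg0//.
apply/funext => w; have [h|h] := leP e `|z - w|; first by rewrite ke// mul0r.
by rewrite ge// mulr0.
Qed.

Lemma conv_CS k g : CS k -> tame g -> CS (convol k g).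
Proof.
move=> ck tg; split; first exact: conv_smooth.
have [_ [M hM]] := ck; have [_ [N hN]] := tg.
exists (`|M| + 1 + N) => z zMN; apply: (@conv_supp _ _ (`|M| + 1)).
  by move=> u Mu; apply: hM; have := ler_norm M; lra.
move=> w zw; apply: (hN w).2.
by have := ler_normD (z - w) w; rewrite subrK; lra.
Qed.

Lemma conv_sym k f g : CS k -> tame f -> tame g ->
  intg (fun z => f z * convol k g z) = intg (fun w => g w * convol (fun u => k (- u)) f w).
Proof.
move=> ck tf tg; have [C C0 hC] := CS_bounded ck.
have kc : continuous k by apply: smooth_continuous; exact: CS_smooth.
apply: etrans (intg_fubini kc hC tf tg) _.
by congr intg; apply/funext => w; congr (_ * intg _); apply/funext => z; rewrite opprB.
Qed.

Lemma partial_opp k i : smooth k -> partial i (fun u => k (- u)) = fun u => - partial i k (- u).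
Proof.
move=> sk; apply/funext => z.
have L : is_derive (0 : R) (1 : R) (fun s => k (- z + s *: e_ i)) (partial i k (- z)).
  have := @is_derive_line R d k i (- z) 0 (@smooth_derivable _ _ k sk i _).
  by rewrite scale0r addr0.
have dn : is_derive (0 : R) (1 : R) (fun h : R => - h) (- 1) by exact: is_deriveNid.
rewrite -{1}oppr0 in L.
have H := @is_derive1_comp R (fun s => k (- z + s *: e_ i)) (fun h => - h) 0 _ _ L dn.
have eqf : (fun h : R => h^-1 *: (((fun u => k (- u)) \o shift z) (h *: e_ i) - k (- z))) =
   (fun h : R => h^-1 *: ((((fun s => k (- z + s *: e_ i)) \o (fun h => - h)) \o shift 0) (h *: (1 : R)) -
      ((fun s => k (- z + s *: e_ i)) \o (fun h => - h)) 0)).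
  apply/funext => h /=; congr (_ *: (k _ - k _)).
    by rewrite addr0 -[h *: 1]/(h * 1) mulr1 opprD scaleNr addrC.
  by rewrite oppr0 scale0r addr0.
by have [_] := H; rewrite /partial /derive -eqf mulrN1.
Qed.

End convolution.

(** * Mollifiers *)

Section mollifiers.
Context (R : realType) (d : nat).
Local Notation rV := 'rV[R]_d.
Implicit Types (f g k : rV -> R) (z w u : rV).

(** Evenness makes convolution with [k] symmetric for the pairing by [intg], and makes the partial
    derivatives of [k] odd. *)
Definition mollifier (e : R) k : Prop :=
  [/\ CS k, forall z, 0 <= k z, forall z, k (- z) = k z,
      forall z, e <= `|z| -> k z = 0 & intg k = 1] /\
  exists2 m, 0 < m & forall z, `|z| <= e / 2 -> m <= k z.

Lemma norm_lt (z : rV) (e : R) : 0 < e -> (forall i, `|z 0 i| < e) -> `|z| < e.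
Proof.
move=> e0 h; rewrite -normrN -sub0r; apply/rv_ball_norm/rv_ballP; split=> // i.
by rewrite mxE sub0r normrN.
Qed.

(** A product over the coordinates of bumps built from exp(-1/x), vanishing outside the cube of
    radius [e], divided by its integral. The integral is positive because small balls have positive
    volume. *)
Lemma mollifier_exists (e : R) : (0 < volume [set: rV])%E -> 0 < e ->
  exists k, mollifier e k.
Proof.
move=> nt e0.
pose r i z := flat (1 : {poly R}) (- e^-1 * (z : rV) 0 i + 1) * flat 1 (e^-1 * z 0 i + 1).
pose b z := \prod_(i < d) r i z.
have r0 i z : 0 <= r i z by rewrite mulr_ge0// flat_ge0.
have b0 z : 0 <= b z by apply: prodr_ge0 => i _.
have sb : smooth b by apply: smooth_prod => i; apply: smoothM; exact: smooth_flat.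
have bN z : b (- z) = b z.
  by apply: eq_bigr => i _; rewrite /r mxE mulrNN mulrN mulNr mulrC.
have be z : e <= `|z| -> b z = 0.
  move=> ez; have [i zi] : exists i, e <= `|z 0 i|.
    apply/not_existsP => h; move: ez; apply/negP; rewrite -ltNge.
    by apply: norm_lt => // i; rewrite ltNge; apply/negP; exact: h.
  rewrite /b (bigD1 i)//= /r.
  have [zi0|zi0] := leP 0 (z 0 i).
    rewrite flat_le0 ?mul0r//; move: zi; rewrite ger0_norm// => zi.
    rewrite mulNr addrC subr_le0 -(mulVf (lt0r_neq0 e0)) ler_wpM2l// invr_ge0 ltW//.
  rewrite [X in _ * X * _]flat_le0 ?mulr0 ?mul0r//; move: zi; rewrite ltr0_norm// => zi.
  by rewrite -lerBrDr sub0r ler_pdivrMl// mulrN1; lra.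
have cb : CS b by split => //; exists e => z /ltW; exact: be.
(* For [|z| <= e / 2] both arguments of [flat] in [r i z] are at least 1/2. *)
pose m0 := \prod_(i < d) (flat (1 : {poly R}) 2^-1 ^+ 2).
have h2 : 0 < 2^-1 :> R by rewrite invr_gt0.
have m00 : 0 < m0.
  by apply: prodr_gt0 => i _; rewrite exprn_gt0//; have /andP[] := flat_incr h2 (lexx _).
have bm z : `|z| <= e / 2 -> m0 <= b z.
  move=> zm; apply: ler_prod => i _; rewrite sqr_ge0 /=.
  have : `|z 0 i| <= e / 2 by apply: le_trans (le_coord z i) zm.
  rewrite ler_norml => /andP[h3 h4].
  have e1 : e^-1 * z 0 i <= 2^-1.
    by rewrite ler_pdivrMl//; move: h4; rewrite mulrC.
  have e3 : - 2^-1 <= e^-1 * z 0 i.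
    by rewrite ler_pdivlMl//; move: h3; rewrite mulrN.
  rewrite expr2; apply: ler_pM; try exact: flat_ge0.
    by have /andP[_] := @flat_incr R 2^-1 (- e^-1 * z 0 i + 1) h2 ltac:(lra).
  by have /andP[_] := @flat_incr R 2^-1 (e^-1 * z 0 i + 1) h2 ltac:(lra).
have Ib : 0 < intg b.
  pose U : set rV := [set z | `|z| < e / 2].
  have oU : open U by rewrite (_ : U = Num.norm @^-1` [set x | x < e / 2])//;
    apply: open_comp => [z _|]; [exact: norm_continuous|exact: open_lt].
  have U0 : (0 < volume U)%E.
    by apply: volume_open_gt0 nt oU _; exists 0; rewrite /U/= normr0 divr_gt0.
  have mU := measurable_open oU.
  have Ufin : (volume U < +oo)%E by apply: (@volume_bounded _ _ _ (e / 2)) => z /ltW.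
  have tU : tame (\1_U : rV -> R) by apply: (@tame_indic _ _ _ (e / 2)) => // z /ltW.
  apply: (@lt_le_trans _ _ (m0 * fine (volume U))).
    by rewrite mulr_gt0// fine_gt0// U0.
  rewrite -intg_indic// -intgZ//; apply: le_intg; [exact: tameZ|exact: CS_tame|].
  move=> z; rewrite indicE; case: (boolP (z \in U)) => [|_]; last by rewrite mulr0.
  by rewrite inE mulr1 => /ltW; exact: bm.
exists (fun z => (intg b)^-1 * b z); split; [split|].
- exact: CSZ.
- by move=> z; rewrite mulr_ge0// invr_ge0 ltW.
- by move=> z; rewrite bN.
- by move=> z /be ->; rewrite mulr0.
- by rewrite intgZ ?mulVf ?gt_eqF//; exact: CS_tame.
- exists ((intg b)^-1 * m0); first by rewrite mulr_gt0// invr_gt0.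
  by move=> z /bm h; rewrite ler_wpM2l// invr_ge0 ltW.
Qed.

Lemma intg_refl_mollifier e k z : mollifier e k -> intg (fun w => k (z - w)) = 1.
Proof.
move=> [[ck _ kN _ <-] _].
rewrite -(intg_sh (- z) (CS_tame ck)); congr intg; apply/funext => w.
by rewrite -kN opprB.
Qed.

Lemma tame_refl e k z : mollifier e k -> tame (fun w => k (z - w)).
Proof.
move=> [[ck _ kN _ _] _]; rewrite (_ : (fun w => _) = fun w => k (w - z)).
  by apply: tame_sh; exact: CS_tame.
by apply/funext => w; rewrite -kN opprB.
Qed.

Lemma conv_mollifier_le e k f g z : mollifier e k -> tame f -> tame g ->
  (forall w, `|z - w| < e -> f w <= g w) -> convol k f z <= convol k g z.
Proof.
move=> mk tf tg fg; have [[ck k0 _ ke _] _] := mk.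
apply: le_intg; try exact: tame_conv.
move=> w; have [h|h] := leP e `|z - w|; first by rewrite ke// !mul0r.
by rewrite ler_wpM2l// fg.
Qed.

Lemma conv_mollifier_sym e k f g : mollifier e k -> tame f -> tame g ->
  intg (fun z => f z * convol k g z) = intg (fun z => g z * convol k f z).
Proof.
move=> [[ck _ kN _ _] _] tf tg; apply: etrans (conv_sym ck tf tg) _.
by have -> : (fun u => k (- u)) = k by apply/funext => u.
Qed.

Lemma conv_mollifier_cst e k g (c : R) z : mollifier e k -> tame g ->
  (forall w, `|z - w| < e -> g w = c) -> convol k g z = c.
Proof.
move=> mk tg gc; have [[ck k0 _ ke _] _] := mk.
rewrite -[RHS]mulr1 -(intg_refl_mollifier z mk) -intgZ; last exact: tame_refl mk.
congr intg; apply/funext => w; have [h|h] := leP e `|z - w|; first by rewrite ke// mul0r mulr0.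
by rewrite gc// mulrC.
Qed.

Lemma conv_mollifier_norm e k g (c : R) z : mollifier e k -> tame g ->
  (forall w, `|g w| <= c) -> `|convol k g z| <= c.
Proof.
move=> mk tg gc; have [[ck k0 _ ke _] _] := mk.
have tk := tame_refl z mk.
apply: le_trans (le_norm_intg (tame_conv z ck tg)) _.
rewrite -[leRHS]mulr1 -(intg_refl_mollifier z mk) -intgZ//; apply: le_intg.
- by apply: tame_norm; exact: tame_conv.
- exact: tameZ.
- by move=> w; rewrite normrM (ger0_norm (k0 _)) mulrC ler_wpM2r.
Qed.

(** Jensen for the Euclidean norm. The sum S of squares is the average over w of the inner product
    of the mollified vector at z with g(w), and this product is at most (S + 1)/2. So S <= (S +
    1)/2. *)
Lemma conv_mollifier_sq e k (g : 'I_d -> rV -> R) z : mollifier e k ->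
  (forall i, tame (g i)) -> (forall w, \sum_i g i w ^+ 2 <= 1) ->
  \sum_i convol k (g i) z ^+ 2 <= 1.
Proof.
move=> mk tg g1; have [[ck k0 _ ke _] _] := mk.
have tk := tame_refl z mk.
set S := \sum_i _.
suff : S <= (S + 1) / 2 by lra.
have {1}-> : S = intg (fun w => k (z - w) * \sum_i (convol k (g i) z * g i w)).
  rewrite (_ : (fun w => _) = fun w => \sum_i convol k (g i) z * (k (z - w) * g i w)).
    rewrite intg_sum => [|i]; last by apply: tameZ; exact: tame_conv.
    by apply: eq_bigr => i _; rewrite intgZ ?expr2//; exact: tame_conv.
  by apply/funext => w; rewrite mulr_sumr; apply: eq_bigr => i _; rewrite mulrCA.
rewrite -[leRHS]mulr1 -[X in _ <= _ * X](intg_refl_mollifier z mk) -intgZ//; apply: le_intg.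
- by apply: tame_conv => //; apply: tame_sum => i; exact: tameZ.
- exact: tameZ.
move=> w; rewrite mulrC ler_wpM2r// ler_pdivlMr// mulr_suml.
apply: le_trans (_ : \sum_i (convol k (g i) z ^+ 2 + g i w ^+ 2) <= _).
  apply: ler_sum => i _; have := sqr_ge0 (convol k (g i) z - g i w).
  by rewrite sqrrB; lra.
by rewrite big_split/= lerD2l.
Qed.

End mollifiers.

(** * Mollified indicators and thin neighbourhoods of boxes *)

Section approximation.
Context (R : realType) (d : nat).
Local Notation rV := 'rV[R]_d.
Implicit Types (p : rV * rV) (A B U : set rV) (f g k : rV -> R) (z w u : rV).

(** Off this set an indicator of [A] mollified at scale [e] still equals the indicator. *)
Definition fringe (e : R) A : set rV :=
  [set z | exists w, `|z - w| < e /\ ~ (A z <-> A w)].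

(** A point of the fringe lies in a slab of thickness 2e around one of the faces. The margin 2 in
    the other directions is the upper bound on [e]. *)
Lemma volume_fringe_box p : exists2 M, 0 <= M &
  forall e, 0 < e <= 2 -> (volume (fringe e (box p)) <= (M * e)%:E)%E.
Proof.
pose L i := \prod_(j < d | j != i) Num.max 0 (p.2 0 j + 2 - (p.1 0 j - 2)).
have L0 i : 0 <= L i by apply: prodr_ge0 => j _; rewrite le_max lexx.
exists (\sum_i (L i *+ 2 *+ 2)) => [|e /andP[e0 e1]].
  by apply: sumr_ge0 => i _; rewrite !mulrn_wge0.
pose s (a : R) i := (\row_j (if j == i then a - e else p.1 0 j - 2),
                    \row_j (if j == i then a + e else p.2 0 j + 2)).
have sv a i : box_volume (s a i) = L i *+ 2 * e.
  rewrite /box_volume (bigD1 i)//= !mxE eqxx mulrC mulrnAl -mulrnAr; congr (_ * _).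
    by apply: eq_bigr => j ji; rewrite !mxE (negbTE ji).
  by rewrite (_ : a + e - (a - e) = e *+ 2); [apply/max_idPr; rewrite mulr2n|rewrite mulr2n]; lra.
apply: (@le_trans _ _ (volume (\bigcup_(i in [set` index_enum 'I_d]) (box (s (p.1 0 i) i) `|` box (s (p.2 0 i) i))))).
  apply: le_volume => z [w [zw zpw]].
  have zw' j : `|z 0 j - w 0 j| < e.
    by apply: le_lt_trans zw; have := le_coord (z - w) j; rewrite !mxE.
  have [x [y [xp yp] xy]] : exists x, exists2 y, box p x /\ ~ box p y &
      forall j, `|x 0 j - y 0 j| < e /\ `|x 0 j - z 0 j| < e /\ `|y 0 j - z 0 j| < e.
    have [pz|npz] := pselect (box p z); have [pw|npw] := pselect (box p w).
    - by exfalso; apply: zpw.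
    - exists z, w => // j; rewrite subrr normr0; split => //; split => //.
      by rewrite distrC.
    - exists w, z => // j; rewrite subrr normr0; split; first by rewrite distrC.
      by split => //; rewrite distrC.
    - by exfalso; apply: zpw.
  have bz j : p.1 0 j - 2 <= z 0 j <= p.2 0 j + 2.
    have := xp j; have [_ [h _]] := xy j; move: h; rewrite ltr_norml.
    by move=> /andP[? ?] /andP[? ?]; apply/andP; split; lra.
  move/existsNP : yp => [i yi]; exists i; first by rewrite /= mem_index_enum.
  have := xp i; have [h1 [h2 h3]] := xy i; move: h1 h2 h3; rewrite !ltr_norml.
  move=> /andP[? ?] /andP[? ?] /andP[? ?] /andP[? ?].
  have := yi => /negP; rewrite negb_and -!ltNge => /orP[h|h].
    left => j; rewrite /= !mxE; case: eqP => [->|_]; last exact: bz.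
    by apply/andP; split; lra.
  right => j; rewrite /= !mxE; case: eqP => [->|_]; last exact: bz.
  by apply/andP; split; lra.
apply: le_trans (volume_bigcup_seq _ _) _.
rewrite mulr_suml -sumEFin; apply: lee_sum => i _.
apply: le_trans (volumeU_le _ _) _; rewrite [_ *+ 2 *+ 2]mulr2n mulrDl EFinD.
by apply: leeD; apply: le_trans (volume_box _) _; rewrite sv.
Qed.

Lemma volume_fringe_boxes (s : seq (rV * rV)) : exists2 M, 0 <= M &
  forall e, 0 < e <= 2 ->
  (volume (fringe e (\bigcup_(p in [set` s]) box p)) <= (M * e)%:E)%E.
Proof.
have [M hM] := choice (fun p => let: ex_intro2 x a b := volume_fringe_box p in
  ex_intro (fun M => 0 <= M /\ forall e, 0 < e <= 2 ->
    (volume (fringe e (box p)) <= (M * e)%:E)%E) x (conj a b)).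
exists (\sum_(p <- s) M p) => [|e e1].
  by apply: sumr_ge0 => p _; exact: (hM p).1.
apply: (@le_trans _ _ (volume (\bigcup_(p in [set` s]) fringe e (box p)))).
  apply: le_volume => z [w [zw zpw]].
  suff [p sp h] : exists2 p, p \in s & ~ (box p z <-> box p w).
    by exists p => //; exists w.
  apply: contrapT => h; apply: zpw; split => -[p sp bp]; exists p => //;
    by apply: contrapT => nb; apply: h; exists p => // -[h1 h2]; auto.
apply: le_trans (volume_bigcup_seq _ _) _.
rewrite mulr_suml -sumEFin; apply: lee_sum => p _; exact: (hM p).2.
Qed.

Lemma measurable_fringe e A : lebesgue_measurable A -> lebesgue_measurable (fringe e A).
Proof.
move=> mA.
have oN B : open [set z : rV | exists2 w, B w & `|z - w| < e].
  apply/rv_openP => z [w Bw zw]; exists (e - `|z - w|); first by rewrite subr_gt0.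
  move=> x zx; exists w => //; have := ler_distD z x w; rewrite [`|x - z|]distrC.
  lra.
have -> : fringe e A = (A `&` [set z | exists2 w, (~` A) w & `|z - w| < e]) `|`
    (~` A `&` [set z | exists2 w, A w & `|z - w| < e]).
  apply/seteqP; split=> z.
    move=> [w [zw n]]; have [Az|nAz] := pselect (A z).
      by left; split => //; exists w => // Aw; apply: n.
    by right; split => //; exists w => //; apply: contrapT => nAw; apply: n.
  by move=> [[Az [w nAw zw]]|[nAz [w Aw zw]]]; exists w; split => //;
    move=> [h1 h2]; [apply/nAw/h1|apply/nAz/h2].
apply: (@measurableU _ (lebesgue_space R d)); apply: (@measurableI _ (lebesgue_space R d)) => //.
- exact/measurable_open/oN.
- exact: (@measurableC _ (lebesgue_space R d)).
- exact/measurable_open/oN.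
Qed.

Lemma boxes_bounded (s : seq (rV * rV)) : exists c : R, forall z,
  (\bigcup_(p in [set` s]) box p) z -> `|z| <= c.
Proof.
exists (\sum_(p <- s) (`|p.1| + `|p.2|)) => z [p /= ps pz].
have h0 (q : rV * rV) : 0 <= `|q.1| + `|q.2| by exact: addr_ge0.
apply/rv_normP => [|i]; first exact: sumr_ge0.
apply: (@le_trans _ _ (`|p.1| + `|p.2|)).
  have := pz i; have := le_coord p.1 i; have := le_coord p.2 i.
  have := normr_ge0 p.1; have := normr_ge0 p.2.
  by rewrite !ler_norml => ? ? /andP[? ?] /andP[? ?] /andP[? ?]; apply/andP; split; lra.
by rewrite (big_rem p)//= lerDl; exact: sumr_ge0.
Qed.

Lemma measurable_boxes (s : seq (rV * rV)) :
  lebesgue_measurable (\bigcup_(p in [set` s]) box p).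
Proof.
by apply: (@fin_bigcup_measurable _ (lebesgue_space R d)) => // p _; exact: measurable_box.
Qed.

Lemma indic_01 A z : 0 <= (\1_A z : R) <= 1.
Proof. by rewrite indicE; case: (_ \in _); rewrite ?ler01 ?lexx. Qed.

Lemma norm_indicB A B z : `|\1_A z - \1_B z| = \1_(A `+` B) z :> R.
Proof.
rewrite !indicE; case: (boolP (z \in A)) => [|]; rewrite ?inE ?notin_setE => Az;
  case: (boolP (z \in B)) => [|]; rewrite ?inE ?notin_setE => Bz.
- by rewrite subrr normr0 memNset// => -[] [].
- by rewrite subr0 normr1 mem_set//; left.
- by rewrite sub0r normrN normr1 mem_set//; right.
- by rewrite subrr normr0 memNset// => -[] [].
Qed.

(** As [f] is merely bounded, [B] is replaced, up to volume [del], by a finite union [U] of boxes,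
    whose indicator changes under mollification only on a fringe of volume O(e'). Each of the three
    resulting errors is at most e/3. *)
Lemma mollifier_approx f B (c : R) : tame f -> lebesgue_measurable B ->
  (forall z, B z -> `|z| <= c) -> forall e, 0 < e ->
  exists2 e0, 0 < e0 & forall e' k, 0 < e' -> e' <= e0 -> mollifier e' k ->
    `|intg (fun z => f z * convol k \1_B z) - intg (fun z => f z * \1_B z)| <= e.
Proof.
move=> tf mB Bc e e0; have [mf [F hF]] := tf.
have fF z : `|f z| <= F by exact: (hF z).1.
have F0 : 0 <= F by apply: le_trans (fF 0).
have Bfin : (volume B < +oo)%E by exact: volume_bounded Bc.
pose del := e / (3 * (F + 1)).
have F1 : 0 < F + 1 by lra.
have F31 : 0 < 3 * (F + 1) by lra.
have d0 : 0 < del by rewrite divr_gt0.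
have Fdel : F * del <= e / 3.
  have : del * (3 * (F + 1)) = e by rewrite /del divfK// gt_eqF.
  nra.
have [s sU] := volume_approx d0 Bfin mB.
set U := \bigcup_(p in _) _ in sU.
have mU : lebesgue_measurable U by exact: measurable_boxes.
have [cU hcU] := boxes_bounded s.
have [M M0 hM] := volume_fringe_boxes s.
have FM0 : 0 <= F * M by exact: mulr_ge0.
have FM1 : 0 < 3 * (F * M + 1) by lra.
exists (Num.min 1 (e / (3 * (F * M + 1)))).
  by rewrite lt_min ltr01 divr_gt0.
move=> e' k e'0; rewrite le_min => /andP[e'1 e'e] mk.
have [[ck k0 kN ke Ik] _] := mk.
have FMe : F * M * e' <= e / 3.
  by move: e'e; rewrite ler_pdivlMr//; nra.
have tB : tame (\1_B : rV -> R) by exact: tame_indic Bc.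
have tU : tame (\1_U : rV -> R) by exact: tame_indic hcU.
have tfg g : tame g -> tame (fun z => f z * g z) by apply: tameM fF.
have mBU : lebesgue_measurable (B `+` U).
  by apply: (@measurableU _ (lebesgue_space R d)); exact: (@measurableD _ (lebesgue_space R d)).
have BUfin : (volume (B `+` U) < +oo)%E by apply: le_lt_trans sU (ltry _).
have BU' : fine (volume (B `+` U)) <= del.
  by rewrite -lee_fin fineK// ge0_fin_numE// volume_ge0.
have T2 g : tame g -> (forall z, `|g z| <= F) ->
    `|intg (fun z => g z * (\1_U z - \1_B z))| <= e / 3.
  move=> tg gF; apply: le_trans Fdel; rewrite -{1}(ger0_norm F0).
  apply: le_trans (@intg_bound _ _ _ (B `+` U) F _ mBU BUfin _ _) _.
  - by apply: (@tameM _ _ g _ F) => //; [case: tg|exact: tameB].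
  - move=> z; rewrite normrM distrC norm_indicB -[leRHS]mulr1 ler_pM//.
  - move=> z nz; apply/eqP; rewrite mulf_eq0 orbC -normr_eq0.
    by rewrite distrC norm_indicB indicE memNset// eqxx.
  - by rewrite (ger0_norm F0) ler_wpM2l.
have cB := CS_tame (conv_CS ck tB); have cU' := CS_tame (conv_CS ck tU).
rewrite -intgB; [|exact: tfg..].
rewrite (_ : (fun z => _) = fun z => f z * (convol k \1_B z - convol k \1_U z) +
   (f z * (convol k \1_U z - \1_U z) + f z * (\1_U z - \1_B z))); last first.
  by apply/funext => z; ring.
rewrite intgD ?intgD; last 4 first.
- by apply: tfg; exact: tameB.
- by apply: tfg; exact: tameB.
- by apply: tfg; exact: tameB.
- by apply: tameD; apply: tfg; exact: tameB.
apply: le_trans (ler_normD _ _) _.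
have -> : e = e / 3 + (e / 3 + e / 3) by lra.
apply: lerD; last first.
  apply: le_trans (ler_normD _ _) _; apply: lerD; last exact: T2.
  have fU : (volume (fringe e' U) < +oo)%E.
    by apply: le_lt_trans (hM e' _) (ltry _); rewrite e'0; lra.
  have mF : lebesgue_measurable (fringe e' U) by exact: measurable_fringe.
  apply: le_trans (@intg_bound _ _ _ (fringe e' U) F _ mF fU _ _) _.
  - by apply: tfg; exact: tameB.
  - move=> z; rewrite normrM -[leRHS]mulr1 ler_pM//.
    have : 0 <= convol k \1_U z <= 1.
      apply/andP; split.
        apply: intg_ge0 => w; rewrite mulr_ge0// indicE; case: (_ \in _) => //.
      apply: le_trans (ler_norm _) _; apply: (conv_mollifier_norm _ mk) => // w.
      exact: normr_indic.
    have /andP[? ?] := indic_01 U z.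
    by move=> /andP[? ?]; rewrite ler_norml; apply/andP; split; lra.
  - move=> z nz; rewrite (@conv_mollifier_cst _ _ e' k _ (\1_U z)) ?subrr ?mulr0//.
    move=> w zw; rewrite !indicE; congr (nat_of_bool _)%:R.
    have /contrapT [h1 h2] : ~ ~ (U z <-> U w) by move=> h; apply: nz; exists w.
    by apply/idP/idP; rewrite !inE.
  rewrite (ger0_norm F0); apply: le_trans FMe; rewrite -mulrA ler_wpM2l//.
  rewrite -lee_fin fineK; last by rewrite ge0_fin_numE// volume_ge0.
  by apply: hM; rewrite e'0; lra.
(* The kernel is moved onto [f], and [convol k f] obeys the same bound [F] as [f]; so this error too
   is at most [F] times the volume of the symmetric difference. *)
have E1 : intg (fun z => f z * (convol k \1_B z - convol k \1_U z)) =
    - intg (fun z => convol k f z * (\1_U z - \1_B z)).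
  rewrite (_ : (fun z => _) = fun z => f z * convol k \1_B z - f z * convol k \1_U z); last first.
    by apply/funext => z; rewrite mulrBr.
  rewrite intgB; [|exact: tfg..].
  rewrite (conv_mollifier_sym mk tf tB) (conv_mollifier_sym mk tf tU).
  rewrite -opprB -intgB; last 2 first.
  - by apply: tameM (normr_indic U) _; [exact: lmfun_indic|exact/CS_tame/conv_CS].
  - by apply: tameM (normr_indic B) _; [exact: lmfun_indic|exact/CS_tame/conv_CS].
  by congr (- intg _); apply/funext => z; ring.
rewrite E1 normrN; apply: T2; first exact/CS_tame/conv_CS.
by move=> z; exact: (conv_mollifier_norm _ mk).
Qed.

End approximation.

(** * Perimeter bounds *)

Section perimeter.
Context (R : realType) (d : nat).
Local Notation rV := 'rV[R]_d.
Implicit Types (A B C G W O : set rV) (f g k phi : rV -> R) (z w u : rV).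
Implicit Types (X : 'I_d -> rV -> R) (J : pred 'I_d).

(** A compact subset of [O] in quantitative form: mollifying at a scale of at most [r / 2] only
    halves the depth, and a diagonal map changes it by a constant factor. *)
Definition deep O (r M : R) : set rV :=
  [set z | `|z| <= M /\ forall w, `|z - w| < r -> O w].

Definition sup_in O f : Prop :=
  exists r M : R, 0 < r /\ forall z, f z != 0 -> deep O r M z.

Definition CSin O f : Prop := smooth f /\ sup_in O f.

Lemma le_deep O r1 r2 M1 M2 z : r1 <= r2 -> M2 <= M1 -> deep O r2 M2 z -> deep O r1 M1 z.
Proof.
move=> r12 M12 [zM zr]; split; first exact: le_trans M12.
by move=> w zw; apply: zr; exact: lt_le_trans r12.
Qed.

Lemma deep_in O r M z : 0 < r -> deep O r M z -> O z.
Proof. by move=> r0 [_]; apply; rewrite subrr normr0. Qed.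

Lemma CSin_CS O f : CSin O f -> CS f.
Proof.
move=> [sf [r [M [r0 h]]]]; split => //; exists M => z zM; apply/eqP.
by apply/negPn/negP => /h[]; rewrite leNgt zM.
Qed.

Lemma sup_in2 O f g h : (forall z, f z = 0 -> g z = 0 -> h z = 0) ->
  sup_in O f -> sup_in O g -> sup_in O h.
Proof.
move=> fgh [r1 [M1 [r10 h1]]] [r2 [M2 [r20 h2]]].
exists (Num.min r1 r2), (Num.max M1 M2); split; first by rewrite lt_min r10.
move=> z hz; have [fz|/h1] := eqVneq (f z) 0; last first.
  by apply: le_deep; rewrite ?ge_min ?le_max lexx.
have [gz|/h2] := eqVneq (g z) 0; first by move: hz; rewrite fgh ?eqxx.
by apply: le_deep; rewrite ?ge_min ?le_max lexx orbT.
Qed.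

Lemma sup_in1 O f h : (forall z, f z = 0 -> h z = 0) -> sup_in O f -> sup_in O h.
Proof. by move=> fh sf; apply: (sup_in2 _ sf sf) => z /fh. Qed.

Lemma CSinD O f g : CSin O f -> CSin O g -> CSin O (fun z => f z + g z).
Proof.
move=> [sf ff] [sg gg]; split; first exact: smoothD.
by apply: sup_in2 ff gg => z -> ->; rewrite addr0.
Qed.

Lemma CSinM O f g : smooth f -> CSin O g -> CSin O (fun z => f z * g z).
Proof.
move=> sf [sg gg]; split; first exact: smoothM.
by apply: sup_in1 gg => z ->; rewrite mulr0.
Qed.

Lemma CSin0 O : CSin O (fun=> 0).
Proof.
split; first exact: smooth_cst.
by exists 1, 0; split => // z; rewrite eqxx.
Qed.

Definition divg X z : R := \sum_i partial i (X i) z.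

Definition flux G X : R := intg (fun z => \1_G z * divg X z).

Definition vfield J O (s : R) X : Prop :=
  [/\ forall i, CSin O (X i), forall i, ~~ J i -> X i = fun=> 0 &
      forall z, \sum_i X i z ^+ 2 <= s ^+ 2].

(* For J = predT this bounds the relative perimeter (rel_perimeterP); for smaller J
   only the variation of G in the coordinate directions of J. *)
Definition pbound J O G (p : R) : Prop := forall X, vfield J O 1 X -> flux G X <= p.

Lemma tame_divg X : (forall i, CS (X i)) -> tame (divg X).
Proof. by move=> cX; apply: tame_sum => i; exact/CS_tame/CS_partial. Qed.

Lemma fluxD G X X' : lebesgue_measurable G -> (forall i, CS (X i)) -> (forall i, CS (X' i)) ->
  flux G (fun i z => X i z + X' i z) = flux G X + flux G X'.
Proof.
move=> mG cX cX'; rewrite /flux -intgD; last 2 first.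
- by apply: tame_indicM => //; exact: tame_divg.
- by apply: tame_indicM => //; exact: tame_divg.
congr intg; apply/funext => z; rewrite -mulrDr; congr (_ * _).
rewrite /divg -big_split/=; apply: eq_bigr => i _.
by rewrite partialD//; exact: CS_smooth.
Qed.

Lemma fluxZ G X (a : R) : lebesgue_measurable G -> (forall i, CS (X i)) ->
  flux G (fun i z => a * X i z) = a * flux G X.
Proof.
move=> mG cX; rewrite /flux -intgZ; last by apply: tame_indicM => //; exact: tame_divg.
congr intg; apply/funext => z; rewrite mulrCA; congr (_ * _).
by rewrite /divg mulr_sumr; apply: eq_bigr => i _; rewrite partialZ//; exact: CS_smooth.
Qed.

Lemma intg_divg X : (forall i, CS (X i)) -> intg (divg X) = 0.
Proof.
move=> cX; rewrite /divg intg_sum => [|i]; last exact/CS_tame/CS_partial.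
by rewrite big1// => i _; exact: intg_partial.
Qed.

Lemma vfieldZ J O (a s : R) X : vfield J O s X -> vfield J O (a * s) (fun i z => a * X i z).
Proof.
move=> [cX jX sX]; split => [i|i /jX ->|z].
- by apply: CSinM => //; exact: smooth_cst.
- by apply/funext => z; rewrite mulr0.
- under eq_bigr do rewrite exprMn.
  by rewrite -mulr_sumr exprMn ler_wpM2l// sqr_ge0.
Qed.

Lemma vfield_CS J O s X : vfield J O s X -> forall i, CS (X i).
Proof. by move=> [cX _ _] i; exact: CSin_CS (cX i). Qed.

Lemma sub_vfield J J' O s X : (forall i, J i -> J' i) -> vfield J O s X -> vfield J' O s X.
Proof.
move=> JJ' [cX jX sX]; split => // i nJ; apply: jX.
by apply: contra nJ; exact: JJ'.
Qed.

Lemma pbound_flux J O G p s X : lebesgue_measurable G -> pbound J O G p -> 0 < s ->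
  vfield J O s X -> flux G X <= s * p.
Proof.
move=> mG pG s0 vX.
have /pG : vfield J O 1 (fun i z => s^-1 * X i z).
  by rewrite -(mulVf (lt0r_neq0 s0)); exact: vfieldZ.
rewrite fluxZ//; last exact: vfield_CS vX.
by rewrite ler_pdivrMl.
Qed.

Lemma sub_pbound J J' O G p : (forall i, J' i -> J i) -> pbound J O G p -> pbound J' O G p.
Proof. by move=> JJ' pG X /(sub_vfield JJ'); exact: pG. Qed.

Lemma pbound_ge0 J O G p : pbound J O G p -> 0 <= p.
Proof.
move=> pG; have /pG : vfield J O 1 (fun i => fun=> 0).
  split => [i|//|z]; first exact: CSin0.
  by rewrite big1 ?expr1n// => i _; rewrite expr0n.
rewrite /flux (_ : (fun z => _) = fun=> 0) ?intg0//.
by apply/funext => z; rewrite /divg big1 ?mulr0// => i _; rewrite partial_cst.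
Qed.

Lemma closed_deep O r M : closed (deep O r M).
Proof.
rewrite -(setCK (deep O r M)); apply: open_closedC; apply/rv_openP => z /not_andP[/negP|].
  rewrite -ltNge => Mz; exists (`|z| - M); first by rewrite subr_gt0.
  move=> w zw [wM _]; have := ler_normD (z - w) w; rewrite subrK; lra.
move=> /existsNP[w /not_implyP[zw nO]]; exists (r - `|z - w|); first by rewrite subr_gt0.
move=> u zu [_ /(_ w)]; move=> h; apply: nO; apply: h.
by have := ler_distD z u w; rewrite [`|u - z|]distrC; lra.
Qed.

Lemma compact_deep O r M : compact (deep O r M).
Proof.
apply: bounded_closed_compact; last exact: closed_deep.
by exists M; split; rewrite ?num_real// => y My z [/le_trans h _]; apply: h; exact: ltW.
Qed.

Lemma compact_sub_deep (L O : set rV) : compact L -> open O -> L `<=` O ->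
  exists r M : R, 0 < r /\ L `<=` deep O r M.
Proof.
move=> cL oO LO.
have [M [Mreal hM]] : bounded_set L by exact: compact_bounded.
have H : \forall r \near (0 : R)^'+, forall z, L z -> forall w, `|z - w| < r -> O w.
  move: cL => /compact_near_coveringP/near_covering_withinP.
  move=> /(_ _ (0 : R)^'+ (fun r z => forall w, `|z - w| < r -> O w)); apply.
  move=> x Lx; have [e e0 he] := (rv_openP O).1 oO x (LO x Lx).
  near=> y r => Ly w yw; apply: he.
  apply: le_lt_trans (ler_distD y _ _) _.
  have h1 : `|x - y| < e / 2.
    by apply/rv_ball_norm; near: y; apply: nbhsx_ballx; rewrite divr_gt0.
  have h2 : r <= e / 2 by near: r; apply: nbhs_right_le; rewrite divr_gt0.
  by move: yw => /= yw; lra.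
have [r [r0 hr]] : exists r, 0 < r /\ forall z, L z -> forall w, `|z - w| < r -> O w.
  near (0 : R)^'+ => r; exists r; split => //; near: r; exact: H.
exists r, (M + 1); split => // z Lz; split; last exact: hr.
by apply: hM => //; lra.
Unshelve. all: by end_near. Qed.

Lemma enorm_le1 (x : rV) : (enorm x <= 1) = (\sum_i x 0 i ^+ 2 <= 1).
Proof.
rewrite /enorm; apply/idP/idP => h.
  rewrite -[X in X <= _]sqr_sqrtr ?sumr_ge0// => [|i _]; last exact: sqr_ge0.
  by rewrite expr_le1// sqrtr_ge0.
by rewrite -sqrtr1 ler_sqrt.
Qed.

Lemma test_field_vfield C (xi : rV -> rV) :
  test_field C xi -> vfield predT (interior C) 1 (fun i z => xi z 0 i).
Proof.
move=> [sxi cK Ki nx]; split => [i|//|z]; last by rewrite expr1n -enorm_le1.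
split; first exact: sxi.
have [r [M [r0 h]]] := compact_sub_deep cK (@open_interior _ C) Ki.
exists r, M; split => // z zi; apply: h; apply: subset_closure => /=.
by apply: contraNneq zi => ->; rewrite mxE.
Qed.

Lemma vfield_test_field C X : vfield predT (interior C) 1 X ->
  test_field C (fun z => \row_i X i z).
Proof.
move=> [cX _ nX].
have [r [M [r0 h]]] : exists r M : R, 0 < r /\ forall i z, X i z != 0 -> deep (interior C) r M z.
  have [rM hrM] := choice (fun i => let: ex_intro r (ex_intro M h) := (cX i).2 in
    ex_intro (fun rM : R * R => 0 < rM.1 /\ forall z, X i z != 0 -> deep (interior C) rM.1 rM.2 z) (r, M) h).
  exists (\big[Num.min/1]_i (rM i).1), (\sum_i `|(rM i).2|); split.
    by apply/bigmin_gtP; split => // i _; exact: (hrM i).1.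
  move=> i z /(hrM i).2; apply: le_deep; first exact: bigmin_le_cond.
  by rewrite (bigD1 i)//= (le_trans (ler_norm _))// lerDl sumr_ge0.
have sub : [set z | (\row_i X i z) != 0] `<=` deep (interior C) r M.
  move=> z /= nz; have [i hi] : exists i, X i z != 0.
    apply: contrapT => /forallNP h0; move: nz; apply/negP/negPn/eqP/rowP => i.
    by rewrite !mxE; apply/eqP/negPn/negP/h0.
  exact: h hi.
have subc : closure [set z | (\row_i X i z) != 0] `<=` deep (interior C) r M.
  by rewrite (closure_id (deep _ _ _)).1; [exact: closure_subset|exact: closed_deep].
split.
- by move=> i; under eq_fun do rewrite mxE; exact: (cX i).1.
- exact: subclosed_compact (@closed_closure _ _) (@compact_deep _ _ _) subc.
- by move=> z /subc; exact: deep_in.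
- move=> z; rewrite enorm_le1 -[leRHS](expr1n _ 2); apply: le_trans (nX z).
  by rewrite le_eqVlt; apply/orP; left; apply/eqP; apply: eq_bigr => i _; rewrite mxE.
Qed.

(** The bridge to the given notion of perimeter. From here on perimeters occur as real upper bounds,
    which avoids extended real arithmetic. *)
Lemma rel_perimeterP C G p : lebesgue_measurable G ->
  (rel_perimeter C G <= p%:E)%E <-> pbound predT (interior C) G p.
Proof.
move=> mG; split => [h X vX|h].
  rewrite -lee_fin; apply: le_trans h; apply: ereal_sup_ubound.
  exists (fun z => \row_i X i z); first exact: vfield_test_field.
  have E : divergence (fun z => \row_i X i z) = divg X.
    apply/funext => z; apply: eq_bigr => i _.
    by congr (partial i _ z); apply/funext => w; rewrite mxE.
  by rewrite E; apply: (integral_intg mG); apply: tame_divg; exact: vfield_CS vX.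
apply: ge_ereal_sup => _ [xi txi <-].
have vxi := test_field_vfield txi.
have E : (\int[@volume R d]_(x in G) (divergence xi x)%:E)%E = (flux G (fun i z => xi z 0 i))%:E.
  by apply: (integral_intg mG); apply: (@tame_divg (fun i z => xi z 0 i)); exact: vfield_CS vxi.
by rewrite E lee_fin; exact: h vxi.
Qed.

End perimeter.

(** * Mollified fields and symmetric differences *)

Section mollified_fields.
Context (R : realType) (d : nat).
Local Notation rV := 'rV[R]_d.
Implicit Types (A B C G W O : set rV) (f g k phi : rV -> R) (z w u : rV).
Implicit Types (X : 'I_d -> rV -> R) (J : pred 'I_d).

Lemma convol_deep O e k g r M z : mollifier e k -> tame g -> 0 < e -> e <= r / 2 ->
  (forall w, g w != 0 -> deep O r M w) -> convol k g z != 0 -> deep O (r / 2) (M + e) z.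
Proof.
move=> mk tg e0 er gd nz.
have [w zw gw] : exists2 w, `|z - w| < e & g w != 0.
  apply: contrapT => h; move: nz; apply/negP/negPn/eqP.
  apply: (conv_mollifier_cst mk tg) => w zw; apply/eqP/negPn/negP => gw.
  by apply: h; exists w.
have [wM wr] := gd w gw; split.
  by have := ler_normD (z - w) w; rewrite subrK; lra.
move=> u zu; apply: wr; have := ler_distD z w u; rewrite [`|w - z|]distrC.
have -> : r = r / 2 + r / 2 by lra.
by move: zu zw er; lra.
Qed.

Lemma vfield_convol J O e k (g : 'I_d -> rV -> R) r M : mollifier e k ->
  (forall i, tame (g i)) -> (forall z, \sum_i g i z ^+ 2 <= 1) ->
  (forall i, ~~ J i -> g i = fun=> 0) -> (forall i z, g i z != 0 -> deep O r M z) ->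
  0 < e -> e <= r / 2 -> vfield J O 1 (fun i => convol k (g i)).
Proof.
move=> mk tg g1 gJ gd e0 er; have [[ck _ _ _ _] _] := mk; split.
- move=> i; split; first exact: conv_smooth.
  exists (r / 2), (M + e); split; first by lra.
  by move=> z; apply: convol_deep => // w; exact: gd.
- move=> i /gJ ->; apply/funext => z; apply: (conv_mollifier_cst mk) => //.
  exact: tame0.
- by move=> z; rewrite expr1n; exact: (conv_mollifier_sq _ mk).
Qed.

(** Integration by parts with the derivative always on the kernel: the partial derivative of an even
    kernel is odd, whence the sign. *)
Lemma intg_partial_convol e k f g i : mollifier e k -> tame f -> tame g ->
  intg (fun z => f z * partial i (convol k g) z) =
  - intg (fun z => g z * partial i (convol k f) z).
Proof.
move=> [[ck _ kN _ _] _] tf tg; rewrite !partial_conv//.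
have cpk := CS_partial i ck.
have kk : (fun u => k (- u)) = k by apply/funext.
have pN u : partial i k (- u) = - partial i k u.
  by rewrite -{2}kk partial_opp ?opprK//; exact: CS_smooth.
apply: etrans (conv_sym cpk tf tg) _.
rewrite -intgN; last first.
  have [F F0 hF] := CS_bounded (conv_CS cpk tf).
  have := tameM (CS_tame (conv_CS cpk tf)).1 hF tg.
  by under eq_fun do rewrite mulrC.
congr intg; apply/funext => w; rewrite -mulrN; congr (_ * _).
rewrite /convol -intgN; last exact: tame_conv.
by congr intg; apply/funext => z; rewrite pN mulNr.
Qed.

Lemma divgM (b : rV -> R) X z : smooth b -> (forall i, CS (X i)) ->
  divg (fun i z => b z * X i z) z = b z * divg X z + \sum_i X i z * partial i b z.
Proof.
move=> sb cX; rewrite /divg mulr_sumr -big_split/=; apply: eq_bigr => i _.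
by rewrite partialM//; exact: CS_smooth.
Qed.

Lemma vfieldM J O s b X : smooth b -> (forall z, `|b z| <= 1) ->
  vfield J O s X -> vfield J O s (fun i z => b z * X i z).
Proof.
move=> sb b1 [cX jX nX]; split => [i|i /jX ->|z].
- exact: CSinM.
- by apply/funext => z; rewrite mulr0.
- apply: le_trans (nX z); apply: ler_sum => i _; rewrite exprMn ler_piMl ?sqr_ge0//.
  by rewrite -real_normK ?num_real// expr_le1.
Qed.

Lemma vfield_deep J O s X : vfield J O s X -> exists r M : R,
  0 < r /\ forall i z, X i z != 0 -> deep O r M z.
Proof.
move=> [cX _ _].
have [rM hrM] := choice (fun i => let: ex_intro r (ex_intro M h) := (cX i).2 in
  ex_intro (fun rM : R * R => 0 < rM.1 /\ forall z, X i z != 0 -> deep O rM.1 rM.2 z) (r, M) h).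
exists (\big[Num.min/1]_i (rM i).1), (\sum_i `|(rM i).2|); split.
  by apply/bigmin_gtP; split => // i _; exact: (hrM i).1.
move=> i z /(hrM i).2; apply: le_deep; first exact: bigmin_le_cond.
by rewrite (bigD1 i)//= (le_trans (ler_norm _))// lerDl sumr_ge0.
Qed.

Lemma divg_out (P : set rV) X z : (forall w, P w -> forall i, X i w = 0) -> open P -> P z ->
  divg X z = 0.
Proof.
move=> XP oP Pz; rewrite /divg big1// => i _.
rewrite (@partial_local _ _ _ (fun=> 0)) ?partial_cst//.
by apply: filterS (open_nbhs_nbhs (conj oP Pz)) => w /XP.
Qed.

Lemma open_norm_gt (M : R) : open [set z : rV | M < `|z|].
Proof.
apply/rv_openP => z /= Mz; exists (`|z| - M); first by rewrite subr_gt0.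
by move=> w zw; have := ler_normD (z - w) w; rewrite subrK; lra.
Qed.

(* If b is the mollified indicator of B, then (1 - 2 b) X is a test field for A, and
   a mollification of (1 - 2 * 1_A) X is one for B. *)
Lemma setY_pbound J O A B pa pb : (0 < volume [set: rV])%E ->
  lebesgue_measurable A -> lebesgue_measurable B ->
  pbound J O A pa -> pbound J O B pb -> pbound J O (A `+` B) (pa + pb).
Proof.
move=> nt mA mB pA pB X vX.
have [r [M [r0 dX]]] := vfield_deep vX.
have cX := vfield_CS vX.
have [_ jX nX] := vX.
have XM z i : M < `|z| -> X i z = 0.
  by move=> Mz; apply/eqP/negPn/negP => /dX[]; rewrite leNgt Mz.
pose Q : set rV := [set z | `|z| <= M + 1].
(* The support of [X], and of a mollification at scale at most 1, lies in [Q]. Cutting [B] off there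
   changes no flux and makes its indicator tame. *)
pose B' := B `&` Q.
have mQ : lebesgue_measurable Q.
  apply: measurable_closed; rewrite (_ : Q = Num.norm @^-1` [set x | x <= M + 1])//.
  by apply: closed_comp => [z _|]; [exact: norm_continuous|exact: closed_le].
have mB' : lebesgue_measurable B' by exact: (@measurableI _ (lebesgue_space R d)).
have B'M z : B' z -> `|z| <= M + 1 by case.
have tB' : tame (\1_B' : rV -> R) by exact: tame_indic B'M.
have out (Y : 'I_d -> rV -> R) : (forall z i, M + 1 < `|z| -> Y i z = 0) ->
    forall z, \1_B z * divg Y z = \1_B' z * divg Y z.
  move=> hY z; have [zM|zM] := leP `|z| (M + 1).
    congr (_ * _); rewrite !indicE; congr (nat_of_bool _)%:R.
    by apply/idP/idP; rewrite !inE; [move=> Bz; split|case].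
  by rewrite (divg_out (P := [set z : rV | M + 1 < `|z|])) ?mulr0// => [w Mw i|];
    [exact: hY|exact: open_norm_gt].
pose D := divg X; have tD : tame D by exact: tame_divg.
pose s z : R := 1 - 2 * \1_A z.
have s1 z : `|s z| <= 1.
  rewrite /s indicE; case: (_ \in _) => /=; rewrite ?mulr1n ?mulr0n ?mulr1 ?mulr0.
    by rewrite (_ : 1 - 2 = -1) ?normrN1//; lra.
  by rewrite subr0 normr1.
have ms : lmfun s.
  have := lmfunD (lmfun_cst 1) (lmfunM (lmfun_cst (-2)) (lmfun_indic mA)).
  by congr lmfun; apply/funext => z; rewrite mulNr.
have tsD : tame (fun z => s z * D z) by exact: tameM s1 tD.
have tAD : tame (fun z => \1_A z * D z) by exact: tame_indicM.
(* The indicator of the symmetric difference is [\1_A + (1 - 2 * \1_A) * \1_B]. *)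
have EF : flux (A `+` B) X = intg (fun z => (s z * D z) * \1_B' z) + intg (fun z => \1_A z * D z).
  rewrite -intgD//; last first.
    by have := tame_indicM mB' tsD; under eq_fun do rewrite mulrC.
  congr intg; apply/funext => z; rewrite -/(divg X z) -/(D z).
  have outX : \1_B z * D z = \1_B' z * D z by apply: out => w i Mw; apply: XM; lra.
  rewrite (_ : s z * D z * \1_B' z = s z * (\1_B z * D z)); last by rewrite outX; ring.
  rewrite -norm_indicB /s !indicE; case: (z \in A); case: (z \in B);
    rewrite /= ?mulr1n ?mulr0n ?subrr ?subr0 ?sub0r ?normrN ?normr0 ?normr1 -/(D z); ring.
apply/ler_addgt0Pl => del del0.
have [e0 e00 he0] := mollifier_approx tsD mB' B'M del0.
pose e := Num.min e0 (Num.min (r / 2) 1).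
have e_gt0 : 0 < e by rewrite !lt_min e00 ltr01 divr_gt0.
have ee0 : e <= e0 by rewrite ge_min lexx.
have er : e <= r / 2 by rewrite !ge_min lexx orbT.
have e1 : e <= 1 by rewrite !ge_min lexx !orbT.
clearbody e; have [k mk] := mollifier_exists nt e_gt0.
have := he0 e k e_gt0 ee0 mk; rewrite ler_norml => /andP[happ _] {he0}.
have [[ck k0 kN ke Ik] _] := mk.
pose b := convol k \1_B'.
have cb : CS b by exact: conv_CS.
have sb := CS_smooth cb.
have b01 z : 0 <= b z <= 1.
  apply/andP; split.
    by apply: intg_ge0 => w; rewrite mulr_ge0//; have /andP[] := indic_01 B' w.
  by apply: le_trans (ler_norm _) _; apply: (conv_mollifier_norm _ mk) => // w; exact: normr_indic.
pose c z := 1 - 2 * b z.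
have sc : smooth c by apply: smoothB; [exact: smooth_cst|exact: smoothZ].
have c1 z : `|c z| <= 1 by have /andP[? ?] := b01 z; rewrite ler_norml; apply/andP; split; rewrite /c; lra.
have vc := vfieldM sc c1 vX.
have FA := pA _ vc.
pose g i z := s z * X i z.
have tX i : tame (X i) by exact: CS_tame.
have tg i : tame (g i) by exact: tameM s1 (tX i).
have g1 z : \sum_i g i z ^+ 2 <= 1.
  rewrite -[leRHS](expr1n _ 2); apply: le_trans (nX z); apply: ler_sum => i _.
  by rewrite exprMn ler_piMl ?sqr_ge0// -real_normK ?num_real// expr_le1.
have gd i z : g i z != 0 -> deep O r M z.
  by move=> h; apply: (dX i); apply: contraNneq h => h0; rewrite /g h0 mulr0.
have gJ i : ~~ J i -> g i = fun=> 0.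
  by move=> /jX h; apply/funext => z; rewrite /g h mulr0.
have vg := vfield_convol mk tg g1 gJ gd e_gt0 er.
have FB := pB _ vg.
have pc i : partial i c = fun z => - 2 * partial i b z.
  rewrite partialB ?partialZ ?partial_cst//; [|exact: smooth_cst|exact: smoothZ].
  by apply/funext => z; rewrite sub0r mulNr.
have bndb i : exists2 C, 0 <= C & forall z, `|partial i b z| <= C by exact/CS_bounded/CS_partial.
have tXpb i : tame (fun z => X i z * partial i b z).
  have [C _ hC] := bndb i.
  have := tameM (CS_tame (CS_partial i cb)).1 hC (tX i).
  by under eq_fun do rewrite mulrC.
(* [T] is the derivative of [b] along [X]. In the sum of the two fluxes the terms in [\1_A * T]
   cancel, and [intg T] is traded for the integral of [b * D]. *)
pose T z := \sum_i X i z * partial i b z.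
have tT : tame T by exact: tame_sum.
have cbX i : CS (fun z => b z * X i z) by exact: CSM.
have bD0 : intg (fun z => b z * D z) = - intg T.
  have tbD : tame (fun z => b z * D z).
    have [C _ hC] := CS_bounded cb; exact: tameM (CS_tame cb).1 hC tD.
  have := intg_divg cbX; rewrite (_ : divg _ = fun z => b z * D z + T z).
    by rewrite intgD// => /eqP; rewrite addr_eq0 => /eqP.
  by apply/funext => z; rewrite divgM.
have FAE : flux A (fun i z => c z * X i z) =
    intg (fun z => \1_A z * (c z * D z)) - 2 * intg (fun z => \1_A z * T z).
  rewrite -intgZ; last exact: tame_indicM.
  rewrite -intgB; last 2 first.
  - apply: tame_indicM => //; exact: tameM (measurable_continuous (smooth_continuous sc)) c1 tD.
  - by apply: tameZ; exact: tame_indicM.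
  congr intg; apply/funext => z; rewrite divgM// -/(D z).
  rewrite (_ : \sum_i _ = - 2 * T z); first by ring.
  by rewrite /T mulr_sumr; apply: eq_bigr => i _; rewrite pc; ring.
have FBE : flux B (fun i => convol k (g i)) = - intg (fun z => s z * T z).
  have -> : flux B (fun i => convol k (g i)) = intg (fun z => \1_B' z * divg (fun i => convol k (g i)) z).
    congr intg; apply/funext => z; apply: out => w i Mw.
    apply/eqP/negPn/negP => /(convol_deep mk (tg i) e_gt0 er (gd i))[h _].
    move: (lt_le_trans Mw h); rewrite ltrD2l; apply/negP; by rewrite -leNgt.
  have tpc i : tame (fun z => \1_B' z * partial i (convol k (g i)) z).
    by apply: tame_indicM => //; apply/CS_tame/CS_partial/conv_CS.
  rewrite (_ : (fun z => _) = fun z => \sum_i \1_B' z * partial i (convol k (g i)) z); last first.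
    by apply/funext => z; rewrite mulr_sumr.
  rewrite intg_sum// (eq_bigr (fun i => - intg (fun z => g i z * partial i b z))); last first.
    by move=> i _; rewrite (intg_partial_convol i mk).
  rewrite sumrN; congr (- _).
  rewrite -intg_sum => [|i]; last first.
    by have := tameM ms s1 (tXpb i); under eq_fun do rewrite mulrA.
  congr intg; apply/funext => z; rewrite /T mulr_sumr; apply: eq_bigr => i _.
  by rewrite /g mulrA.
have tbD : tame (fun z => b z * D z).
  have [C _ hC] := CS_bounded cb; exact: tameM (CS_tame cb).1 hC tD.
have E1 : intg (fun z => s z * D z * convol k \1_B' z) =
   intg (fun z => b z * D z) - 2 * intg (fun z => \1_A z * (b z * D z)).
  rewrite -intgZ; last exact: tame_indicM.
  rewrite -intgB//; last by apply: tameZ; exact: tame_indicM.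
  by congr intg; apply/funext => z; rewrite /s -/(b z); ring.
have E2 : intg (fun z => \1_A z * (c z * D z)) = intg (fun z => \1_A z * D z) -
    2 * intg (fun z => \1_A z * (b z * D z)).
  rewrite -intgZ; last exact: tame_indicM.
  rewrite -intgB//; last by apply: tameZ; exact: tame_indicM.
  by congr intg; apply/funext => z; rewrite /c; ring.
have E3 : intg (fun z => s z * T z) = intg T - 2 * intg (fun z => \1_A z * T z).
  rewrite -intgZ; last exact: tame_indicM.
  rewrite -intgB//; last by apply: tameZ; exact: tame_indicM.
  by congr intg; apply/funext => z; rewrite /s; ring.
move: happ FA FB; rewrite EF FAE FBE E1 E2 E3 bD0.
move: (intg T) (intg _) (intg _) (intg _) (intg _) => x1 x2 x3 x4 x5; clear; lra.
Qed.

End mollified_fields.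

(** * Stretching *)

Section scaling.
Context (R : realType) (d : nat).
Local Notation rV := 'rV[R]_d.
Implicit Types (A B C G W O : set rV) (f g k phi : rV -> R) (z w u c t : rV).
Implicit Types (X : 'I_d -> rV -> R) (J : pred 'I_d).

Lemma CSin_dmap O c t phi : dpos c -> (forall z, O (dmap c t z) <-> O z) ->
  CSin O phi -> CSin O (phi \o dmap c t).
Proof.
move=> c0 Oc cp; have [sp [r [M [r0 h]]]] := cp.
split; first by have [] := smooth_dmap c t sp.
have [_ [N hN]] := tame_dmap t c0 (CS_tame (CSin_CS cp)).
exists (r / (`|c| + 1)), N; split; first by rewrite divr_gt0// ltr_wpDl.
move=> z pz; split; first by rewrite leNgt; apply/negP => /(hN z).2 /eqP; apply/negP.
move=> w; rewrite ltr_pdivlMr ?ltr_wpDl// => zw; apply/Oc.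
have [_ hr] := h _ pz; apply: hr; apply: norm_lt => // i; rewrite !mxE.
rewrite opprD addrACA subrr addr0 -mulrBr normrM; apply: le_lt_trans zw.
rewrite mulrC ler_pM//; first by have := le_coord (z - w) i; rewrite !mxE.
by apply: le_trans (le_coord c i) _; rewrite lerDl.
Qed.

(** The weight [c 0 i] cancels the factor of the chain rule: the divergence of the new field is the
    old divergence composed with the inverse map. *)
Definition pull c t X i : rV -> R := fun z => c 0 i * X i (dmap (dminv c) (dmtrans c t) z).

Lemma flux_dmap G c t X : dpos c -> lebesgue_measurable G -> (forall i, CS (X i)) ->
  flux (dmap c t @^-1` G) X = (ddet c)^-1 * flux G (pull c t X).
Proof.
move=> c0 mG cX; have c'0 := dpos_inv c0.
have E z : divg (pull c t X) z = divg X (dmap (dminv c) (dmtrans c t) z).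
  apply: eq_bigr => i _; have [sX pX] := smooth_dmap (dminv c) (dmtrans c t) (CS_smooth (cX i)).
  rewrite /pull (partialZ (c 0 i) i sX) pX mxE mulrA divff ?mul1r//.
  by rewrite gt_eqF.
have tI : tame (fun z => \1_G z * divg (pull c t X) z).
  apply: tame_indicM => //; rewrite (_ : divg _ = divg X \o dmap (dminv c) (dmtrans c t)).
    by apply: tame_dmap => //; exact: tame_divg.
  exact/funext/E.
rewrite /flux -(intg_dmap t c0 tI); congr intg; apply/funext => z /=.
by rewrite E dmapK.
Qed.

Lemma vfield_pull J O c t X (s A : R) : dpos c -> 0 <= A ->
  (forall z, O (dmap c t z) <-> O z) ->
  (forall i, J i -> c 0 i <= A) -> vfield J O s X -> vfield J O (A * s) (pull c t X).
Proof.
move=> c0 A0 Oc cA [cX jX nX]; have c'0 := dpos_inv c0.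
have Oc' z : O (dmap (dminv c) (dmtrans c t) z) <-> O z.
  by rewrite -{2}(dmapVK t c0 z) Oc.
split.
- by move=> i; apply: CSinM; [exact: smooth_cst|exact: CSin_dmap].
- by move=> i /jX h; apply/funext => z; rewrite /pull h mulr0.
- move=> z; rewrite exprMn; apply: le_trans (ler_wpM2l (sqr_ge0 _) (nX (dmap (dminv c) (dmtrans c t) z))).
  rewrite mulr_sumr; apply: ler_sum => i _; rewrite /pull exprMn.
  have [Ji|/jX ->] := boolP (J i); last by rewrite expr0n !mulr0.
  by rewrite ler_wpM2r ?sqr_ge0// ler_sqr ?nnegrE ?cA// ltW.
Qed.

Lemma pbound_dmap J O c t G (A p : R) : dpos c -> 0 < A ->
  (forall z, O (dmap c t z) <-> O z) -> (forall i, J i -> c 0 i <= A) ->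
  lebesgue_measurable G -> pbound J O G p ->
  pbound J O (dmap c t @^-1` G) ((ddet c)^-1 * (A * p)).
Proof.
move=> c0 A0 Oc cA mG pG X vX; rewrite flux_dmap//; last exact: vfield_CS vX.
rewrite ler_pM2l ?invr_gt0 ?ddet_gt0// -[A in leRHS]mulr1.
apply: (pbound_flux mG pG); first by rewrite mulr1.
by apply: vfield_pull => //; exact: ltW.
Qed.

(* Adding a small J'-field zeta to the pulled back fields costs only a second
   order increase of their norm, so that flux G zeta > 0 would produce a strict
   inequality. *)
Lemma pbound_dmap_rigid J' O c t G (A th p : R) : dpos c -> 0 < A -> 0 < th < 1 ->
  (forall z, O (dmap c t z) <-> O z) -> (forall i, c 0 i <= A) ->
  (forall i, J' i -> c 0 i <= th * A) ->
  lebesgue_measurable G -> pbound predT O G p ->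
  (forall q, pbound predT O (dmap c t @^-1` G) q -> (ddet c)^-1 * (A * p) <= q) ->
  pbound J' O G 0.
Proof.
move=> c0 A0 /andP[th0 th1] Oc cA cth mG pG lowq zt vz.
have th2 : 0 < 1 - th ^+ 2 by rewrite subr_gt0 expr_lt1// ltW.
(* The smallest K with (th x + v)^2 <= x^2 + K v^2 for all x and v; the difference of the two sides
   is K times a square. *)
pose K := (1 - th ^+ 2)^-1; have K0 : 0 < K by rewrite invr_gt0.
have cz := vfield_CS vz.
apply: (@le_of_quad _ _ _ (K * p)) => h h0 h1; rewrite mulr0 add0r.
have hK : 0 < 1 + K * h ^+ 2 by rewrite ltr_wpDr// mulr_ge0 ?sqr_ge0// ltW.
(* This is the bound for the preimage that follows once the perturbed field is known to have norm at
   most A (1 + K h^2). *)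
have := lowq ((ddet c)^-1 * (A * ((1 + K * h ^+ 2) * p - h * flux G zt))).
rewrite !ler_pM2l ?invr_gt0 ?ddet_gt0// => H.
suff /H : pbound predT O (dmap c t @^-1` G)
    ((ddet c)^-1 * (A * ((1 + K * h ^+ 2) * p - h * flux G zt))).
  by rewrite mulrDl mul1r mulrAC; lra.
move=> X vX; rewrite flux_dmap//; last exact: vfield_CS vX.
rewrite ler_pM2l ?invr_gt0 ?ddet_gt0// mulrBr lerBrDr [_ * (h * _)]mulrA.
have vp := vfield_pull c0 (ltW A0) Oc (fun i _ => cA i) vX.
have cp := vfield_CS vp.
rewrite -fluxZ// -fluxD//; last by move=> i; exact: CSZ.
rewrite mulrA; apply: (pbound_flux mG pG); first exact: mulr_gt0.
have [cX _ nX] := vX; have [cz' jz nz] := vz; have [cp' _ _] := vp.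
split => [i|//|z].
  by apply: CSinD => //; apply: CSinM => //; exact: smooth_cst.
set y := dmap (dminv c) (dmtrans c t) z.
apply: (@le_trans _ _ (\sum_i (A ^+ 2 * X i y ^+ 2 + A ^+ 2 * h ^+ 2 * K * zt i z ^+ 2))).
  apply: ler_sum => i _; rewrite /pull -/y.
  have [Ji|/jz h'] := boolP (J' i); last first.
    rewrite h' !(mulr0, addr0) expr0n/= !(mulr0, addr0) exprMn ler_wpM2r ?sqr_ge0//.
    by rewrite ler_sqr ?nnegrE ?cA// ltW.
  have ci0 := c0 i; have ci := cth i Ji.
  have quad (x v : R) : (th * x + v) ^+ 2 <= x ^+ 2 + K * v ^+ 2.
    have hk : K * (1 - th ^+ 2) = 1 by rewrite mulVf// gt_eqF.
    have := sqr_ge0 (x * (1 - th ^+ 2) - th * v).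
    move=> hs; have : 0 <= K * (x * (1 - th ^+ 2) - th * v) ^+ 2 by rewrite mulr_ge0// ltW.
    have -> : K * (x * (1 - th ^+ 2) - th * v) ^+ 2 =
        K * (1 - th ^+ 2) * (x ^+ 2 * (1 - th ^+ 2) - 2 * x * th * v) + K * th ^+ 2 * v ^+ 2.
      by ring.
    have -> : K * th ^+ 2 = K - K * (1 - th ^+ 2) by ring.
    by rewrite hk; lra.
  have [ca caE] : exists ca, c 0 i = th * ca.
    by exists (c 0 i / th); rewrite mulrC divfK// gt_eqF.
  rewrite caE -mulrA; apply: le_trans (quad _ _) _.
  have ca0 : 0 < ca by move: ci0; rewrite caE pmulr_rgt0.
  have caA : ca <= A by move: ci; rewrite caE ler_pM2l.
  rewrite !exprMn; apply: lerD; last by rewrite le_eqVlt; apply/orP; left; apply/eqP; ring.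
  by rewrite ler_wpM2r ?sqr_ge0// ler_sqr ?nnegrE// ltW.
rewrite big_split/= -!mulr_sumr.
have := nX y; have := nz z; rewrite !expr1n => n1 n2.
apply: (@le_trans _ _ (A ^+ 2 + A ^+ 2 * h ^+ 2 * K)).
  apply: lerD; first by rewrite -[leRHS]mulr1 ler_wpM2l ?sqr_ge0.
  by rewrite -[leRHS]mulr1 ler_wpM2l// mulr_ge0// ?mulr_ge0 ?sqr_ge0// ltW.
have u0 : 0 <= K * h ^+ 2 by rewrite mulr_ge0 ?sqr_ge0// ltW.
rewrite (_ : A ^+ 2 + _ = A ^+ 2 * (1 + K * h ^+ 2)); last by ring.
rewrite exprMn ler_wpM2l ?sqr_ge0// expr2 ler_peMr//; last by rewrite lerDl.
exact: ltW.
Qed.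

End scaling.

(** * Cutting the perimeter into two parts *)

Section split_perimeter.
Context (R : realType) (d : nat).
Local Notation rV := 'rV[R]_d.
Implicit Types (A B C F G L W O : set rV) (f g k phi : rV -> R) (z w u c t : rV).
Implicit Types (X : 'I_d -> rV -> R) (J : pred 'I_d).

Definition lconst A z : Prop := exists2 r : R, 0 < r & forall w, `|z - w| < r -> (A w <-> A z).

Definition vanishes f z : Prop := exists2 r : R, 0 < r & forall w, `|z - w| < r -> f w = 0.

Lemma near_norm (P : rV -> Prop) z (r : R) : 0 < r -> (forall w, `|z - w| < r -> P w) ->
  \forall w \near z, P w.
Proof.
move=> r0 h; apply/nbhs_ballP; exists r => //= w /rv_ball_norm; exact: h.
Qed.

Lemma near_dist (P : rV -> Prop) z : (\forall w \near z, P w) ->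
  exists2 r : R, 0 < r & forall w, `|z - w| < r -> P w.
Proof.
by move=> /nbhs_ballP[r /= r0 h]; exists r => // w /rv_ball_norm; exact: h.
Qed.

Lemma vanishes_out O f z : sup_in O f -> ~ O z -> vanishes f z.
Proof.
move=> [r [M [r0 h]]] nO; exists r => // w zw; apply/eqP/negPn/negP => /h[_].
by move=> /(_ z); rewrite distrC => /(_ zw).
Qed.

Variant local_indic A f z : Prop :=
| LocalIn of A z & (\forall w \near z, \1_A w * f w = f w)
| LocalOut of (forall i, \1_A z * partial i f z = 0) & (\forall w \near z, \1_A w * f w = 0).

Lemma lconst_local A f z : lconst A z \/ vanishes f z -> local_indic A f z.
Proof.
case=> [|] [r r0 h].
  have [Az|nA] := pselect (A z).
    by left=> //; apply: near_norm r0 _ => w /h wz; rewrite indicE mem_set ?mul1r//; apply/wz.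
  right=> [i|]; first by rewrite indicE memNset ?mul0r.
  by apply: near_norm r0 _ => w /h wz; rewrite indicE memNset ?mul0r// => /wz.
right=> [i|]; last by apply: near_norm r0 _ => w /h ->; rewrite mulr0.
by rewrite (@partial_local _ _ f (fun=> 0)) ?partial_cst ?mulr0//; exact: near_norm r0 h.
Qed.

(** Each point has a neighbourhood where the product is either [phi] or 0, because [\1_A] can only
    jump where [phi] vanishes. *)
Lemma CSin_indicM O A phi : CSin O phi -> (forall z, O z -> lconst A z \/ vanishes phi z) ->
  CSin O (fun z => \1_A z * phi z) /\
  forall i, partial i (fun z => \1_A z * phi z) = fun z => \1_A z * partial i phi z.
Proof.
move=> cp h; have [sp dp] := cp.
have H z : local_indic A phi z.
  apply: lconst_local.
  by have [/h//|nO] := pselect (O z); right; exact: vanishes_out nO.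
split; first split.
- apply: smooth_local => z; case: (H z) => _ h1.
    by exists phi => //; apply: filterS h1 => w ->.
  by exists (fun=> 0); [exact: smooth_cst|apply: filterS h1 => w ->].
- by apply: sup_in1 dp => z ->; rewrite mulr0.
- move=> i; apply/funext => z; case: (H z) => [Az|->] h1; rewrite (partial_local i h1).
    by rewrite indicE mem_set ?mul1r.
  by rewrite partial_cst.
Qed.

(** [\1_A * X] is again a smooth compactly supported field, so its divergence has integral 0:
    nothing flows out where [A] has no boundary. *)
Lemma flux_lconst0 O A X : (forall i, CSin O (X i)) ->
  (forall i z, O z -> lconst A z \/ vanishes (X i) z) -> flux A X = 0.
Proof.
move=> cX h.
have hX i := CSin_indicM (cX i) (h i).
rewrite -(@intg_divg _ _ (fun i z => \1_A z * X i z)); last first.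
  by move=> i; exact: CSin_CS (hX i).1.
congr intg; apply/funext => z; rewrite /divg mulr_sumr; apply: eq_bigr => i _.
by rewrite (hX i).2.
Qed.

(* chi is the mollified indicator of a neighbourhood of K. *)
Lemma smooth_cutoff (K F : set rV) : (0 < volume [set: rV])%E ->
  compact K -> closed F -> K `&` F = set0 ->
  exists chi : rV -> R, [/\ smooth chi, forall z, 0 <= chi z <= 1,
    forall z, K z -> vanishes (fun w => 1 - chi w) z & forall z, F z -> vanishes chi z].
Proof.
move=> nt cK cF KF.
have [r [M [r0 dK]]] : exists r M : R, 0 < r /\ K `<=` deep (~` F) r M.
  apply: compact_sub_deep => //; first exact: closed_openC.
  by move=> z Kz Fz; have : (K `&` F) z by []; rewrite KF.
pose B : set rV := [set w | exists2 z, K z & `|z - w| < r / 2].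
have oB : open B.
  apply/rv_openP => w [z Kz zw]; exists (r / 2 - `|z - w|); first by rewrite subr_gt0.
  by move=> u wu; exists z => //; have := ler_distD w z u; lra.
have BM w : B w -> `|w| <= M + r.
  move=> [z /dK[zM _] zw]; have := ler_normD (w - z) z; rewrite subrK distrC; lra.
have tB : tame (\1_B : rV -> R) by apply: tame_indic BM; exact: measurable_open.
have r4 : 0 < r / 4 by lra.
have [k mk] := mollifier_exists nt r4.
have [[ck _ _ _ _] _] := mk.
exists (convol k \1_B); split.
- exact: conv_smooth.
- move=> z; have i01 w := andP (indic_01 B w).
  rewrite -(conv_mollifier_cst (z := z) mk (@tame0 _ _) (fun _ _ => erefl)).
  apply/andP; split.
    by apply: (conv_mollifier_le mk (@tame0 _ _) tB) => w _; exact: (i01 w).1.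
  apply: le_trans (ler_norm _) _; apply: (conv_mollifier_norm _ mk tB) => w.
  exact: normr_indic.
- move=> z Kz; exists (r / 4); first lra.
  move=> w zw; rewrite (conv_mollifier_cst (c := 1) mk tB) ?subrr// => u wu.
  rewrite indicE mem_set//; exists z => //; have := ler_distD w z u; lra.
- move=> z Fz; exists (r / 4); first lra.
  move=> w zw; apply: (conv_mollifier_cst mk tB) => u wu.
  rewrite indicE memNset// => -[y /dK[_ /(_ z) h] yu]; apply: h => //.
  have := ler_distD w z u; have := ler_distD u y z; rewrite [`|u - z|]distrC; lra.
Qed.

(** Pointwise a convex combination of two vectors of norm at most [s], as [a] and [b] are signs; the
    square is convex. *)
Lemma vfield_split O s X1 X2 (a b chi : rV -> R) :
  (forall i, CSin O (fun z => chi z * (a z * X1 i z) + (1 - chi z) * (b z * X2 i z))) ->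
  (forall z, 0 <= chi z <= 1) -> (forall z, a z ^+ 2 = 1) -> (forall z, b z ^+ 2 = 1) ->
  vfield predT O s X1 -> vfield predT O s X2 ->
  vfield predT O s (fun i z => chi z * (a z * X1 i z) + (1 - chi z) * (b z * X2 i z)).
Proof.
move=> cZ c01 a1 b1 [_ _ n1] [_ _ n2]; split => // z.
have [c0 c1] := andP (c01 z).
apply: (@le_trans _ _ (\sum_i (chi z * X1 i z ^+ 2 + (1 - chi z) * X2 i z ^+ 2))).
  apply: ler_sum => i _.
  have -> : X1 i z ^+ 2 = (a z * X1 i z) ^+ 2 by rewrite exprMn a1 mul1r.
  have -> : X2 i z ^+ 2 = (b z * X2 i z) ^+ 2 by rewrite exprMn b1 mul1r.
  move: (a z * _) (b z * _) (chi z) c0 c1 => x y c c0 c1.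
  have : 0 <= c * (1 - c) * (x - y) ^+ 2 by rewrite mulr_ge0 ?sqr_ge0// mulr_ge0// subr_ge0.
  lra.
rewrite big_split/= -!mulr_sumr; have := n1 z; have := n2 z.
by move: (\sum_i _) (\sum_i _) => x y hx hy; nra.
Qed.

(** On [O] one has [(1 - 2 * \1_G2) * \1_E = \1_G1 - \1_G2], and [G2] contributes no flux of [Y1],
    being locally constant on its support. The same holds with the indices exchanged. *)
Lemma flux_split_field O E G1 G2 (Y1 Y2 : 'I_d -> rV -> R) :
  lebesgue_measurable G1 -> lebesgue_measurable G2 ->
  (forall z, O z -> (E z <-> (G1 `+` G2) z)) ->
  (forall i, CSin O (Y1 i)) -> (forall i, CSin O (Y2 i)) ->
  (forall i z, O z -> lconst G2 z \/ vanishes (Y1 i) z) ->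
  (forall i z, O z -> lconst G1 z \/ vanishes (Y2 i) z) ->
  let Z i z := (Y1 i z + (-2) * (\1_G2 z * Y1 i z)) + (Y2 i z + (-2) * (\1_G1 z * Y2 i z)) in
  (forall i, CSin O (Z i)) /\ flux E Z = flux G1 Y1 + flux G2 Y2.
Proof.
move=> mG1 mG2 EG cY1 cY2 hY1 hY2 Z.
have iY1 i := CSin_indicM (cY1 i) (hY1 i); have iY2 i := CSin_indicM (cY2 i) (hY2 i).
have cst2 : smooth (fun _ : rV => -2 : R) by exact: smooth_cst.
have sY1 i := (cY1 i).1; have sY2 i := (cY2 i).1.
have siY1 i := (iY1 i).1.1; have siY2 i := (iY2 i).1.1.
split=> [i|].
  exact: CSinD (CSinD (cY1 i) (CSinM cst2 (iY1 i).1)) (CSinD (cY2 i) (CSinM cst2 (iY2 i).1)).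
have dZ z : divg Z z = (1 - 2 * \1_G2 z) * divg Y1 z + (1 - 2 * \1_G1 z) * divg Y2 z.
  rewrite /divg !mulr_sumr -big_split/=; apply: eq_bigr => i _.
  rewrite /Z partialD; [|by apply: smoothD => //; exact: smoothZ..].
  rewrite (partialD _ (sY1 i)); last exact: smoothZ.
  rewrite (partialD _ (sY2 i)); last exact: smoothZ.
  rewrite (partialZ _ _ (siY1 i)) (partialZ _ _ (siY2 i)) (iY1 i).2 (iY2 i).2.
  by ring.
have out Y z : (forall i, CSin O (Y i)) -> ~ O z -> divg Y z = 0.
  move=> cY nO; rewrite /divg big1// => i _.
  have [r r0 h] := vanishes_out (cY i).2 nO.
  by rewrite (@partial_local _ _ (Y i) (fun=> 0)) ?partial_cst//; exact: near_norm r0 h.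
have tY1 : tame (divg Y1) by apply: tame_divg => i; exact: CSin_CS (cY1 i).
have tY2 : tame (divg Y2) by apply: tame_divg => i; exact: CSin_CS (cY2 i).
rewrite -[flux G1 Y1]subr0 -[flux G2 Y2]subr0.
rewrite -{1}(flux_lconst0 cY1 hY1) -(flux_lconst0 cY2 hY2) /flux.
move: (divg Z) (divg Y1) (divg Y2) dZ (out _ ^~ cY1) (out _ ^~ cY2) tY1 tY2.
clear -mG1 mG2 EG => D D1 D2 dZ o1 o2 t1 t2.
have t11 := tame_indicM mG1 t1; have t21 := tame_indicM mG2 t1.
have t12 := tame_indicM mG1 t2; have t22 := tame_indicM mG2 t2.
rewrite -(intgB t11 t21) -(intgB t22 t12) -(intgD (tameB t11 t21) (tameB t22 t12)).
congr intg; apply/funext => z; rewrite dZ.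
have [Oz|nO] := pselect (O z); last by rewrite (o1 _ nO) (o2 _ nO); ring.
have -> : (\1_E z : R) = \1_G1 z + \1_G2 z - 2 * (\1_G1 z * \1_G2 z).
  have := EG z Oz; rewrite /setY/= !indicE.
  have [g1|g1] := pselect (G1 z); have [g2|g2] := pselect (G2 z);
    (rewrite ?(mem_set g1) ?(memNset g1) ?(mem_set g2) ?(memNset g2) /= => hE);
    (have [e|e] := pselect (E z); rewrite ?(mem_set e) ?(memNset e) /=);
    try ring; exfalso; tauto.
by rewrite !indicE; case: (z \in G1); case: (z \in G2) => /=; ring.
Qed.

(* With chi = 1 near F1 and 0 near F2, the single field
   chi (1 - 2 * 1_G2) X1 + (1 - chi) (1 - 2 * 1_G1) X2 is smooth and tests E. *)
Lemma split_flux O E F1 F2 G1 G2 p X1 X2 : (0 < volume [set: rV])%E ->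
  closed F1 -> closed F2 -> F1 `&` F2 = set0 ->
  lebesgue_measurable G1 -> lebesgue_measurable G2 -> lebesgue_measurable E ->
  (forall z, O z -> (E z <-> (G1 `+` G2) z)) ->
  (forall z, O z -> ~ F1 z -> lconst G1 z) -> (forall z, O z -> ~ F2 z -> lconst G2 z) ->
  pbound predT O E p -> vfield predT O 1 X1 -> vfield predT O 1 X2 ->
  flux G1 X1 + flux G2 X2 <= p.
Proof.
move=> nt cF1 cF2 F12 mG1 mG2 mE EG l1 l2 pE v1 v2.
have [r1 [M1 [r10 d1]]] := vfield_deep v1; have [r2 [M2 [r20 d2]]] := vfield_deep v2.
have [c1 _ _] := v1; have [c2 _ _] := v2.
pose L : set rV := [set z | `|z| <= Num.max M1 M2].
(* [F1] may be unbounded, but only its part in a ball containing the supports of [X1] and [X2]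
   matters. *)
have cL : compact (F1 `&` L).
  apply: bounded_closed_compact.
    by exists (Num.max M1 M2); split; rewrite ?num_real// => y My z [_ /le_trans h]; apply: h; exact: ltW.
  apply: closedI => //; rewrite (_ : L = Num.norm @^-1` [set x | x <= Num.max M1 M2])//.
  by apply: closed_comp => [z _|]; [exact: norm_continuous|exact: closed_le].
have F12L : (F1 `&` L) `&` F2 = set0 by rewrite setIAC F12 set0I.
have [chi [schi chi01 chi1 chi0]] := smooth_cutoff nt cL cF2 F12L.
have oL z : ~ L z -> forall i, vanishes (X1 i) z /\ vanishes (X2 i) z.
  move=> /negP; rewrite -ltNge gt_max => /andP[z1 z2] i; split.
    by apply/near_dist; apply: filterS (near_norm_gt z1) => w Mw; apply/eqP/negPn/negP => /d1[]; rewrite leNgt Mw.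
  by apply/near_dist; apply: filterS (near_norm_gt z2) => w Mw; apply/eqP/negPn/negP => /d2[]; rewrite leNgt Mw.
have vM f g z : vanishes f z -> vanishes (fun w => f w * g w) z.
  by move=> [r r0 h]; exists r => // w /h ->; rewrite mul0r.
have vM' f g z : vanishes g z -> vanishes (fun w => f w * g w) z.
  by move=> [r r0 h]; exists r => // w /h ->; rewrite mulr0.
have h2 i (f : rV -> R) z : O z -> lconst G2 z \/ vanishes (fun w => chi w * f w) z.
  by move=> Oz; have [/chi0 h|h] := pselect (F2 z); [right; exact: vM|left; exact: l2].
have h1 (Y : 'I_d -> rV -> R) : (forall z i, ~ L z -> vanishes (Y i) z) -> forall i z, O z ->
    lconst G1 z \/ vanishes (fun w => (1 - chi w) * Y i w) z.
  move=> hY i z Oz; have [F1z|h] := pselect (F1 z); last by left; exact: l1.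
  right; have [Lz|nL] := pselect (L z); last by apply: vM'; exact: hY.
  by apply: vM; exact: chi1.
have schi' : smooth (fun z => 1 - chi z) by apply: smoothB => //; exact: smooth_cst.
pose Y1 i z := chi z * X1 i z; pose Y2 i z := (1 - chi z) * X2 i z.
have cY1 i : CSin O (Y1 i) by exact: CSinM.
have cY2 i : CSin O (Y2 i) by exact: CSinM.
have hY1 i z : O z -> lconst G2 z \/ vanishes (Y1 i) z by exact: h2.
have hY2 i z : O z -> lconst G1 z \/ vanishes (Y2 i) z.
  by apply: h1 => w j /oL/(_ j)[].
have [cZ fZ] := flux_split_field mG1 mG2 EG cY1 cY2 hY1 hY2.
pose s1 z : R := 1 - 2 * \1_G1 z; pose s2 z : R := 1 - 2 * \1_G2 z.
have sq (A : set rV) z : (1 - 2 * \1_A z) ^+ 2 = 1 :> R.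
  by rewrite indicE; case: (z \in A) => /=; ring.
pose Z i z := chi z * (s2 z * X1 i z) + (1 - chi z) * (s1 z * X2 i z).
have ZE : (fun i z => (Y1 i z + (-2) * (\1_G2 z * Y1 i z)) +
    (Y2 i z + (-2) * (\1_G1 z * Y2 i z))) = Z.
  by apply/funext => i; apply/funext => z; rewrite /Z /Y1 /Y2 /s1 /s2; ring.
have vZ : vfield predT O 1 Z.
  apply: vfield_split => //; try by move=> z; exact: sq.
  by move=> i; rewrite -/(Z i) -ZE; exact: cZ.
have := pE Z vZ; rewrite -ZE fZ.
(* The remaining part of [X1] vanishes near [F1] and so has no flux through [G1]; likewise for [X2]
   and [G2]. *)
have e1 : flux G1 X1 = flux G1 Y1 + flux G1 (fun i z => (1 - chi z) * X1 i z).
  have C1 i : CS (Y1 i) by exact: CSin_CS (cY1 i).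
  have C2 i : CS (fun z => (1 - chi z) * X1 i z) by apply: CSM => //; exact: CSin_CS (c1 i).
  apply: etrans (fluxD mG1 C1 C2).
  by congr flux; apply/funext => i; apply/funext => z; rewrite /Y1; ring.
have e2 : flux G2 X2 = flux G2 (fun i z => chi z * X2 i z) + flux G2 Y2.
  have C1 i : CS (Y2 i) by exact: CSin_CS (cY2 i).
  have C2 i : CS (fun z => chi z * X2 i z) by apply: CSM => //; exact: CSin_CS (c2 i).
  apply: etrans (fluxD mG2 C2 C1).
  by congr flux; apply/funext => i; apply/funext => z; rewrite /Y2; ring.
rewrite e1 e2 (flux_lconst0 (O := O) (A := G1) (X := fun i z => (1 - chi z) * X1 i z)).
- rewrite (flux_lconst0 (O := O) (A := G2) (X := fun i z => chi z * X2 i z)).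
  + by rewrite addr0 add0r.
  + by move=> i; exact: CSinM.
  + by move=> i z; exact: h2.
- by move=> i; exact: CSinM.
- by apply: h1 => z i /oL/(_ i)[].
Qed.

Definition per J O G : R := sup [set flux G X | X in vfield J O 1].

Lemma vfield_zero J O : vfield J O 1 (fun i => fun=> 0).
Proof.
split => [i|//|z]; first exact: CSin0.
by rewrite big1 ?expr1n// => i _; rewrite expr0n.
Qed.

Lemma pbound_per J O G p : pbound J O G p -> pbound J O G (per J O G) /\ per J O G <= p.
Proof.
move=> pG; split => [X vX|].
  by apply: sup_ubound; [exists p => _ [Y vY <-]; exact: pG|exists X].
apply: ge_sup; first by exists (flux G (fun i => fun=> 0)), (fun i => fun=> 0) => //; exact: vfield_zero.
by move=> _ [Y vY <-]; exact: pG.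
Qed.

(** The joint bound on the two fluxes is separated by taking the supremum over [X1] with [X2] fixed,
    and then the one over [X2]. *)
Lemma split_perimeter O E F1 F2 G1 G2 p : (0 < volume [set: rV])%E ->
  closed F1 -> closed F2 -> F1 `&` F2 = set0 ->
  lebesgue_measurable G1 -> lebesgue_measurable G2 -> lebesgue_measurable E ->
  (forall z, O z -> (E z <-> (G1 `+` G2) z)) ->
  (forall z, O z -> ~ F1 z -> lconst G1 z) -> (forall z, O z -> ~ F2 z -> lconst G2 z) ->
  pbound predT O E p ->
  exists p1 p2, [/\ pbound predT O G1 p1, pbound predT O G2 p2 & p1 + p2 <= p].
Proof.
move=> nt cF1 cF2 F12 mG1 mG2 mE EG l1 l2 pE.
have H := split_flux nt cF1 cF2 F12 mG1 mG2 mE EG l1 l2 pE.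
have v0 := vfield_zero predT O.
have f0 G : flux G (fun i => fun=> 0) = 0.
  rewrite /flux (_ : (fun z => _) = fun=> 0) ?intg0//.
  by apply/funext => z; rewrite /divg big1 ?mulr0// => i _; rewrite partial_cst.
have b1 X2 : vfield predT O 1 X2 -> pbound predT O G1 (p - flux G2 X2).
  by move=> v2 X1 v1; rewrite lerBrDr; exact: H.
exists (per predT O G1), (p - per predT O G1); split.
- by have [] := pbound_per (b1 _ v0).
- by move=> X2 v2; have [_] := pbound_per (b1 _ v2); lra.
- by lra.
Qed.

End split_perimeter.

(** * Translations and vanishing perimeter *)

Section translation.
Context (R : realType) (d : nat).
Local Notation rV := 'rV[R]_d.
Implicit Types (A B C F G L W O : set rV) (f g k phi : rV -> R) (z w u c t : rV).
Implicit Types (X : 'I_d -> rV -> R) (J : pred 'I_d).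

Lemma measurable_ball_norm (N : R) : lebesgue_measurable [set z : rV | `|z| <= N].
Proof.
apply: measurable_closed; rewrite (_ : mkset _ = Num.norm @^-1` [set x | x <= N])//.
by apply: closed_comp => [z _|]; [exact: norm_continuous|exact: closed_le].
Qed.

Lemma volume_ball_norm (N : R) : (volume [set z : rV | (`|z| <= N)%R] < +oo)%E.
Proof. by apply: (@volume_bounded _ _ _ N). Qed.

Lemma normZe (s : R) (i : 'I_d) : `|s *: (e_ i : rV)| <= `|s|.
Proof. exact: norm_e. Qed.

Lemma is_derive_translate G phi i (s : R) : lebesgue_measurable G -> CS phi ->
  is_derive s (1 : R) (fun s : R => intg (fun z => \1_G z * phi (z + s *: e_ i)))
    (intg (fun z => \1_G z * partial i phi (z + s *: e_ i))).
Proof.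
move=> mG cp; have [C C0 hC] := CS_taylor i cp.
have [_ [N hN]] := cp; have [_ [N' hN']] := CS_partial i cp.
pose Q : set rV := [set z | `|z| <= `|N| + `|N'| + `|s| + 1].
have mQ : lebesgue_measurable Q by exact: measurable_ball_norm.
have tp u : tame (fun z => \1_G z * phi (z + u)).
  by apply: tame_indicM => //; exact/CS_tame/CS_sh.
have tp' u : tame (fun z => \1_G z * partial i phi (z + u)).
  by apply: tame_indicM => //; exact/CS_tame/CS_sh/CS_partial.
apply: (@is_derive_quad _ _ _ _ _ _ (C * fine (volume Q)) 1) => // h h1.
have tZ := tameZ h (tp' (s *: e_ i)).
rewrite -(intgB (tp _) (tp _)) -(intgZ h (tp' _)) -(intgB (tameB (tp _) (tp _)) tZ).
have -> : C * fine (volume Q) * h ^+ 2 = `|C * h ^+ 2| * fine (volume Q).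
  have hh : 0 <= C * h ^+ 2 by rewrite mulr_ge0 ?sqr_ge0.
  by rewrite (ger0_norm hh); ring.
apply: intg_bound => //.
- exact: tameB (tameB (tp _) (tp _)) tZ.
- exact: volume_ball_norm.
- move=> z; rewrite mulrCA -mulrBr -mulrBr normrM.
  apply: le_trans (hC (z + s *: e_ i) h).
  rewrite [_ *: 1]mulr1 scalerDl [h *: _ + _]addrC addrA.
  by rewrite ler_piMl// normr_indic.
- move=> z /negP; rewrite -ltNge => zQ.
  have far (a : R) : `|a| <= `|s| + 1 -> `|N| + `|N'| < `|z + a *: e_ i|.
    move=> ha; have := ler_normB (z + a *: e_ i) (a *: e_ i); rewrite addrK.
    by have := normZe a i; lra.
  have hs1 : `|h *: 1 + s| <= `|s| + 1.
    by rewrite [_ *: 1]mulr1; apply: le_trans (ler_normD _ _) _; lra.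
  have hs2 : `|s| <= `|s| + 1 by lra.
  have n1 := ler_norm N; have n2 := ler_norm N'; have n3 := normr_ge0 N; have n4 := normr_ge0 N'.
  rewrite hN ?hN ?hN'; first by ring.
  + by have := far _ hs2; lra.
  + by have := far _ hs2; lra.
  + by have := far _ hs1; lra.
Qed.

(** A function supported here may be pushed by any [s <= t] along [e_ i] and stays supported in [O],
    so it remains a test function. *)
Definition along (i : 'I_d) (t : R) O : set rV :=
  [set z | forall s : R, 0 <= s <= t -> O (z + s *: e_ i)].

Lemma pbound_partial J O G p i phi : lebesgue_measurable G -> pbound J O G p -> J i ->
  CSin O phi -> (forall z, `|phi z| <= 1) -> `|intg (fun z => \1_G z * partial i phi z)| <= p.
Proof.
move=> mG pG Ji cp p1.
have H (f : rV -> R) : CSin O f -> (forall z, `|f z| <= 1) ->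
    intg (fun z => \1_G z * partial i f z) <= p.
  move=> cf f1; pose X j : rV -> R := if j == i then f else fun=> 0.
  have vX : vfield J O 1 X.
    split => [j|j nJ|z].
    - by rewrite /X; case: ifP => // _; exact: CSin0.
    - by rewrite /X; case: eqP => // ji; move: nJ; rewrite ji Ji.
    - rewrite (bigD1 i)//= /X eqxx big1 ?addr0 => [|j /negPf ->]; last by rewrite expr0n.
      by rewrite expr1n -real_normK ?num_real// expr_le1.
  have := pG X vX; rewrite /flux (_ : (fun z => _) = fun z => \1_G z * partial i f z)//.
  apply/funext => z; congr (_ * _); rewrite /divg (bigD1 i)//= /X eqxx big1 ?addr0//.
  by move=> j /negPf ->; rewrite partial_cst.
rewrite ler_norml H// andbT lerNl.
have [sp dp] := cp.
have := H (fun z => - phi z); rewrite partialN//.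
rewrite (_ : (fun z => \1_G z * - partial i phi z) = fun z => - (\1_G z * partial i phi z)); last first.
  by apply/funext => z; rewrite mulrN.
rewrite intgN; last by apply: tame_indicM => //; exact/CS_tame/CS_partial/(CSin_CS cp).
apply=> [|z]; last by rewrite normrN.
split; first exact: smoothN.
by apply: sup_in1 dp => z ->; rewrite oppr0.
Qed.

Lemma CSin_along O i (t s r M : R) phi : 0 <= s <= t -> 0 < r -> smooth phi ->
  (forall z, phi z != 0 -> deep (along i t O) r M z) -> CSin O (fun z => phi (z + (- s) *: e_ i)).
Proof.
move=> st r0 sp dp; split.
  have [h _] := smooth_dmap (const_mx 1) ((- s) *: e_ i) sp.
  by rewrite (sh_dmapE ((- s) *: e_ i) phi).
exists r, (M + `|s|); split => // z /dp[zM h]; split.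
  have := ler_normB (z + (- s) *: e_ i) ((- s) *: e_ i); rewrite addrK.
  by have := normZe (- s) i; rewrite normrN; lra.
move=> w zw; have := h (w + (- s) *: e_ i); rewrite opprD addrACA subrr addr0 => /(_ zw s st).
by rewrite -addrA -scalerDl addNr scale0r addr0.
Qed.

(** The derivative of the pairing in the translation parameter is the flux of a translated
    one-component field, hence bounded by [p]; the mean value theorem gives the factor [t]. *)
Lemma translate_smooth J O G p i (t r M : R) phi : lebesgue_measurable G ->
  pbound J O G p -> J i -> 0 <= t -> 0 < r -> smooth phi -> (forall z, `|phi z| <= 1) ->
  (forall z, phi z != 0 -> deep (along i t O) r M z) ->
  intg (fun z => \1_G z * phi (z + (- t) *: e_ i)) - intg (fun z => \1_G z * phi z) <= t * p.
Proof.
move=> mG pG Ji; rewrite le_eqVlt => /orP[/eqP <- _ _ _ _|t0 r0 sp p1 dp].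
  by rewrite oppr0 scale0r; under eq_fun do rewrite addr0; rewrite subrr mul0r.
have cp : CS phi.
  split => //; exists M => z zM; apply/eqP/negPn/negP => /dp[].
  by rewrite leNgt zM.
have tN : - t < 0 by lra.
have dphi (s : R) := is_derive_translate i s mG cp.
have cphi (D : set R) : {within D, continuous (fun s : R => intg (fun z => \1_G z * phi (z + s *: e_ i)))}.
  apply: continuous_subspaceT => s; apply/differentiable_continuous/derivable1_diffP.
  by have [] := dphi s.
have [s /[!in_itv]/= /andP[s1 s2] E] := MVT_segment (ltW tN) (fun s _ => dphi s) (cphi _).
move: E; rewrite scale0r; under [in intg _ - _ = _]eq_fun do rewrite addr0.
have st : 0 <= - s <= t by apply/andP; split; lra.
have /(pbound_partial mG pG Ji) H := CSin_along st r0 sp dp.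
move: H; rewrite opprK => H E.
have {}H : `|intg (fun z => \1_G z * partial i phi (z + s *: e_ i))| <= p.
  by move: H; rewrite (partial_sh (s *: e_ i) i sp); apply.
move: H; rewrite ler_norml => /andP[H1 H2].
rewrite -[leLHS]opprB E sub0r opprK -mulNr mulrC ler_pM2l//.
by rewrite lerNl.
Qed.

(** By duality: the test function is a mollification of [g], the sign of the difference of the two
    indicators on [L], for which the pairing becomes the volume of the symmetric difference. *)
Lemma translate_volume_le J O G p i (t r M : R) L : (0 < volume [set: rV])%E ->
  lebesgue_measurable G -> lebesgue_measurable L ->
  pbound J O G p -> J i -> 0 <= t -> 0 < r -> L `<=` deep (along i t O) r M ->
  (volume ((sh (t *: e_ i) G `+` G) `&` L) <= (t * p)%:E)%E.
Proof.
move=> nt mG mL pG Ji t0 r0 Ld.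
pose G' := sh (t *: e_ i) G.
have mG' : lebesgue_measurable G' by exact: measurable_sh.
have LM z : L z -> `|z| <= M by move=> /Ld[].
pose Q : set rV := [set z | `|z| <= M + r].
have mQ : lebesgue_measurable Q by exact: measurable_ball_norm.
have m1 : lebesgue_measurable (G' `&` L) by exact: (@measurableI _ (lebesgue_space R d)).
have m2 : lebesgue_measurable (G `&` L) by exact: (@measurableI _ (lebesgue_space R d)).
have t1 : tame (\1_(G' `&` L) : rV -> R) by apply: (tame_indic (M := M)) => // z [_ /LM].
have t2 : tame (\1_(G `&` L) : rV -> R) by apply: (tame_indic (M := M)) => // z [_ /LM].
pose g z : R := \1_(G' `&` L) z - \1_(G `&` L) z.
have tg : tame g by exact: tameB.
have tQ : tame (\1_Q : rV -> R) by exact: (tame_indic (M := M + r)).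
pose f z : R := (\1_G' z - \1_G z) * \1_Q z.
have tf : tame f.
  apply: (@tameM _ _ _ _ 2) => //.
    rewrite (_ : (fun z => _) = fun z => \1_G' z + (-1) * \1_G z).
      by apply: lmfunD; [exact: lmfun_indic|apply: lmfunM; [exact: lmfun_cst|exact: lmfun_indic]].
    by apply/funext => z; rewrite mulN1r.
  move=> z; apply: le_trans (ler_normB _ _) _.
  by have := normr_indic (R := R) G z; have := normr_indic (R := R) G' z; lra.
pose V := (G' `+` G) `&` L.
have mV : lebesgue_measurable V.
  apply: (@measurableI _ (lebesgue_space R d)) => //.
  by apply: (@measurableU _ (lebesgue_space R d)); exact: (@measurableD _ (lebesgue_space R d)).
have fV : (volume V < +oo)%E by apply: (@volume_bounded _ _ _ M) => z [_ /LM].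
have fg : intg (fun z => f z * g z) = fine (volume V).
  rewrite -intg_indic//; congr intg; apply/funext => z; rewrite /f /g /V /setY !indicE.
  have hLQ : L z -> Q z by move=> /LM; rewrite /Q/=; lra.
  rewrite !in_setI !in_setU !in_setD.
  have [l|l] := pselect (L z); last first.
    by rewrite (memNset l) !andbF subrr mulr0.
  rewrite (mem_set l) (mem_set (hLQ l)) !andbT.
  by case: (z \in G); case: (z \in G') => /=; ring.
rewrite -(@fineK _ (volume V)) ?ge0_fin_numE ?volume_ge0// lee_fin -fg.
apply/ler_addgt0Pr => e e0; have e20 : 0 < e / 2 by lra.
have [e1 e10 h1] := mollifier_approx tf m1 (fun z h => LM z h.2) e20.
have [e2' e20' h2] := mollifier_approx tf m2 (fun z h => LM z h.2) e20.
pose e' := Num.min (Num.min e1 e2') (r / 2).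
have e'0 : 0 < e' by rewrite !lt_min e10 e20'/=; lra.
have [k mk] := mollifier_exists nt e'0; have [[ck _ _ _ _] _] := mk.
have le1 : e' <= e1 by rewrite !ge_min lexx.
have le2 : e' <= e2' by rewrite !ge_min lexx orbT.
have le3 : e' <= r / 2 by rewrite !ge_min lexx !orbT.
have {}h1 := h1 _ _ e'0 le1 mk; have {}h2 := h2 _ _ e'0 le2 mk.
have gd w : g w != 0 -> deep (along i t O) r M w.
  move=> gw; apply: Ld; apply: contrapT => nL; move: gw; rewrite /g !indicE !in_setI.
  by rewrite (memNset nL) !andbF subrr eqxx.
have dphi z : convol k g z != 0 -> deep (along i t O) (r / 2) (M + e') z.
  exact: (convol_deep mk tg e'0 le3 gd).
have phi1 z : `|convol k g z| <= 1.
  apply: (conv_mollifier_norm _ mk tg) => w; rewrite /g !indicE !in_setI.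
  by case: (w \in G'); case: (w \in G); case: (w \in L); rewrite /= ?subrr ?subr0 ?sub0r ?normrN ?normr0 ?normr1.
have r20 : 0 < r / 2 by lra.
have := translate_smooth mG pG Ji t0 r20 (conv_smooth ck tg) phi1 dphi.
have cphi := conv_CS ck tg.
have tG1 : tame (fun z => \1_G z * convol k g (z + (- t) *: e_ i)).
  by apply: tame_indicM => //; apply/CS_tame; exact: CS_sh.
have -> : intg (fun z => \1_G z * convol k g (z + (- t) *: e_ i)) = intg (fun z => \1_G' z * convol k g z).
  rewrite -(intg_sh (t *: e_ i) tG1); congr intg; apply/funext => z; congr (_ * _).
  by rewrite scaleNr addrK.
have tp1 := tame_indicM mG (CS_tame cphi); have tp2 := tame_indicM mG' (CS_tame cphi).
rewrite -(intgB tp2 tp1).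
have -> : intg (fun z => \1_G' z * convol k g z - \1_G z * convol k g z) =
   intg (fun z => f z * convol k \1_(G' `&` L) z) - intg (fun z => f z * convol k \1_(G `&` L) z).
  have tc B : tame (\1_B : rV -> R) -> tame (fun z => f z * convol k \1_B z).
    move=> tB; have cB := conv_CS ck tB; have [D _ hD] := CS_bounded cB.
    by have := tameM (CS_tame cB).1 hD tf; under eq_fun do rewrite mulrC.
  rewrite -(intgB (tc _ t1) (tc _ t2)); congr intg; apply/funext => z.
  have -> : convol k g z = convol k \1_(G' `&` L) z - convol k \1_(G `&` L) z.
    rewrite /convol -(intgB (tame_conv z ck t1) (tame_conv z ck t2)).
    by congr intg; apply/funext => w; rewrite mulrBr.
  rewrite /f; have [zQ|zQ] := leP `|z| (M + r).
    by rewrite [\1_Q z]indicE mem_set//=; ring.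
  have c0 (B : set rV) : (forall w, B w -> `|w| <= M) -> tame (\1_B : rV -> R) -> convol k \1_B z = 0.
    move=> BM tB; apply: (conv_mollifier_cst mk tB) => w zw; rewrite indicE memNset// => /BM wM.
    by have := ler_normD (z - w) w; rewrite subrK; lra.
  rewrite !c0//; last 2 first.
  - by move=> w [_ /LM].
  - by move=> w [_ /LM].
  by ring.
have -> : intg (fun z => f z * g z) = intg (fun z => f z * \1_(G' `&` L) z) - intg (fun z => f z * \1_(G `&` L) z).
  have tc B : tame (\1_B : rV -> R) -> lebesgue_measurable B -> tame (fun z => f z * \1_B z).
    by move=> tB mB; have := tame_indicM mB tf; under eq_fun do rewrite mulrC.
  rewrite -(intgB (tc _ t1 m1) (tc _ t2 m2)).
  by congr intg; apply/funext => w; rewrite /g mulrBr.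
move: h1 h2; rewrite !ler_norml => /andP[a1 a2] /andP[b1 b2].
move: a1 a2 b1 b2; clear.
move: (intg _) (intg _) (intg _) (intg _) => x1 x2 x3 x4; lra.
Qed.

Lemma volume_bigcup_le (A : nat -> set rV) (c : \bar R) :
  (forall n, lebesgue_measurable (A n)) -> (forall n m, (n <= m)%N -> A n `<=` A m) ->
  (forall n, (volume (A n) <= c)%E) -> (volume (\bigcup_n A n) <= c)%E.
Proof.
move=> mA ndA h.
have cv : (@volume R d \o A) @ \oo --> volume (\bigcup_n A n).
  apply: (@nondecreasing_cvg_mu _ (lebesgue_space R d)) => //.
    exact: (@bigcupT_measurable _ (lebesgue_space R d)).
  by move=> n m nm; apply/subsetPset; exact: ndA.
rewrite -(cvg_lim (@ereal_hausdorff R) cv); apply: lime_le; first by apply/cvg_ex; exists (volume (\bigcup_n A n)).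
exact: nearW.
Qed.

Lemma volume_bigcap0 (A : nat -> set rV) (e : R) :
  (forall n, lebesgue_measurable (A n)) -> (forall n m, (n <= m)%N -> A m `<=` A n) ->
  (volume (A 0%N) < +oo)%E -> \bigcap_n A n = set0 -> 0 < e ->
  exists n, (volume (A n) <= e%:E)%E.
Proof.
move=> mA niA f0 A0 e0.
have cv : (@volume R d \o A) @ \oo --> volume (\bigcap_n A n).
  apply: (@nonincreasing_cvg_mu _ (lebesgue_space R d)) => //.
    exact: (@bigcapT_measurable _ (lebesgue_space R d)).
  by move=> n m nm; apply/subsetPset; exact: niA.
move: cv; rewrite A0 measure0 => /fine_cvgP[fin].
move=> /cvgrPdist_le/(_ _ e0) h.
have [n [fn hn]] : exists n, volume (A n) \is a fin_num /\ `|0 - fine (volume (A n))| <= e.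
  near \oo => n; exists n; split; near: n => //.
exists n; move: hn; rewrite sub0r normrN ger0_norm ?fine_ge0 ?volume_ge0//.
by rewrite -{2}(fineK fn) lee_fin.
Unshelve. all: by end_near. Qed.

Lemma open_bigcup_deep O : open O ->
  O = \bigcup_n deep O n.+1%:R^-1 n%:R.
Proof.
move=> oO; apply/seteqP; split => z; last by move=> [n _]; apply: deep_in; rewrite invr_gt0.
move=> Oz; have [r r0 hr] := (rv_openP O).1 oO z Oz.
have [n hn] := ltr_add_invr (y := 0) (x := r) r0.
exists (n + (Num.truncn `|z|).+1)%N => //; split.
  by rewrite natrD; apply: le_trans (ltW (truncnS_gt _)) _; rewrite lerDr.
move=> w zw; apply: hr; apply: lt_le_trans zw _; move: hn; rewrite add0r => /ltW; apply: le_trans.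
by rewrite lef_pV2 ?posrE// ler_nat ltnS leq_addr.
Qed.

Lemma measurable_deep O r M : lebesgue_measurable (deep O r M).
Proof. by apply: measurable_closed; exact: closed_deep. Qed.

Lemma le_deepn O n m : (n <= m)%N -> deep O n.+1%:R^-1 n%:R `<=` deep O m.+1%:R^-1 m%:R.
Proof.
by move=> nm z; apply: le_deep; [rewrite lef_pV2 ?posrE// ler_nat ltnS|rewrite ler_nat].
Qed.

Lemma measurableY A B : lebesgue_measurable A -> lebesgue_measurable B ->
  lebesgue_measurable (A `+` B).
Proof.
move=> mA mB; apply: (@measurableU _ (lebesgue_space R d));
exact: (@measurableD _ (lebesgue_space R d)).
Qed.

Lemma translate_volume J O G p i (t : R) : (0 < volume [set: rV])%E ->
  open O -> (forall z (s : R), O (z + s *: e_ i) <-> O z) ->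
  lebesgue_measurable G -> pbound J O G p -> J i ->
  (volume ((sh (t *: e_ i) G `+` G) `&` O) <= (`|t| * p)%:E)%E.
Proof.
move=> nt oO Oi mG pG Ji.
have H (s : R) : 0 <= s -> (volume ((sh (s *: e_ i) G `+` G) `&` O) <= (s * p)%:E)%E.
  move=> s0; rewrite (open_bigcup_deep oO) setI_bigcupr; apply: volume_bigcup_le => n.
  - apply: (@measurableI _ (lebesgue_space R d)); last exact: measurable_deep.
    by apply: measurableY => //; exact: measurable_sh.
  - by move=> m nm; apply: setIS; exact: le_deepn.
  - have n0 : 0 < n.+1%:R^-1 :> R by rewrite invr_gt0.
    apply: (translate_volume_le nt mG (@measurable_deep O _ _) pG Ji s0 n0).
    by move=> z [zM hz]; split; [exact: zM|move=> w /hz Ow a _; exact/Oi].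
have [t0|t0] := leP 0 t; first by rewrite ger0_norm//; exact: H.
rewrite ltr0_norm//.
(* The symmetric difference for [t] is a translate of the one for [- t]. *)
have := H (- t); rewrite oppr_ge0 => /(_ (ltW t0)).
rewrite -(volume_sh (t *: e_ i)) => h; apply: le_trans h.
apply: le_volume => z; rewrite /sh/= => -[hz /(Oi z t) Oz]; split => //.
move: hz; rewrite /setY /sh/= scaleNr addrK; tauto.
Qed.

Lemma volume_null_bigcup (A : nat -> set rV) :
  (forall n, volume (A n) = 0%E) -> volume (\bigcup_n A n) = 0%E.
Proof.
move=> h; apply/eqP; rewrite eq_le volume_ge0 andbT.
have := @volume_bigcup_countable R d nat setT A (countableP _).
by move=> /le_trans; apply; rewrite esum1.
Qed.

Lemma volumeY_eq A B : lebesgue_measurable A -> lebesgue_measurable B ->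
  volume (A `+` B) = 0%E -> volume A = volume B.
Proof.
have H A' B' : lebesgue_measurable A' -> volume (A' `+` B') = 0%E -> (volume A' <= volume B')%E.
  move=> mA AB; apply: (@le_trans _ _ (volume (B' `|` (A' `+` B')))).
    apply: le_volume => z Az; have [Bz|nB] := pselect (B' z); first by left.
    by right; left.
  by apply: le_trans (volumeU_le _ _) _; rewrite AB adde0.
move=> mA mB AB; apply/eqP; rewrite eq_le H// H//.
by rewrite setYC.
Qed.

Lemma pbound0_null J O G i : (0 < volume [set: rV])%E ->
  open O -> (forall z (s : R), O (z + s *: e_ i) <-> O z) ->
  lebesgue_measurable G -> pbound J O G 0 -> J i ->
  (volume (G `&` O) < +oo)%E -> volume (G `&` O) = 0%E.
Proof.
move=> nt oO Oi mG pG Ji fG.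
have mO := measurable_open oO.
have mGO : lebesgue_measurable (G `&` O) by exact: (@measurableI _ (lebesgue_space R d)).
pose H (a : R) := (G `&` O) `&` ~` [set z : rV | z 0 i <= a].
have mH a : lebesgue_measurable (H a).
  apply: (@measurableI _ (lebesgue_space R d)) => //.
  by apply: (@measurableC _ (lebesgue_space R d)); exact: measurable_halfspace.
have shift a s : volume (H (a - s)) = volume (H a).
  rewrite -(volume_sh (s *: e_ i) (H a)); apply: volumeY_eq => //; first exact: measurable_sh.
  apply/eqP; rewrite eq_le volume_ge0 andbT.
  have := translate_volume s nt oO Oi mG pG Ji; rewrite mulr0 => h; apply: le_trans h.
  apply: le_volume => z; rewrite /setY /H /sh/= !mxE !eqxx/= mulr1.
  have -> : (z 0 i <= a - s) = (z 0 i + s <= a) by rewrite lerBrDr.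
  have := Oi z s; tauto.
have c0 (e : R) : 0 < e -> (volume (H 0%R) <= e%:E)%E.
  move=> e0; have [||||n] := @volume_bigcap0 (fun n => H n%:R) e _ _ _ _ e0 => //.
  - move=> n m nm z [GOz /= hz]; split => //= zn; apply: hz; apply: le_trans zn _.
    by rewrite ler_nat.
  - by apply: le_lt_trans fG; apply: le_volume => z [].
  - rewrite -subset0 => z /(_ (Num.truncn (z 0 i)).+1 I)[_ /=]; apply.
    by rewrite ltW// truncnS_gt.
  by rewrite -(shift n%:R n%:R) subrr.
have H0 a : volume (H a) = 0%E.
  rewrite -[a]add0r -[a]opprK shift; apply/eqP; rewrite eq_le volume_ge0 andbT.
  by apply/lee_addgt0Pr => e e0; rewrite add0e c0.
apply/eqP; rewrite eq_le volume_ge0 andbT.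
rewrite -(volume_null_bigcup (fun n => H0 (- n%:R))); apply: le_volume => z GOz.
exists (Num.truncn (- z 0 i)).+1 => //; split => //=; apply/negP; rewrite -ltNge.
by rewrite ltrNl truncnS_gt.
Qed.

End translation.

(** * Sets of zero perimeter in convex open sets *)

Section zero_perimeter.
Context (R : realType) (d : nat).
Local Notation rV := 'rV[R]_d.
Implicit Types (A B C F G L W O : set rV) (f g phi : rV -> R) (z w u c t v : rV).
Implicit Types (X : 'I_d -> rV -> R) (J : pred 'I_d).

Definition nball z (r : R) : set rV := [set w | `|z - w| < r].

Lemma open_nball z r : open (nball z r).
Proof.
apply/rv_openP => w zw; exists (r - `|z - w|); first by rewrite subr_gt0.
by move=> u wu; have := ler_distD w z u; rewrite /nball/=; lra.
Qed.

Lemma measurable_nball z r : lebesgue_measurable (nball z r).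
Proof. by apply: measurable_open; exact: open_nball. Qed.

Lemma nballM z (r : R) w : nball z r w -> `|w| <= `|z| + r.
Proof. by rewrite /nball/= distrC => zw; have := ler_normD (w - z) z; rewrite subrK; lra. Qed.

Lemma sh_nball u z (r : R) : sh u (nball z r) = nball (z - u) r.
Proof. by apply/funext => w; rewrite /sh /nball/= opprD addrA addrAC. Qed.

Definition convx O := forall x y (s : R), O x -> O y -> 0 <= s <= 1 ->
  O ((1 - s) *: x + s *: y).

Definition inv_null W u L := volume ((sh u W `+` W) `&` L) = 0%E.

Lemma le_null A B : A `<=` B -> volume B = 0%E -> volume A = 0%E.
Proof. by move=> AB B0; apply/eqP; rewrite eq_le volume_ge0 andbT -B0 le_volume. Qed.

Lemma nullU A B : volume A = 0%E -> volume B = 0%E -> volume (A `|` B) = 0%E.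
Proof.
move=> A0 B0; apply/eqP; rewrite eq_le volume_ge0 andbT.
by apply: le_trans (volumeU_le _ _) _; rewrite A0 B0 adde0.
Qed.

Lemma inv_null0 W L : inv_null W 0 L.
Proof. by rewrite /inv_null sh0 setYK set0I measure0. Qed.

Lemma inv_nullN W u L : inv_null W u (sh u L) -> inv_null W (- u) L.
Proof.
rewrite /inv_null -(volume_sh (- u)); apply: le_null => z.
by rewrite /sh /setY/= addrNK; tauto.
Qed.

Lemma inv_nullD W u v L : inv_null W u L -> inv_null W v (sh (- u) L) ->
  inv_null W (u + v) L.
Proof.
move=> h1; rewrite /inv_null -(volume_sh u) => h2; apply: le_null (nullU h1 h2) => z.
rewrite /sh /setY/= addrK -!addrA; move=> [h Lz].
by have [?|?] := pselect (W (z + u)); tauto.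
Qed.

Lemma inv_null_coord J O W i (s : R) z (r : R) : (0 < volume [set: rV])%E ->
  lebesgue_measurable W -> pbound J O W 0 -> J i -> 0 < r ->
  (forall a, 0 <= a <= 1 -> forall w, `|z + (a * s) *: e_ i - w| < 2 * r -> O w) ->
  inv_null W (s *: e_ i) (nball z r).
Proof.
move=> nt mW pW Ji.
have H (s' : R) z' r' : 0 < r' -> 0 <= s' ->
    (forall a, 0 <= a <= 1 -> forall w, `|z' + (a * s') *: e_ i - w| < 2 * r' -> O w) ->
    inv_null W (s' *: e_ i) (nball z' r').
  move=> r0 s0 h; apply/eqP; rewrite eq_le volume_ge0 andbT (_ : 0%E = (s' * 0)%:E) ?mulr0//.
  rewrite -{1}(mulr0 s').
  apply: (translate_volume_le nt mW (@measurable_nball _ _) pW Ji s0 r0).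
  move=> w zw; split; first exact: nballM zw.
  move=> w' ww' a /andP[a0 as'].
  have [s00|s00] := eqVneq s' 0.
    have a00 : a = 0 by apply/eqP; rewrite eq_le a0 andbT -s00.
    apply: (h 0); rewrite ?lexx ?ler01// mul0r a00 scale0r !addr0.
    by have := ler_distD w z' w'; move: zw; rewrite /nball/=; lra.
  have sp : 0 < s' by rewrite lt_neqAle eq_sym s00.
  apply: (h (a / s')); first by rewrite divr_ge0//= ler_pdivrMr// mul1r.
  rewrite divfK// opprD addrACA subrr addr0.
  by have := ler_distD w z' w'; move: zw; rewrite /nball/=; lra.
move=> r0 h; have [s0|s0] := leP 0 s; first exact: H.
rewrite -[s *: _]opprK -scaleNr; apply: inv_nullN; rewrite sh_nball; apply: H => //; first lra.
move=> a a01 w hw; apply: (h (1 - a)); first by apply/andP; split; lra.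
move: hw; rewrite scaleNr opprK -[z + _ + _]addrA -scalerDl (_ : s + a * - s = (1 - a) * s)//; ring.
Qed.

(** [u] is applied one coordinate at a time. Its truncations have norm at most [r], so with the
    margin [2 * r] used by each single move everything stays within [3 * r] of [z]. *)
Lemma inv_null_small J O W z u (r : R) : (0 < volume [set: rV])%E ->
  lebesgue_measurable W -> pbound J O W 0 -> 0 < r -> `|u| <= r ->
  (forall i, ~~ J i -> u 0 i = 0) -> (forall w, `|z - w| < 3 * r -> O w) ->
  inv_null W u (nball z r).
Proof.
move=> nt mW pW r0 ur uJ Oz.
pose h k : rV := \row_i (if (i < k)%N then u 0 i else 0).
have hd : h d = u by apply/rowP => i; rewrite mxE ltn_ord.
rewrite -hd; have := leqnn d; elim: {-2}d => [_|k IH kd].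
  have -> : h 0%N = 0 by apply/rowP => i; rewrite !mxE.
  exact: inv_null0.
set i := Ordinal kd.
have ha (a : R) : 0 <= a <= 1 -> `|h k + (a * u 0 i) *: e_ i| <= r.
  move=> /andP[a0 a1]; apply/rv_normP => [|j]; first exact: ltW.
  rewrite !mxE eqxx/= eq_sym; have uj := le_trans (le_coord u j) ur.
  case: eqP => [ij|_]; rewrite ?mulr0 ?addr0; last by case: ifP => // _; rewrite normr0 ltW.
  rewrite -ij ltnn add0r mulr1 normrM; have ui := le_trans (le_coord u i) ur.
  by rewrite (ger0_norm a0); have := normr_ge0 (u 0 i); nra.
have -> : h k.+1 = h k + u 0 i *: e_ i.
  apply/rowP => j; rewrite !mxE eqxx/= ltnS leq_eqVlt -(inj_eq val_inj) /= eq_sym.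
  case: (eqVneq k (val j)) => [kj|] /=; last by rewrite mulr0 addr0.
  by rewrite kj ltnn add0r mulr1; congr (u 0 _); exact: val_inj.
apply: inv_nullD; first exact: IH (ltnW kd).
rewrite sh_nball opprK; have [Ji|/uJ ->] := boolP (J i); last by rewrite scale0r; exact: inv_null0.
apply: (inv_null_coord nt mW pW Ji r0) => a a01 w hw; apply: Oz.
have := ha a a01; have := ler_distD (z + h k + (a * u 0 i) *: e_ i) z w.
rewrite -{1}[z + _ + _]addrA opprD addrA subrr sub0r normrN.
by move: hw; lra.
Qed.

(** The displacement is cut into [n] steps of length at most [r]. Each intermediate point has room
    [3 * r], since convexity spreads the balls at the two ends over the whole segment. *)
Lemma inv_null_segment J O W z u : (0 < volume [set: rV])%E -> open O -> convx O ->
  lebesgue_measurable W -> pbound J O W 0 -> (forall i, ~~ J i -> u 0 i = 0) ->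
  O z -> O (z + u) -> exists2 r : R, 0 < r & inv_null W u (nball z r).
Proof.
move=> nt oO cO mW pW uJ Oz Ozu.
have [r1 r10 h1] := (rv_openP O).1 oO z Oz; have [r2 r20 h2] := (rv_openP O).1 oO _ Ozu.
pose r := Num.min r1 r2 / 3.
have r0 : 0 < r by rewrite divr_gt0// lt_min r10.
have le1 : 3 * r <= r1 by rewrite mulrC divfK// ge_min lexx.
have le2 : 3 * r <= r2 by rewrite mulrC divfK// ge_min lexx orbT.
exists r => //.
pose n := (Num.truncn (`|u| / r)).+1.
have n0 : 0 < n%:R :> R by rewrite ltr0n.
have un : `|u| <= n%:R * r.
  by rewrite -ler_pdivrMr// ltW// truncnS_gt.
have main k : (k <= n)%N -> inv_null W ((k%:R / n%:R) *: u) (nball z r).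
  elim: k => [_|k IH kn]; first by rewrite mul0r scale0r; exact: inv_null0.
  rewrite -[k.+1]addn1 natrD mulrDl scalerDl; apply: inv_nullD; first exact: IH (ltnW kn).
  rewrite sh_nball opprK; apply: (@inv_null_small J O) => //.
  - rewrite normrZ ger0_norm ?divr_ge0// mul1r mulrC ler_pdivrMr// mulrC//.
  - by move=> i /uJ; rewrite mxE => ->; rewrite mulr0.
  move=> w hw; pose v := w - (z + (k%:R / n%:R) *: u).
  have vn : `|v| < 3 * r by rewrite /v distrC.
  have -> : w = (1 - k%:R / n%:R) *: (z + v) + (k%:R / n%:R) *: (z + u + v).
    rewrite [z + u + v]addrAC [_ *: (z + v + u)]scalerDr addrA -scalerDl subrK scale1r.
    by rewrite addrAC /v addrC subrK.
  apply: cO.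
  - by apply: h1; rewrite opprD addrA subrr sub0r normrN; lra.
  - by apply: h2; rewrite opprD addrA subrr sub0r normrN; lra.
  - by rewrite divr_ge0//= ler_pdivrMr// mul1r ler_nat ltnW.
by have := main n (leqnn n); rewrite divff ?scale1r// gt_eqF.
Qed.

Lemma volume_local_null A : (forall z, A z -> exists2 r : R, 0 < r & volume (A `&` nball z r) = 0%E) ->
  volume A = 0%E.
Proof.
move=> h.
pose S : set (nat * {ffun 'I_d -> int}) := [set nk | volume (A `&` box (cell R nk.1 nk.2)) = 0%E].
have cS : countable S by exact: countableP.
apply/eqP; rewrite eq_le volume_ge0 andbT.
have := @volume_bigcup_countable R d _ S (fun nk => A `&` box (cell R nk.1 nk.2)) cS.
rewrite esum1 => [h'|nk //]; apply: le_trans h'; apply: le_volume => z Az.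
have [r r0 hr] := h z Az.
have [n hn] := ltr_add_invr (y := 0) (x := r) r0; rewrite add0r in hn.
have [k zk] := cell_cover n z; exists (n, k) => //=.
apply: le_null hr => w [Aw wk]; split => //; apply: le_lt_trans hn.
exact: cell_small zk wk.
Qed.

Definition near_null A z := exists2 r : R, 0 < r & volume (A `&` nball z r) = 0%E.

(** [convol k \1_B] is constant on [Q], because [W] is invariant up to null sets under small
    translations. If [W] and its complement both had mass in [Q], this constant would be close to 1
    and close to 0. *)
Lemma local_01 O W z (r : R) : (0 < volume [set: rV])%E ->
  lebesgue_measurable W -> pbound predT O W 0 -> 0 < r -> (forall w, `|z - w| < 3 * r -> O w) ->
  near_null W z \/ near_null (~` W) z.
Proof.
move=> nt mW pW r0 Oz.
have mC : lebesgue_measurable (~` W) by exact: (@measurableC _ (lebesgue_space R d)).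
pose Q := nball z (r / 2).
have mI A B : lebesgue_measurable A -> lebesgue_measurable B -> lebesgue_measurable (A `&` B).
  exact: (@measurableI _ (lebesgue_space R d)).
have mQ : lebesgue_measurable Q by exact: measurable_nball.
apply: contrapT => /not_orP[h1 h2].
have r20 : 0 < r / 2 by lra.
have fin A : (volume (A `&` Q) < +oo)%E by apply: (@volume_bounded _ _ _ (`|z| + r / 2)) => w [_ /nballM].
have pos A : ~ near_null A z -> 0 < fine (volume (A `&` Q)).
  move=> h; rewrite fine_gt0// fin lt_neqAle volume_ge0 !andbT eq_sym.
  by apply/eqP => h0; apply: h; exists (r / 2).
have V1 := pos _ h1; have V2 := pos _ h2.
set v1 := fine _ in V1; set v2 := fine _ in V2.
pose B := W `&` nball z (2 * r).
have mB : lebesgue_measurable B by apply: mI => //; exact: measurable_nball.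
have BM w : B w -> `|w| <= `|z| + 2 * r by move=> [_ /nballM].
have tI A : lebesgue_measurable A -> tame (\1_(A `&` Q) : rV -> R).
  by move=> mA; apply: (tame_indic (M := `|z| + r / 2)) => [|w [_ /nballM]//]; exact: mI.
(* With this [e] the constant [cc] would satisfy both cc >= 3/4 and cc <= 1/4. *)
pose e := Num.min v1 v2 / 4.
have e0 : 0 < e by rewrite divr_gt0// lt_min V1.
have ev1 : 4 * e <= v1 by rewrite mulrC divfK// ge_min lexx.
have ev2 : 4 * e <= v2 by rewrite mulrC divfK// ge_min lexx orbT.
have [e1 e10 a1] := mollifier_approx (tI W mW) mB BM e0.
have [e2 e20 a2] := mollifier_approx (tI _ mC) mB BM e0.
pose e' := Num.min (Num.min e1 e2) (r / 4).
have e'0 : 0 < e' by rewrite !lt_min e10 e20/=; lra.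
have le1 : e' <= e1 by rewrite !ge_min lexx.
have le2 : e' <= e2 by rewrite !ge_min lexx orbT.
have le3 : e' <= r / 4 by rewrite !ge_min lexx !orbT.
have [k mk] := mollifier_exists nt e'0; have [[ck _ _ kout _] _] := mk.
have {}a1 := a1 _ _ e'0 le1 mk; have {}a2 := a2 _ _ e'0 le2 mk.
have tB : tame (\1_B : rV -> R) by exact: tame_indic BM.
have bc w : Q w -> convol k \1_B w = convol k \1_B z.
  rewrite /Q /nball/= => Qw; pose u := w - z.
  have un : `|u| < r / 2 by rewrite /u distrC.
  have tsB : tame (fun v => \1_B (v + u) : R) by exact: tame_sh.
  have -> : convol k \1_B w = convol k (fun v => \1_B (v + u)) z.
    rewrite /convol -(intg_sh u (tame_conv w ck tB)); congr intg; apply/funext => v.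
    by congr (k _ * _); apply/rowP => j; rewrite !mxE; ring.
  apply/eqP; rewrite -subr_eq0; apply/eqP.
  rewrite /convol -(intgB (tame_conv z ck tsB) (tame_conv z ck tB)).
  pose N := (sh u W `+` W) `&` nball z r.
  have N0 : volume N = 0%E by apply: (inv_null_small nt mW pW) => //; lra.
  have [D D0 hD] := CS_bounded ck.
  have mN : lebesgue_measurable N.
    by apply: mI; [apply: measurableY => //; exact: measurable_sh|exact: measurable_nball].
  have := @intg_bound _ _ (fun v => k (z - v) * \1_B (v + u) - k (z - v) * \1_B v) N (2 * D) _ mN.
  rewrite N0 ltry/= mulr0 => H; apply/eqP; rewrite -normr_le0; apply: H => //.
  - by apply: tameB; exact: tame_conv.
  - move=> v; rewrite -mulrBr normrM mulrC ler_pM//.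
    by rewrite !indicE; case: (_ \in B); case: (_ \in B); rewrite /= ?subrr ?subr0 ?sub0r ?normrN ?normr0 ?normr1 ?ler0n ?ler1n.
  - move=> v nN; have [zv|zv] := ltP `|z - v| e'; last by rewrite kout// !mul0r subrr.
    rewrite -mulrBr; suff -> : \1_B (v + u) = \1_B v :> R by rewrite subrr mulr0.
    have b1 : nball z (2 * r) v by rewrite /nball/=; lra.
    have b2 : nball z (2 * r) (v + u).
      by rewrite /nball/= opprD addrA; have := ler_normB (z - v) u; lra.
    have b3 : nball z r v by rewrite /nball/=; lra.
    have : W v <-> W (v + u).
      by move: nN; rewrite /N /setY /sh/=; have [?|?] := pselect (W v); have [?|?] := pselect (W (v + u)); tauto.
    move=> E; rewrite !indicE; congr (nat_of_bool _)%:R.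
    by apply/idP/idP; rewrite !inE => -[/E]; split.
set cc := convol k \1_B z in bc.
have f1 A : lebesgue_measurable A -> intg (fun w => \1_(A `&` Q) w * convol k \1_B w) = cc * fine (volume (A `&` Q)).
  move=> mA; rewrite -intg_indic; last exact: mI.
  rewrite -intgZ; last exact: tI.
  congr intg; apply/funext => w; have [Qw|nQ] := pselect (Q w).
    by rewrite bc// mulrC.
  by rewrite indicE memNset ?mul0r ?mulr0// => -[].
have f2 : intg (fun w => \1_(W `&` Q) w * \1_B w) = v1.
  rewrite /v1 -intg_indic; last exact: mI.
  congr intg; apply/funext => w; rewrite !indicE !in_setI.
  have [Qw|nQ] := pselect (Q w); last by rewrite (memNset nQ) !andbF mul0r.
  have b1 : nball z (2 * r) w by move: Qw; rewrite /Q /nball/=; lra.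
  by rewrite (mem_set Qw) (mem_set b1) !andbT; case: (_ \in _) => /=; ring.
have f3 : intg (fun w => \1_(~` W `&` Q) w * \1_B w) = 0.
  rewrite -(intg0 R d); congr intg; apply/funext => w; rewrite !indicE !in_setI in_setC.
  by case: (w \in W); rewrite /= ?mul0r ?mulr0.
move: a1 a2; rewrite (f1 _ mW) (f1 _ mC) f2 f3 -/v1 -/v2 subr0 !ler_norml => /andP[x1 x2] /andP[x3 x4].
move: x1 x4 ev1 ev2 e0 V1 V2; clearbody cc v1 v2 e; clear => x1 x4 ev1 ev2 e0 V1 V2.
by have [c2|c2] := leP cc (1 / 2); nra.
Qed.

Lemma near_null_sh W z u : near_null W z ->
  (exists2 r : R, 0 < r & inv_null W u (nball (z - u) r)) -> near_null W (z - u).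
Proof.
move=> [r1 r10 h1] [r2 r20 h2].
exists (Num.min r1 r2); first by rewrite lt_min r10.
have h1' : volume (sh u (W `&` nball z r1)) = 0%E by rewrite volume_sh.
apply: le_null (nullU h1' h2) => w [Ww]; rewrite /nball/= lt_min => /andP[w1 w2].
have [Wu|nW] := pselect (W (w + u)).
  by left; split => //=; move: w1; rewrite /nball/= opprD addrA addrAC.
by right; split => //; rewrite /setY /sh/=; tauto.
Qed.

(** If [W] is null near one point of [O], invariance along segments spreads this to all points;
    otherwise the local alternative makes the complement null near every point. *)
Lemma pbound0_trivial O W : (0 < volume [set: rV])%E -> open O -> convx O ->
  lebesgue_measurable W -> pbound predT O W 0 ->
  volume (O `&` W) = 0%E \/ volume (O `\` W) = 0%E.
Proof.
move=> nt oO cO mW pW.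
have [|h0] := pselect (exists2 z, O z & near_null W z).
  move=> [z0 Oz0 n0]; left; apply: volume_local_null => z [Oz Wz].
  have Oz0' : O (z + (z0 - z)) by rewrite addrC subrK.
  have H := inv_null_segment nt oO cO mW pW (u := z0 - z) (fun i (h : ~~ predT i) => False_ind _ (elimN idP h isT)) Oz Oz0'.
  have := near_null_sh n0 (u := z0 - z); rewrite subKr => /(_ H)[r r0 hr].
  by exists r => //; apply: le_null hr => w [[_]].
right; apply: volume_local_null => z [Oz Wz].
have [r r0 hr] := (rv_openP O).1 oO z Oz.
have r30 : 0 < r / 3 by lra.
have h w : `|z - w| < 3 * (r / 3) -> O w by move=> zw; apply: hr; lra.
case: (local_01 nt mW pW r30 h) => [n0|[r' r'0 hr']]; first by exfalso; apply: h0; exists z.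
by exists r' => //; apply: le_null hr' => w [[_]].
Qed.

End zero_perimeter.

(** * Cylinders *)

Section cylinders.
Context (R : realType) (d : nat).
Local Notation rV := 'rV[R]_d.
Implicit Types (A B C F G L W O : set rV) (f g phi : rV -> R) (z w u c t v : rV).
Implicit Types (X : 'I_d -> rV -> R) (J Y : pred 'I_d).

(** The difference quotient is moved onto the box, and a shift by [h] alters a box only in its
    fringe. The fringe has width [2 * h], its defining inequality being strict, whence [2 * M]. *)
Lemma intg_partial_box p : exists P : R, forall i phi, CS phi -> (forall z, `|phi z| <= 1) ->
  intg (fun z => \1_(box p) z * partial i phi z) <= P.
Proof.
have [M M0 hM] := volume_fringe_box p; exists (2 * M) => i phi cp p1.
set B := box p.
have mB : lebesgue_measurable B by exact: measurable_box.
have fB : (volume B < +oo)%E by apply: le_lt_trans (volume_box p) _; rewrite ltry.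
have [C C0 hC] := CS_taylor i cp.
apply: (@le_of_quad _ _ _ (C * fine (volume B))) => h h0 h1.
have tB f : tame f -> tame (fun z => \1_B z * f z) by exact: tame_indicM.
have t1 := tB _ (CS_tame cp); have t2 := tB _ (CS_tame (CS_sh (h *: e_ i) cp)).
have t3 := tB _ (CS_tame (CS_partial i cp)).
have E : h * intg (fun z => \1_B z * partial i phi z) =
    (intg (fun z => \1_B z * phi (z + h *: e_ i)) - intg (fun z => \1_B z * phi z)) -
    (intg (fun z => \1_B z * phi (z + h *: e_ i)) - intg (fun z => \1_B z * phi z)
     - h * intg (fun z => \1_B z * partial i phi z)) by ring.
rewrite E; apply: lerD.
  pose B' := sh ((- h) *: e_ i) B.
  have mB' : lebesgue_measurable B' by exact: measurable_sh.
  have -> : intg (fun z => \1_B z * phi (z + h *: e_ i)) = intg (fun z => \1_B' z * phi z).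
    rewrite -(intg_sh ((- h) *: e_ i) t2); congr intg; apply/funext => z.
    by rewrite -addrA -scalerDl addNr scale0r addr0.
  have t4 := tame_indicM mB' (CS_tame cp).
  rewrite -(intgB t4 t1).
  have h2 : 0 < 2 * h <= 2 by apply/andP; split; lra.
  have D : (volume (B' `+` B) <= (M * (2 * h))%:E)%E.
    apply: le_trans (hM _ h2); apply: le_volume => z zB; exists (z + (- h) *: e_ i).
    rewrite opprD addrA subrr sub0r normrN; split; last by move: zB; rewrite /setY /B' /sh/= -/B; tauto.
    by apply: le_lt_trans (norm_e _ _) _; rewrite normrN gtr0_norm//; lra.
  have fD : (volume (B' `+` B) < +oo)%E by apply: le_lt_trans D _; rewrite ltry.
  have H : `|intg (fun z => \1_B' z * phi z - \1_B z * phi z)| <= `|1 : R| * fine (volume (B' `+` B)).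
    apply: intg_bound => //.
    - exact: tameB.
    - exact: measurableY.
    - move=> z; rewrite -mulrBl normrM norm_indicB.
      by have /andP[i0 i1] := indic_01 (R := R) (B' `+` B) z; rewrite -[leRHS]mulr1 ler_pM.
    - move=> z nD; apply/eqP; rewrite -mulrBl -normr_eq0 normrM norm_indicB indicE memNset//.
      by rewrite mul0r.
  apply: le_trans (ler_norm _) _; apply: le_trans H _; rewrite normr1 mul1r.
  rewrite -lee_fin fineK ?ge0_fin_numE ?volume_ge0//; apply: le_trans D _.
  by rewrite lee_fin; lra.
have tZ := tameZ h t3.
rewrite -(intgB t2 t1) -(intgZ h t3) -(intgB (tameB t2 t1) tZ).
have hC2 : 0 <= C * h ^+ 2 by rewrite mulr_ge0 ?sqr_ge0.
have -> : C * fine (volume B) * h ^+ 2 = `|C * h ^+ 2| * fine (volume B).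
  by rewrite (ger0_norm hC2); ring.
apply: le_trans (ler_norm _) _; rewrite normrN; apply: intg_bound => //.
- exact: tameB (tameB t2 t1) tZ.
- move=> z; rewrite mulrCA -mulrBr -mulrBr normrM; apply: le_trans (hC z h).
  by rewrite ler_piMl// normr_indic.
- by move=> z nB; rewrite indicE memNset// !mul0r mulr0 !subrr.
Qed.

Lemma box_pbound p : exists P : R, forall O, pbound predT O (box p) P.
Proof.
have [P hP] := intg_partial_box p; exists (\sum_(i < d) P) => O X vX.
have cX := vfield_CS vX; have [_ _ nX] := vX.
have mB := measurable_box p.
rewrite /flux (_ : (fun z => _) = fun z => \sum_i \1_(box p) z * partial i (X i) z); last first.
  by apply/funext => z; rewrite mulr_sumr.
rewrite intg_sum => [|i]; last by apply: tame_indicM => //; exact/CS_tame/CS_partial.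
apply: ler_sum => i _; apply: hP => // z.
rewrite -(@expr_le1 _ 2)// real_normK ?num_real//.
have := nX z; rewrite expr1n; apply: le_trans.
by rewrite (bigD1 i)//= lerDl sumr_ge0// => j _; exact: sqr_ge0.
Qed.

Lemma convx_dilate C z p (r s : R) w : convx C -> C z -> 0 < s <= 1 ->
  (forall v, `|p - v| < r -> C v) -> `|(1 - s) *: z + s *: p - w| < s * r -> C w.
Proof.
move=> cC Cz /andP[s0 s1] hp hw.
pose v := p + s^-1 *: (w - ((1 - s) *: z + s *: p)).
have -> : w = (1 - s) *: z + s *: v.
  by rewrite /v scalerDr scalerA divff ?gt_eqF// scale1r addrA addrC subrK.
apply: cC => //; last by rewrite ltW.
apply: hp; rewrite /v opprD addrA subrr sub0r normrN normrZ gtr0_norm ?invr_gt0// distrC.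
by rewrite ltr_pdivrMl.
Qed.

Lemma interiorP C z : interior C z <-> exists2 r : R, 0 < r & forall w, `|z - w| < r -> C w.
Proof. by split=> [/near_dist|[r r0 h]] //; exact: near_norm r0 h. Qed.

Lemma convx_interior_dilate C z p (s : R) : convx C -> C z -> interior C p -> 0 < s <= 1 ->
  interior C ((1 - s) *: z + s *: p).
Proof.
move=> cC Cz /interiorP[r r0 hr] s01; have [s0 s1] := andP s01.
apply/interiorP; exists (s * r); first exact: mulr_gt0.
by move=> w; exact: convx_dilate cC Cz s01 hr.
Qed.

Lemma convx_interior C : convx C -> convx (interior C).
Proof.
move=> cC x y s ix iy /andP[s0 s1]; have [->|sn0] := eqVneq s 0.
  by rewrite subr0 scale1r scale0r addr0.
apply: convx_interior_dilate => //; first exact: interior_subset.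
by rewrite s1 lt_neqAle eq_sym sn0 s0.
Qed.

Lemma bernoulli_le (s : R) n : 0 <= s <= 1 -> 1 - n%:R * s <= (1 - s) ^+ n.
Proof.
move=> /andP[s0 s1]; elim: n => [|n IH]; first by rewrite mul0r subr0 expr0.
rewrite exprS; have h : (1 - s) * (1 - n%:R * s) <= (1 - s) * (1 - s) ^+ n.
  by rewrite ler_wpM2l// subr_ge0.
apply: le_trans h; rewrite -natr1; have : 0 <= n%:R * s ^+ 2 by rewrite mulr_ge0 ?sqr_ge0.
by lra.
Qed.

(** Contracting by 1 - s towards an interior point [p] sends [C] into its interior, so (1 - s)^d
    times the volume of [C] in [Q] is at most that of the interior in [Q]; let s tend to 0. As [Q]
    is centred at [p], it is mapped into itself. *)
Lemma convex_boundary_null C : convx C -> closed C -> interior C !=set0 ->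
  volume (C `\` interior C) = 0%E.
Proof.
move=> cC clC [p ip].
have mC := measurable_closed clC.
have mO : lebesgue_measurable (interior C) by apply: measurable_open; exact: open_interior.
have mI A B : lebesgue_measurable A -> lebesgue_measurable B -> lebesgue_measurable (A `&` B).
  exact: (@measurableI _ (lebesgue_space R d)).
apply: volume_local_null => z [Cz nz]; exists 1 => //.
pose Q := nball p (`|p - z| + 1); have mQ : lebesgue_measurable Q by exact: measurable_nball.
have fQ A : (volume (A `&` Q) < +oo)%E by apply: (@volume_bounded _ _ _ (`|p| + (`|p - z| + 1))) => w [_ /nballM].
have finQ A : volume (A `&` Q) \is a fin_num by rewrite ge0_fin_numE ?volume_ge0.
suff H : volume ((C `\` interior C) `&` Q) = 0%E.
  apply: le_null H => w [Cw zw]; split => //; rewrite /Q /nball/=.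
  by have := ler_distD z p w; move: zw; rewrite /nball/=; lra.
have le : fine (volume (C `&` Q)) <= fine (volume (interior C `&` Q)).
  set VC := fine _; set VO := fine _.
  have VC0 : 0 <= VC by rewrite fine_ge0 ?volume_ge0.
  have key (s : R) : 0 < s < 1 -> (1 - s) ^+ d * VC <= VO.
    move=> /andP[s0 s1]; pose c : rV := const_mx (1 - s); pose t := s *: p.
    have cE w : dmap c t w = (1 - s) *: w + s *: p by apply/rowP => i; rewrite !mxE.
    have c0 : dpos c by move=> i; rewrite mxE subr_gt0.
    have detc : ddet c = (1 - s) ^+ d.
      by rewrite /ddet (eq_bigr (fun=> 1 - s)) ?prodr_const ?card_ord// => i _; rewrite mxE.
    have : (volume (C `&` Q) <= volume (dmap c t @^-1` (interior C `&` Q)))%E.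
      apply: le_volume => w [Cw Qw]; rewrite /preimage/= cE; split.
        by apply: convx_interior_dilate => //; rewrite s0 ltW.
      move: Qw; rewrite /Q /nball/= => Qw.
      have -> : p - ((1 - s) *: w + s *: p) = (1 - s) *: (p - w).
        by apply/rowP => i; rewrite !mxE; ring.
      rewrite normrZ gtr0_norm ?subr_gt0//; have := normr_ge0 (p - w); nra.
    rewrite volume_dmap// -(fineK (finQ C)) -(fineK (finQ (interior C))) -EFinM lee_fin.
    by rewrite detc -/VC -/VO ler_pdivlMl// exprn_gt0// subr_gt0.
  apply/ler_addgt0Pr => e e0.
  pose D := d%:R * VC + 1; have D0 : 0 < D by rewrite ltr_wpDl// mulr_ge0.
  pose s := Num.min (1 / 2) (e / D).
  have s0 : 0 < s by rewrite lt_min divr_gt0//= divr_gt0.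
  have s1 : s <= 1 / 2 by rewrite ge_min lexx.
  have sD : s * D <= e by rewrite -ler_pdivlMr// ge_min lexx orbT.
  have s01 : 0 < s < 1 by apply/andP; split => //; lra.
  have s01' : 0 <= s <= 1 by apply/andP; split; lra.
  have := key s s01; have b := bernoulli_le d s01'.
  have : (1 - d%:R * s) * VC <= (1 - s) ^+ d * VC by rewrite ler_wpM2r.
  by move: sD; rewrite /D; lra.
have E : volume (C `&` Q) = (volume ((C `\` interior C) `&` Q) + volume (interior C `&` Q))%E.
  rewrite -measureU; first congr volume.
  - apply/seteqP; split => w.
      by move=> [Cw Qw]; have [?|?] := pselect (interior C w); [right|left].
    by move=> [[[Cw _] Qw]|[/interior_subset Cw Qw]].
  - by apply: mI => //; exact: (@measurableD _ (lebesgue_space R d)).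
  - exact: mI.
  - by rewrite -subset0 => w [[[_ nw] _] [iw _]].
move: E le; rewrite -(fineK (finQ C)) -(fineK (finQ (interior C))) -(fineK (finQ (C `\` interior C))).
rewrite -EFinD => -[->] h.
congr (_%:E); apply/eqP; rewrite eq_le fine_ge0 ?volume_ge0// andbT.
by move: h => /=; rewrite gerDr.
Qed.

(** A cylinder is described by the set [Y] of its axis coordinates; in this form invariance under
    translations and stretchings along [Y] is immediate. *)
Definition cyl Y O := forall z w, (forall i, ~~ Y i -> z 0 i = w 0 i) -> O z -> O w.

Lemma cyl_interior Y C : cyl Y C -> cyl Y (interior C).
Proof.
move=> cC z w zw /interiorP[r r0 h]; apply/interiorP; exists r => // u wu.
apply: (cC (u - w + z)) => [i /zw|]; first by rewrite !mxE => ->; rewrite subrK.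
by apply: h; rewrite opprD addrCA subrr addr0 opprB.
Qed.

Lemma cylP Y O z w : cyl Y O -> (forall i, ~~ Y i -> z 0 i = w 0 i) -> O z <-> O w.
Proof. by move=> cO zw; split; apply: cO => // i /zw. Qed.

Lemma cyl_translate Y O i z (s : R) : cyl Y O -> Y i -> O (z + s *: e_ i) <-> O z.
Proof.
move=> cO Yi; apply: cylP cO _ => j; rewrite !mxE eqxx/=.
by case: (eqVneq j i) => [->|_ _]; rewrite ?Yi// mulr0 addr0.
Qed.

(** It acts through preimages: [lam > 1] shrinks sets along [Y], and [lam < 1] expands them. *)
Definition stretch Y (lam : R) : rV := \row_i if Y i then lam else 1.

Lemma stretch_pos Y (lam : R) : 0 < lam -> dpos (stretch Y lam).
Proof. by move=> l0 i; rewrite mxE; case: ifP. Qed.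

Lemma ddet_stretch Y (lam : R) : ddet (stretch Y lam) = lam ^+ #|Y|.
Proof.
rewrite /ddet (eq_bigr (fun i => if Y i then lam else 1)) => [|i _]; last by rewrite mxE.
by rewrite -big_mkcond prodr_const.
Qed.

Lemma cyl_stretch Y O (lam : R) z : cyl Y O -> O (dmap (stretch Y lam) 0 z) <-> O z.
Proof. by move=> cO; apply: cylP cO _ => i /negPf Yi; rewrite !mxE Yi mul1r addr0. Qed.

Lemma pos_root (a : R) n : 0 < a -> (0 < n)%N -> exists2 lam, 0 < lam & lam ^+ n = a.
Proof.
move=> a0 n0; exists (a `^ n%:R^-1); first exact: powR_gt0.
by rewrite -powR_mulrn ?powR_ge0// -powRrM mulVf ?powRr1 ?ltW// pnatr_eq0 -lt0n.
Qed.

(** Minimality in working form: the perimeter is a real number, and competitors are arbitrary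
    measurable sets of which only the part in [O] counts. *)
Definition isop O E (p : R) :=
  [/\ lebesgue_measurable E, (0 < volume (E `&` O) < +oo)%E, pbound predT O E p &
    forall G q, lebesgue_measurable G -> volume (G `&` O) = volume (E `&` O) ->
      pbound predT O G q -> p <= q].

Lemma sub_volume_gt0 A B : A `<=` B -> (0 < volume A)%E -> (0 < volume B)%E.
Proof. by move=> AB /lt_le_trans; apply; exact: le_volume. Qed.

Lemma flux_setI O G X : lebesgue_measurable G -> (forall i, CSin O (X i)) ->
  flux (G `&` O) X = flux G X.
Proof.
move=> mG cX; congr intg; apply/funext => z; rewrite !indicE in_setI.
have [Oz|nO] := pselect (O z); first by rewrite (mem_set Oz) andbT.
suff -> : divg X z = 0 by rewrite !mulr0.
rewrite /divg big1// => i _; have [r r0 h] := vanishes_out (cX i).2 nO.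
by rewrite (@partial_local _ _ (X i) (fun=> 0)) ?partial_cst//; exact: near_norm r0 h.
Qed.

Lemma stretched_perimeter Y O G p (lam : R) : cyl Y O -> 0 < lam -> lebesgue_measurable G ->
  pbound predT O G p ->
  pbound predT O (dmap (stretch Y lam) 0 @^-1` G) ((lam ^+ #|Y|)^-1 * (Num.max 1 lam * p)).
Proof.
move=> cO l0 mG pG; rewrite -ddet_stretch; apply: pbound_dmap => //.
- exact: stretch_pos.
- by rewrite lt_max ltr01.
- by move=> z; exact: cyl_stretch.
- by move=> i _; rewrite mxE; case: ifP; rewrite le_max lexx ?orbT.
Qed.

Lemma stretched_volume Y O G (lam : R) : cyl Y O -> 0 < lam ->
  volume ((dmap (stretch Y lam) 0 @^-1` G) `&` O) = ((lam ^+ #|Y|)^-1%:E * volume (G `&` O))%E.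
Proof.
move=> cO l0; rewrite -ddet_stretch -(@volume_dmap _ _ _ 0); last exact: stretch_pos.
by congr volume; apply/funext => z /=; apply/propext; split => -[? /(cyl_stretch lam z cO) ?].
Qed.

(* A box in the cylinder, stretched to the right volume, is a competitor. *)
Lemma isoperimetric_isop Y C E : isoperimetric_region C E -> convx C -> closed C ->
  interior C !=set0 -> cyl Y C -> (0 < #|Y|)%N ->
  exists p, isop (interior C) E p.
Proof.
move=> [mE EC E0 PE] cC clC iC0 cY Y0.
set O := interior C in iC0 *.
have oO : open O by exact: open_interior.
have cO : cyl Y O by exact: cyl_interior.
have mO : lebesgue_measurable O by exact: measurable_open.
(* The part of [E] outside [O] lies in the boundary of a convex set and is null. *)
have vE : volume (E `&` O) = volume E.
  have mEO : lebesgue_measurable (E `&` O) by exact: (@measurableI _ (lebesgue_space R d)).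
  apply: volumeY_eq => //; apply: le_null (convex_boundary_null cC clC iC0) => z.
  by rewrite /setY/= => -[[[? ?] nE]|[Ez h]]; [|split; [exact: EC|move=> Oz; apply: h]].
have compet G q : lebesgue_measurable G -> volume (G `&` O) = volume E -> pbound predT O G q ->
    (rel_perimeter C E <= q%:E)%E.
  move=> mG vG pG; rewrite PE.
  have mGO : lebesgue_measurable (G `&` O) by exact: (@measurableI _ (lebesgue_space R d)).
  apply: (@le_trans _ _ (rel_perimeter C (G `&` O))).
    apply: ereal_inf_lbound; exists (G `&` O) => //; split => //.
    by move=> z [_ /interior_subset].
  apply/(rel_perimeterP _ _ mGO) => X vX; have [cX _ _] := vX.
  by rewrite flux_setI//; exact: pG.
have [p fp] : exists p : R, rel_perimeter C E = p%:E.
  have [z0 Oz0] := iC0; have [r r0 hr] := (rv_openP O).1 oO z0 Oz0.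
  pose b : rV * rV := (z0 - const_mx (r / 2), z0 + const_mx (r / 2)).
  have bO : box b `<=` O.
    move=> w hw; apply: hr; apply: norm_lt => // i; have := hw i; rewrite !mxE => /andP[h1 h2].
    by rewrite ltr_norml; apply/andP; split; lra.
  have vb0 : (0 < volume (box b))%E.
    have [E0' _] := andP E0; apply: (sub_volume_gt0 (A := nball z0 (r / 2))).
      move=> w; rewrite /nball/= => zw i; have := le_lt_trans (le_coord (z0 - w) i) zw.
      by rewrite !mxE ltr_norml => /andP[h1 h2]; apply/andP; split; lra.
    apply: volume_open_gt0 E0' (@open_nball _ _ _ _) _; exists z0; rewrite /nball/= subrr normr0; lra.
  have vbf : (volume (box b) < +oo)%E by apply: le_lt_trans (volume_box b) _; rewrite ltry.
  have [E01 E02] := andP E0.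
  have finE : volume E \is a fin_num by rewrite ge0_fin_numE// ltW.
  have finb : volume (box b) \is a fin_num by rewrite ge0_fin_numE// ltW.
  have vE0 : 0 < fine (volume E) by rewrite fine_gt0// E01.
  have vb0' : 0 < fine (volume (box b)) by rewrite fine_gt0// vb0.
  have [lam l0 lamE] := pos_root (divr_gt0 vb0' vE0) Y0.
  have [P hP] := box_pbound b.
  have : (rel_perimeter C E <= ((lam ^+ #|Y|)^-1 * (Num.max 1 lam * P))%:E)%E.
    apply: compet (stretched_perimeter cO l0 (measurable_box b) (hP O)).
      apply: measurable_dmap (measurable_box b); exact: stretch_pos.
    rewrite (stretched_volume _ cO l0) (setIidl bO) lamE.
    transitivity (((fine (volume (box b)) / fine (volume E))^-1)%:E * (fine (volume (box b)))%:E)%E.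
      by rewrite (fineK finb).
    by rewrite -EFinM invf_div divfK ?gt_eqF// fineK.
  have : (0 <= rel_perimeter C E)%E.
    apply: ereal_sup_ubound; exists (fun z => \row_i (0 : R)).
      apply: (@vfield_test_field _ _ C (fun i => fun=> 0)); exact: vfield_zero.
    rewrite (integral_intg mE); last first.
      by apply: (@tame_divg _ _ (fun i z => (\row_j (0 : R)) 0 i)) => i; under eq_fun do rewrite mxE; exact: CSin_CS (@CSin0 _ _ O).
    rewrite (_ : (fun z => _) = fun=> 0) ?intg0//; apply/funext => z; rewrite /divergence big1 ?mulr0// => i _.
    by under eq_fun do rewrite mxE; rewrite partial_cst.
  by case: (rel_perimeter C E) => [p|//|//] _ _; exists p.
exists p; split => //; first by rewrite vE.
  by apply/(rel_perimeterP _ _ mE); rewrite fp.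
by move=> G q mG vG pG; rewrite -lee_fin -fp; apply: (compet _ _ mG _ pG); exact: etrans vG vE.
Qed.

End cylinders.

(** * No splitting into two sets of finite volume *)

Section no_split.
Context (R : realType) (d : nat).
Local Notation rV := 'rV[R]_d.
Implicit Types (A B C F G L W O : set rV) (f g phi : rV -> R) (z w u c t v : rV).
Implicit Types (X : 'I_d -> rV -> R) (J Y : pred 'I_d).

Lemma le_pbound J O G (p q : R) : p <= q -> pbound J O G p -> pbound J O G q.
Proof. by move=> pq pG X /pG h; exact: le_trans h pq. Qed.

Lemma pbound0_absurd Y J O G i : (0 < volume [set: rV])%E -> open O -> cyl Y O -> Y i -> J i ->
  lebesgue_measurable G -> (0 < volume (G `&` O) < +oo)%E -> ~ pbound J O G 0.
Proof.
move=> nt oO cO Yi Ji mG /andP[v0 vf] pG.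
have := pbound0_null nt oO (fun z s => cyl_translate z s cO Yi) mG pG Ji vf.
by move=> h; move: v0; rewrite h ltxx.
Qed.

Lemma volume_fine A : (0 < volume A < +oo)%E ->
  volume A = (fine (volume A))%:E /\ 0 < fine (volume A).
Proof.
move=> /[dup] h /andP[h1 h2]; rewrite fineK ?ge0_fin_numE ?volume_ge0//.
by rewrite fine_gt0.
Qed.

(* The component with the smaller perimeter to volume ratio, stretched along the
   cylinder to the volume of E, has no larger perimeter than E; rigidity of the
   stretching bounds rules out equality. *)
Lemma no_split_le Y O E G1 G2 (p p1 p2 : R) : (0 < volume [set: rV])%E -> open O ->
  cyl Y O -> (0 < #|Y|)%N -> isop O E p ->
  lebesgue_measurable G1 -> lebesgue_measurable G2 ->
  pbound predT O G1 p1 -> pbound predT O G2 p2 -> p1 + p2 <= p ->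
  (volume (E `&` O) <= volume (G1 `&` O) + volume (G2 `&` O))%E ->
  (0 < volume (G1 `&` O) < +oo)%E -> (0 < volume (G2 `&` O) < +oo)%E ->
  p1 * fine (volume (G2 `&` O)) <= p2 * fine (volume (G1 `&` O)) -> False.
Proof.
move=> nt oO cO Y0 [mE vE pE minE] mG1 mG2 pG1 pG2 p12 vle v1 v2.
have [i0 Yi0] : exists i, Y i by move: Y0 => /card_gt0P[i Yi]; exists i.
have [e1 V10] := volume_fine v1; have [e2 V20] := volume_fine v2; have [e0 V0] := volume_fine vE.
move: vle e1 e2 e0 V10 V20 V0.
set V1 := fine (volume (G1 `&` O)); set V2 := fine (volume (G2 `&` O)); set V := fine (volume (E `&` O)).
move=> vle e1 e2 e0 V10 V20 V0 ratio.
have p10 := pbound_ge0 pG1; have p20 := pbound_ge0 pG2.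
move: vle; rewrite e0 e1 e2 -EFinD lee_fin => vle.
have [lam l0 lamE] := pos_root (divr_gt0 V10 V0) Y0.
have lamV : (lam ^+ #|Y|)^-1 * V1 = V by rewrite lamE invf_div divfK ?gt_eqF.
(* [ratio] and V <= V1 + V2 give p1 V <= p1 (V1 + V2) <= (p1 + p2) V1 <= p V1. *)
have key : (lam ^+ #|Y|)^-1 * p1 <= p.
  have : p1 * V <= p * V1.
    apply: (@le_trans _ _ (p1 * (V1 + V2))); first by rewrite ler_wpM2l.
    apply: (@le_trans _ _ ((p1 + p2) * V1)); last by rewrite ler_wpM2r// ltW.
    by rewrite mulrDr mulrDl lerD2l.
  by rewrite lamE invf_div mulrAC ler_pdivrMr// mulrC.
have low q : pbound predT O (dmap (stretch Y lam) 0 @^-1` G1) q -> p <= q.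
  apply: minE; first by apply: measurable_dmap => //; exact: stretch_pos.
  by rewrite (stretched_volume _ cO l0) e1 -EFinM lamV.
have sp := stretched_perimeter cO l0 mG1 pG1.
have p2pos : ~ p2 <= 0.
  move=> p2le; apply: (pbound0_absurd (J := predT) nt oO cO Yi0 isT mG2 v2).
  exact: le_pbound p2le pG2.
(* If [lam >= 1], shrinking [G1] gives a competitor of perimeter at most p1. So p <= p1 and p2 <= 0,
   although [G2] has finite positive volume. *)
have [l1|l1] := ltP lam 1; last first.
  apply: p2pos; have := low _ sp; rewrite (max_idPr l1).
  have -> : (lam ^+ #|Y|)^-1 * (lam * p1) = (lam ^+ #|Y|.-1)^-1 * p1.
    by rewrite -[in LHS](prednK Y0) exprS invfM mulrACA mulVf ?mul1r// gt_eqF.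
  move=> h; have : (lam ^+ #|Y|.-1)^-1 * p1 <= p1.
    by rewrite ler_piMl// invf_le1 ?exprn_gt0// exprn_ege1.
  by lra.
have maxE : Num.max 1 lam = 1 by apply/max_idPl; exact: ltW.
(* If [lam < 1], minimality shows that the stretching bound is attained; by rigidity with th = lam,
   [G1] has no variation along [Y]. *)
apply: (pbound0_absurd (J := Y) nt oO cO Yi0 Yi0 mG1 v1).
apply: (@pbound_dmap_rigid _ _ Y O (stretch Y lam) 0 G1 1 lam p1) => //.
- exact: stretch_pos.
- by rewrite l0.
- by move=> z; exact: cyl_stretch.
- by move=> i; rewrite mxE; case: ifP => // _; exact: ltW.
- by move=> i Yi; rewrite mxE Yi mulr1.
- by move=> q /low; apply: le_trans; rewrite ddet_stretch mul1r.
Qed.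

Lemma no_split Y O E G1 G2 (p p1 p2 : R) : (0 < volume [set: rV])%E -> open O ->
  cyl Y O -> (0 < #|Y|)%N -> isop O E p ->
  lebesgue_measurable G1 -> lebesgue_measurable G2 ->
  pbound predT O G1 p1 -> pbound predT O G2 p2 -> p1 + p2 <= p ->
  (volume (E `&` O) <= volume (G1 `&` O) + volume (G2 `&` O))%E ->
  (0 < volume (G1 `&` O) < +oo)%E -> (0 < volume (G2 `&` O) < +oo)%E -> False.
Proof.
move=> nt oO cO Y0 iE mG1 mG2 pG1 pG2 p12 vle v1 v2.
have [h|/ltW h] := leP (p1 * fine (volume (G2 `&` O))) (p2 * fine (volume (G1 `&` O))).
  exact: (no_split_le nt oO cO Y0 iE mG1 mG2 pG1 pG2 p12 vle v1 v2 h).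
by apply: (no_split_le nt oO cO Y0 iE mG2 mG1 pG2 pG1 _ _ v2 v1 h); rewrite addrC// addeC.
Qed.

End no_split.

(** * Translates of a set of infinite volume *)

Section translates.
Context (R : realType) (d : nat).
Local Notation rV := 'rV[R]_d.
Implicit Types (A B C F G L W O V : set rV) (f g phi : rV -> R) (z w u c t v : rV).
Implicit Types (X : 'I_d -> rV -> R) (J Y : pred 'I_d) (i : 'I_d) (k n : nat).

Definition nsh i k G : set rV := sh (k%:R *: e_ i) G.

(** The set-theoretic lower limit of the translates, a measurable candidate available without
    compactness; convergence in measure is shown afterwards, strip by strip. *)
Definition limG i G : set rV := [set z | exists n, forall k, (n <= k)%N -> nsh i k G z].

(** Half-open, so that consecutive strips are disjoint and leave no gap. *)
Definition strip i (a : R) n : set rV := [set z | a <= z 0 i < a + n%:R].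

Lemma measurable_nsh i k G : lebesgue_measurable G -> lebesgue_measurable (nsh i k G).
Proof. exact: measurable_sh. Qed.

Lemma measurable_limG i G : lebesgue_measurable G -> lebesgue_measurable (limG i G).
Proof.
move=> mG; rewrite (_ : limG i G = \bigcup_n \bigcap_k nsh i (n + k) G).
  apply: (@bigcupT_measurable _ (lebesgue_space R d)) => n.
  by apply: (@bigcapT_measurable _ (lebesgue_space R d)) => k; exact: measurable_nsh.
apply/seteqP; split => z [n].
  by move=> h; exists n => // k _; apply: h; exact: leq_addr.
by move=> _ h; exists n => k /subnKC <-; exact: h.
Qed.

Lemma open_coord_lt i (b : R) : open [set z : rV | z 0 i < b].
Proof.
apply/rv_openP => z /= zb; exists (b - z 0 i); first by rewrite subr_gt0.
by move=> w zw; have := le_lt_trans (le_coord (z - w) i) zw; rewrite !mxE ltr_norml => /andP[]; lra.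
Qed.

Lemma measurable_coord_ge i (b : R) : lebesgue_measurable [set z : rV | b <= z 0 i].
Proof.
rewrite (_ : mkset _ = ~` [set z : rV | z 0 i < b]).
  apply: (@measurableC _ (lebesgue_space R d)); apply: measurable_open; exact: open_coord_lt.
by apply/funext => z /=; apply/propext; split => [h|/negP]; [apply/negP|]; rewrite -leNgt.
Qed.

Lemma measurable_strip i (a : R) n : lebesgue_measurable (strip i a n).
Proof.
rewrite (_ : strip i a n = [set z : rV | a <= z 0 i] `&` [set z : rV | z 0 i < a + n%:R]).
  apply: (@measurableI _ (lebesgue_space R d)); first exact: measurable_coord_ge.
  by apply: measurable_open; exact: open_coord_lt.
by apply/funext => z; apply/propext; split => [/andP[]|[h1 h2]] //; apply/andP.
Qed.

Let mI A B : lebesgue_measurable A -> lebesgue_measurable B -> lebesgue_measurable (A `&` B).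
Proof. exact: (@measurableI _ (lebesgue_space R d)). Qed.

(* If z + (k + j) e never meets the symmetric difference D of two successive
   translates, then membership of z in the k-th translate is final; and on a unit
   strip the translates of D come from disjoint pieces of D. *)
Lemma limG_strip1 Y O G i (a e : R) : cyl Y O -> Y i -> open O -> lebesgue_measurable G ->
  (volume ((nsh i 1 G `+` G) `&` O) < +oo)%E -> 0 < e ->
  exists n0, forall k, (n0 <= k)%N ->
    (volume ((nsh i k G `+` limG i G) `&` (O `&` strip i a 1)) <= e%:E)%E.
Proof.
move=> cO Yi oO mG; set D := (_ `+` _) `&` O => fD e0.
have mO := measurable_open oO.
have mD : lebesgue_measurable D by apply: mI => //; apply: measurableY => //; exact: measurable_nsh.
pose H n := D `&` [set z : rV | a + n%:R <= z 0 i].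
have mH n : lebesgue_measurable (H n) by apply: mI => //; exact: measurable_coord_ge.
have ndH n m : (n <= m)%N -> H m `<=` H n.
  by move=> nm z [Dz /= h]; split => //=; apply: le_trans h; rewrite lerD2l ler_nat.
(* The parts of [D] above growing heights decrease to the empty set, and [D] has finite volume. *)
have [n0 hn0] : exists n, (volume (H n) <= e%:E)%E.
  apply: volume_bigcap0 => //; first by apply: le_lt_trans fD; apply: le_volume => z [].
  rewrite -subset0 => z /(_ (Num.truncn (z 0 i - a)).+1 I)[_ /=].
  by rewrite -lerBrDl leNgt truncnS_gt.
exists n0 => k nk; apply: le_trans hn0; apply: (@le_trans _ _ (volume (H k))); last first.
  by apply: le_volume; exact: ndH.
pose T j : set rV := D `&` strip i (a + (k + j)%:R) 1.
have mT j : lebesgue_measurable (T j) by apply: mI => //; exact: measurable_strip.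
apply: (@le_trans _ _ (volume (\bigcup_j T j))); last first.
  apply: le_volume => z [j _ [Dz /andP[h _]]]; split => //=.
  by apply: le_trans h; rewrite lerD2l ler_nat leq_addr.
rewrite (@measure_semi_bigcup _ _ (lebesgue_space R d) (@volume R d)) //; last 2 first.
- apply/trivIsetP => j1 j2 _ _ j12; rewrite -subset0 => z [[_ /andP[h1 h2]] [_ /andP[h3 h4]]].
  have disj x y : (x < y)%N -> z 0 i < a + (k + x)%:R + 1 -> a + (k + y)%:R <= z 0 i -> False.
    move=> xy; have : (k + x)%:R + 1 <= (k + y)%:R :> R by rewrite natr1 ler_nat ltn_add2l.
    by lra.
  by case: (ltngtP j1 j2) j12 => // j12 _; [exact: disj j12 h2 h3|exact: disj j12 h4 h1].
- exact: (@bigcupT_measurable _ (lebesgue_space R d)).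
have volT j : volume (T j) = volume (nsh i (k + j) (T j)) by rewrite /nsh volume_sh.
rewrite (eq_eseriesr (fun j _ => volT j)).
apply: le_trans (@lebesgue_outer_sigma_subadditive R d _); apply: le_volume => z [hz [Oz zs]].
apply: contrapT => nz.
have tr j : O (z + j%:R *: e_ i) by apply/(cyl_translate z j%:R cO Yi).
have step j : (k <= j)%N -> G (z + j.+1%:R *: e_ i) <-> G (z + j%:R *: e_ i).
  move=> kj; apply: contrapT => nG; apply: nz; exists (j - k)%N => //.
  rewrite /nsh /sh/= /T subnKC//; split; last first.
    move: zs; rewrite /strip/= !mxE !eqxx/= mulr1 => /andP[z1 z2].
    by apply/andP; split; lra.
  split; last exact: tr.
  move: nG; rewrite -[j.+1]addn1 natrD scalerDl addrA /nsh /setY/=.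
  have [?|?] := pselect (G (z + j%:R *: e_ i)); have [?|?] := pselect (G (z + j%:R *: e_ i + 1 *: e_ i)); tauto.
have all j : (k <= j)%N -> G (z + j%:R *: e_ i) <-> G (z + k%:R *: e_ i).
  elim: j => [|j IH]; first by rewrite leqn0 => /eqP ->.
  rewrite leq_eqVlt => /orP[/eqP -> //|]; rewrite ltnS => kj.
  by rewrite step// IH.
have : limG i G z <-> nsh i k G z.
  split=> [[n hn]|h]; last by exists k => j /all; rewrite /nsh /sh/= => ->.
  have := hn (maxn n k) (leq_maxl _ _); rewrite /nsh /sh/= all//; exact: leq_maxr.
by move: hz; rewrite /setY/=; tauto.
Qed.

Lemma limG_strip Y O G i (a e : R) n : cyl Y O -> Y i -> open O -> lebesgue_measurable G ->
  (volume ((nsh i 1 G `+` G) `&` O) < +oo)%E -> 0 < e ->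
  exists n0, forall k, (n0 <= k)%N ->
    (volume ((nsh i k G `+` limG i G) `&` (O `&` strip i a n)) <= e%:E)%E.
Proof.
move=> cO Yi oO mG fD; elim: n e => [|n IH] e e0.
  exists 0%N => k _; rewrite (_ : strip i a 0 = set0) ?setI0 ?measure0 ?lee_fin ?ltW//.
  by rewrite -subset0 => z /andP[h1]; rewrite addr0 ltNge h1.
have e20 : 0 < e / 2 by lra.
have [n1 h1] := IH _ e20.
have [n2 h2] := limG_strip1 (a + n%:R) cO Yi oO mG fD e20.
exists (maxn n1 n2) => k; rewrite geq_max => /andP[/h1 k1 /h2 k2].
apply: (@le_trans _ _ ((e / 2)%:E + (e / 2)%:E)%E); last by rewrite -EFinD lee_fin; lra.
apply: le_trans (leeD k1 k2); apply: le_trans (volumeU_le _ _); apply: le_volume => z.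
move=> [zW [Oz /andP[za zn]]]; have [zl|zl] := ltP (z 0 i) (a + n%:R).
  by left; split => //; split => //; apply/andP.
by right; split => //; split => //; apply/andP; split; rewrite // -addrA natr1.
Qed.

Lemma limG_cvg Y O G i (M e : R) : cyl Y O -> Y i -> open O -> lebesgue_measurable G ->
  (volume ((nsh i 1 G `+` G) `&` O) < +oo)%E -> 0 < e ->
  exists n0, forall k, (n0 <= k)%N ->
    (volume ((nsh i k G `+` limG i G) `&` (O `&` [set z | (`|z| <= M)%R])) <= e%:E)%E.
Proof.
move=> cO Yi oO mG fD e0.
have [n0 h] := limG_strip (- M) (Num.truncn (M + M)).+1 cO Yi oO mG fD e0.
exists n0 => k /h h'; apply: le_trans h'; apply: le_volume => z [zW [Oz /= zM]].
split => //; split => //; have := le_trans (le_coord z i) zM; rewrite ler_norml => /andP[m1 m2].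
apply/andP; split => //; have := truncnS_gt (M + M); lra.
Qed.

(** Perimeter bounds pass to limits of sets through this estimate; it holds because the divergence
    of a fixed field is bounded with bounded support. *)
Lemma flux_dist J O (s : R) X : vfield J O s X -> exists c M : R, 0 < c /\
  forall A B, lebesgue_measurable A -> lebesgue_measurable B ->
    `|flux A X - flux B X| <= c * fine (volume ((A `+` B) `&` (O `&` [set z | `|z| <= M]))).
Proof.
move=> vX; have [r [M [r0 dX]]] := vfield_deep vX; have cX := vfield_CS vX.
have tD := tame_divg cX.
have [_ [N hN]] := tD.
exists (`|N| + 1), `|N|; split => [|A B mA mB]; first by rewrite ltr_wpDl.
rewrite /flux -(intgB (tame_indicM mA tD) (tame_indicM mB tD)).
set b := `|N| + 1; have -> : b = `|b| by rewrite ger0_norm// addr_ge0.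
set Q := _ `&` _.
have vfin : (volume Q < +oo)%E by apply: (@volume_bounded _ _ _ `|N|) => z [_ []].
have mIQ B' : measurable (B' : set (lebesgue_space R d)) -> lebesgue_measurable B' by [].
pose Q' := (A `+` B) `&` [set z : rV | divg X z != 0].
have mQ' : lebesgue_measurable Q'.
  apply: mI; first exact: measurableY.
  have [lm _] := tD; have := lm measurableT [set~ 0]; rewrite setTI => h.
  rewrite (_ : mkset _ = divg X @^-1` [set~ 0]); first by apply: h; exact: measurableC.
  by apply/funext => z /=; apply/propext; split => [/eqP|/eqP].
have QQ : Q' `<=` Q.
  move=> z [zAB /= dz]; split => //; split.
    apply: contrapT => nO; move: dz; rewrite /divg big1 ?eqxx// => j _.
    have [cXin _ _] := vX; have [r' r'0 h] := vanishes_out (cXin j).2 nO.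
    by rewrite (@partial_local _ _ (X j) (fun=> 0)) ?partial_cst//; exact: near_norm r'0 h.
  rewrite /= leNgt; apply/negP => zN; move: dz; rewrite (hN z).2 ?eqxx//.
  exact: le_lt_trans (ler_norm N) zN.
have fQ' : (volume Q' < +oo)%E by apply: le_lt_trans vfin; exact: le_volume.
apply: (@le_trans _ _ (`|b| * fine (volume Q'))).
  apply: intg_bound => //.
  - exact: tameB (tame_indicM mA tD) (tame_indicM mB tD).
  - move=> z; rewrite -mulrBl normrM norm_indicB.
    have /andP[i0 i1] := indic_01 (R := R) (A `+` B) z.
    rewrite -[leRHS]mul1r ler_pM//; apply: le_trans (hN z).1 _.
    by apply: le_trans (ler_norm _) _; rewrite lerDl.
  - move=> z nQ; apply/eqP; rewrite -mulrBl -normr_eq0 normrM norm_indicB.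
    have [->|dz] := eqVneq (divg X z) 0; first by rewrite normr0 mulr0.
    by rewrite indicE memNset ?mul0r// => zAB; apply: nQ.
rewrite ler_wpM2l// fine_le ?ge0_fin_numE ?volume_ge0//; exact: le_volume.
Qed.

Lemma flux_sh G u X : lebesgue_measurable G -> (forall i, CS (X i)) ->
  flux G (fun i z => X i (z - u)) = flux (sh u G) X.
Proof.
move=> mG cX.
have dE z : divg (fun i z => X i (z - u)) z = divg X (z - u).
  by apply: eq_bigr => i _; rewrite (partial_sh (- u) i (CS_smooth (cX i))).
have t : tame (fun z => \1_G z * divg X (z - u)).
  by apply: tame_indicM => //; apply: (tame_sh (- u) (tame_divg cX)).
rewrite /flux -(intg_sh u (f := fun z => \1_G z * divg (fun i z => X i (z - u)) z)).
  by congr intg; apply/funext => z; rewrite dE addrK.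
by under eq_fun do rewrite dE.
Qed.

Lemma CSin_sh O u phi : (forall z, O (z + u) <-> O z) -> CSin O phi ->
  CSin O (fun z => phi (z + u)).
Proof.
by move=> Ou cp; rewrite (sh_dmapE u phi); apply: CSin_dmap => //; [exact: dpos1|move=> z; rewrite dmap1].
Qed.

Lemma pbound_sh J O G u (p : R) : (forall z, O (z + u) <-> O z) -> lebesgue_measurable G ->
  pbound J O G p -> pbound J O (sh u G) p.
Proof.
move=> Ou mG pG X vX; rewrite -flux_sh//; last exact: vfield_CS vX.
have Ou' z : O (z - u) <-> O z by rewrite -(Ou (z - u)) subrK.
apply: pG; have [cX jX nX] := vX; split => [i|i /jX ->//|z]; last exact: nX.
exact: CSin_sh.
Qed.

(* If some field had positive flux out of the limit set, placing many disjoint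
   far away translates of it would give G unbounded perimeter. *)
Lemma limG_perimeter Y O G i (p : R) : cyl Y O -> Y i -> open O -> lebesgue_measurable G ->
  (volume ((nsh i 1 G `+` G) `&` O) < +oo)%E -> pbound predT O G p ->
  pbound predT O (limG i G) 0.
Proof.
move=> cO Yi oO mG fD pG X vX; rewrite leNgt; apply/negP => a0.
set a := flux _ X in a0.
have mW := measurable_limG i mG.
have [c [M [c0 hc]]] := flux_dist vX.
have a2c : 0 < a / 2 / c by rewrite !divr_gt0.
have [n0 hn0] := limG_cvg M cO Yi oO mG fD a2c.
have low k : (n0 <= k)%N -> a / 2 <= flux (nsh i k G) X.
  move=> /hn0 h; have := hc _ _ (measurable_nsh i k mG) mW; rewrite -/a.
  have : c * fine (volume ((nsh i k G `+` limG i G) `&` (O `&` [set z | `|z| <= M]))) <= a / 2.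
    rewrite mulrC -ler_pdivlMr// -lee_fin fineK// ge0_fin_numE ?volume_ge0//.
    by apply: le_lt_trans h _; rewrite ltry.
  by move=> h1 h2; move: (le_trans h2 h1); rewrite ler_norml => /andP[]; lra.
have cX := vfield_CS vX; have [cXin _ nX] := vX.
have [r [N [r0 dX]]] := vfield_deep vX.
(* More than the extent of the support of [X] along [e_ i]: the translates by [u j] have disjoint
   supports, so their sum [Z n] still has norm at most 1. *)
pose T := (Num.truncn (N + N)).+1.
pose K j := (n0 + j * T)%N.
pose u j : rV := (K j)%:R *: e_ i.
pose Z n l z := \sum_(j < n) X l (z - u j).
have Ou j z : O (z + u j) <-> O z by exact: cyl_translate cO Yi.
have Ou' j z : O (z - u j) <-> O z by rewrite -(Ou j (z - u j)) subrK.
have cZ n l : CSin O (Z n l).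
  elim: n => [|n IH].
    by rewrite /Z; under eq_fun do rewrite big_ord0; exact: CSin0.
  rewrite /Z; under eq_fun do rewrite big_ord_recr/=.
  by apply: CSinD => //; apply: CSin_sh => // z; exact: Ou'.
have vZ n : vfield predT O 1 (Z n).
  split => // z.
  have [|h] := pselect (exists j : 'I_n, exists l, X l (z - u j) != 0); last first.
    rewrite big1 ?expr1n// => l _; rewrite /Z big1 ?expr0n// => j _; apply/eqP/negPn/negP => nz.
    by apply: h; exists j, l.
  move=> [j [l hl]]; apply: le_trans (nX (z - u j)).
  apply: ler_sum => l' _; rewrite /Z (bigD1 j)//= big1 ?addr0// => j' jj'.
  apply/eqP/negPn/negP => hl'.
  have far m l0 : X l0 (z - u m) != 0 -> `|z 0 i - (K m)%:R| <= N.
    move=> /dX[zN _]; have := le_trans (le_coord _ i) zN.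
    by rewrite /u !mxE !eqxx/= mulr1.
  have := far _ _ hl; have := far _ _ hl'; rewrite !ler_norml.
  have disj x y : (x < y)%N -> (K x)%:R + (N + N) < (K y)%:R :> R.
    move=> xy; apply: lt_le_trans (_ : (K x + T)%:R <= _).
      by rewrite natrD ltrD2l truncnS_gt.
    by rewrite ler_nat /K -addnA leq_add2l -mulSnr leq_mul2r xy orbT.
  move: jj'; rewrite -(inj_eq val_inj)/=; case: ltngtP => // /disj + _;
  move: (K j)%:R (K j')%:R (z 0 i) => x y v; clear => ? /andP[? ?] /andP[? ?]; lra.
have fZ n : n%:R * (a / 2) <= flux G (Z n).
  elim: n => [|n IH].
    rewrite mul0r /flux (_ : (fun z => _) = fun=> 0) ?intg0//; apply/funext => z.
    rewrite /divg big1 ?mulr0// => l _; rewrite /Z; under eq_fun do rewrite big_ord0.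
    by rewrite partial_cst.
  have -> : Z n.+1 = fun l z => Z n l z + X l (z - u n).
    by apply/funext => l; apply/funext => z; rewrite /Z big_ord_recr.
  have C1 l : CS (Z n l) by exact: CSin_CS (cZ n l).
  have C2 l : CS (fun z => X l (z - u n)) by apply: (CS_sh (- u n)).
  have E := etrans (fluxD mG C1 C2) (congr1 (fun x => flux G (Z n) + x) (flux_sh (u n) mG cX)).
  have := low (K n) (leq_addr _ _); rewrite /nsh -/(u n) => lowK.
  rewrite E -natr1 mulrDl mul1r.
  exact: lerD IH lowK.
(* This many copies, each with flux at least a/2, exceed the bound [p]. *)
have := pG _ (vZ (Num.truncn (p / (a / 2))).+1); have := fZ (Num.truncn (p / (a / 2))).+1.
have := truncnS_gt (p / (a / 2)); rewrite ltr_pdivrMr; last by lra.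
by move: (_%:R * _) (flux _ _) => x y; lra.
Qed.

(** A unit translation alters [G] by finite volume only, so the translates converge to a set without
    perimeter. In a convex open set that set is null or of full measure, and [V] is its exact
    version. *)
Lemma translates_limit Y O G i (p : R) : (0 < volume [set: rV])%E ->
  cyl Y O -> Y i -> open O -> convx O -> lebesgue_measurable G ->
  pbound predT O G p -> exists V, (V = set0 \/ V = setT) /\
  forall M e : R, 0 < e -> exists n0, forall k, (n0 <= k)%N ->
    (volume ((nsh i k G `+` V) `&` (O `&` [set z | (`|z| <= M)%R])) <= e%:E)%E.
Proof.
move=> nt cO Yi oO cvO mG pG.
have fD : (volume ((nsh i 1 G `+` G) `&` O) < +oo)%E.
  have := translate_volume (1 : R) nt oO (fun z s => cyl_translate z s cO Yi) mG pG (isT : predT i).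
  by move=> h; apply: le_lt_trans h _; rewrite ltry.
have pW := limG_perimeter cO Yi oO mG fD pG.
have [V [VV VW]] : exists V, (V = set0 \/ V = setT) /\ volume ((limG i G `+` V) `&` O) = 0%E.
  case: (pbound0_trivial nt oO cvO (measurable_limG i mG) pW) => h.
    by exists set0; split; [left|rewrite setY0 setIC].
  by exists setT; split; [right|rewrite setYTC setIC].
exists V; split => // M e e0; have [n0 h] := limG_cvg M cO Yi oO mG fD e0.
exists n0 => k /h h'; rewrite -[leRHS]adde0 -VW; apply: le_trans (leeD h' (lexx _)).
apply: le_trans (volumeU_le _ _); apply: le_volume => z; rewrite /setY/= => -[zV [Oz zM]].
by have [?|?] := pselect (limG i G z); have [?|?] := pselect (V z); have [?|?] := pselect (nsh i k G z); tauto.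
Qed.

Lemma volume_ball_large A (c : R) : lebesgue_measurable A -> volume A = +oo%E ->
  exists M : R, (c%:E < volume (A `&` [set z | (`|z| <= M)%R]))%E.
Proof.
move=> mA Aoo; apply: contrapT => h.
have : (volume A <= c%:E)%E; last by rewrite Aoo.
rewrite (_ : A = \bigcup_n (A `&` [set z : rV | `|z| <= n%:R])).
  apply: volume_bigcup_le => n.
  - by apply: mI => //; exact: measurable_ball_norm.
  - by move=> m nm z [Az /= zn]; split => //=; apply: le_trans zn _; rewrite ler_nat.
  - by rewrite leNgt; apply/negP => hn; apply: h; exists n%:R.
apply/seteqP; split => z; last by case=> n _ [].
by move=> Az; exists (Num.truncn `|z|).+1 => //; split => //=; rewrite ltW// truncnS_gt.
Qed.

(** For either [V], the symmetric difference of [G] and [V] has infinite volume in [O]. On a large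
    ball it exceeds [c + 1], while far translates of [G] differ from [V] there by volume at most
    1. *)
Lemma translates_diverge O G V i (c : R) : open O -> lebesgue_measurable G ->
  (V = set0 \/ V = setT) -> volume (G `&` O) = +oo%E -> volume (O `\` G) = +oo%E ->
  (forall M e : R, 0 < e -> exists n0, forall k, (n0 <= k)%N ->
    (volume ((nsh i k G `+` V) `&` (O `&` [set z | (`|z| <= M)%R])) <= e%:E)%E) ->
  exists n0, forall k, (n0 <= k)%N -> (c%:E <= volume ((nsh i k G `+` G) `&` O))%E.
Proof.
move=> oO mG VV vG vC hV; have mO := measurable_open oO.
have mA : lebesgue_measurable ((G `+` V) `&` O).
  by apply: mI => //; apply: measurableY => //; case: VV => ->; [exact: measurable0|exact: measurableT].
have vA : volume ((G `+` V) `&` O) = +oo%E.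
  by case: VV => ->; rewrite ?setY0// setYTC setIC.
have [M hM] := volume_ball_large (c + 1) mA vA.
have [n0 h] := hV M 1 ltr01; exists n0 => k /h h'.
rewrite -(@leeD2rE _ 1%:E)// -EFinD; apply: le_trans (ltW hM) _.
apply: le_trans (leeD (lexx _) h'); apply: le_trans (volumeU_le _ _).
apply: le_volume => z; rewrite /setY/= => -[[zG Oz] zM].
by have [?|?] := pselect (G z); have [?|?] := pselect (V z); have [?|?] := pselect (nsh i k G z); tauto.
Qed.

(* A set of no larger perimeter and larger volume, shrunk along the cylinder. *)
Lemma isop_larger Y O E G (p : R) : (0 < volume [set: rV])%E -> open O -> cyl Y O ->
  (0 < #|Y|)%N -> isop O E p -> lebesgue_measurable G -> pbound predT O G p ->
  (volume (E `&` O) < volume (G `&` O) < +oo)%E ->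
  #|Y| = 1%N /\ pbound (predC Y) O G 0.
Proof.
move=> nt oO cO Y0 [mE vE pE minE] mG pG /andP[EG Gf].
have [i0 Yi0] : exists i, Y i by move: Y0 => /card_gt0P[i Yi]; exists i.
have p0 : 0 < p.
  rewrite ltNge; apply/negP => p0; apply: (pbound0_absurd (J := predT) nt oO cO Yi0 isT mE vE).
  exact: le_pbound p0 pE.
have vG : (0 < volume (G `&` O) < +oo)%E by rewrite Gf andbT (le_lt_trans _ EG)// volume_ge0.
have [eG VG0] := volume_fine vG; have [eE VE0] := volume_fine vE.
move: EG eG eE VG0 VE0; set VG := fine (volume (G `&` O)); set VE := fine (volume (E `&` O)).
move=> EG eG eE VG0 VE0; rewrite eG eE lte_fin in EG.
have [lam l0 lamE] := pos_root (divr_gt0 VG0 VE0) Y0.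
have l1 : 1 < lam.
  rewrite ltNge; apply/negP => l1; have : lam ^+ #|Y| <= 1 by rewrite exprn_ile1// ltW.
  by rewrite lamE ler_pdivrMr// mul1r leNgt EG.
have low q : pbound predT O (dmap (stretch Y lam) 0 @^-1` G) q -> p <= q.
  apply: minE; first by apply: measurable_dmap => //; exact: stretch_pos.
  by rewrite (stretched_volume _ cO l0) eG eE -EFinM lamE invf_div divfK ?gt_eqF.
have Elam : (lam ^+ #|Y|)^-1 * (lam * p) = (lam ^+ #|Y|.-1)^-1 * p.
  by rewrite -[in LHS](prednK Y0) exprS invfM mulrACA mulVf ?mul1r// gt_eqF.
(* With more than one axis coordinate [lam ^+ #|Y|.-1] exceeds 1, so shrinking [G] to the volume of
   [E] would strictly lower the perimeter. *)
have Y1 : #|Y| = 1%N.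
  apply/eqP; rewrite eqn_leq Y0 andbT leqNgt; apply/negP => Y2.
  have := low _ (stretched_perimeter cO l0 mG pG); rewrite (max_idPr (ltW l1)) Elam.
  have lt1 : 1 < lam ^+ #|Y|.-1 by rewrite exprn_egt1// -lt0n -ltnS (prednK Y0).
  by rewrite ler_pMl// invf_ge1 ?exprn_gt0// leNgt lt1.
(* With one axis coordinate the bound is exactly [p], hence attained. The coordinates off [Y] are
   scaled by 1, which is th A for A = lam and th = 1/lam, so rigidity applies to them. *)
split => //; apply: (@pbound_dmap_rigid _ _ (predC Y) O (stretch Y lam) 0 G lam lam^-1 p) => //.
- exact: stretch_pos.
- by rewrite invr_gt0 l0 invf_lt1.
- by move=> z; exact: cyl_stretch.
- by move=> i; rewrite mxE; case: ifP => // _; exact: ltW.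
- by move=> i /negPf Yi; rewrite mxE Yi mulVf// gt_eqF.
- by move=> q /low; apply: le_trans; rewrite ddet_stretch Elam Y1 expr0 invr1 mul1r.
Qed.

Lemma pbound_eq J O A B (p : R) : lebesgue_measurable A -> lebesgue_measurable B ->
  (forall z, O z -> A z <-> B z) -> pbound J O A p -> pbound J O B p.
Proof.
move=> mA mB AB pA X vX; have [cX _ _] := vX; rewrite -(flux_setI mB cX).
suff -> : B `&` O = A `&` O by rewrite (flux_setI mA cX); exact: pA.
by apply/seteqP; split => z [/AB h Oz]; split => //; exact: h.
Qed.

Lemma trivial_pbound J O V : V = set0 \/ V = setT -> pbound J O V 0.
Proof.
move=> VV X vX; have cX := vfield_CS vX; case: VV => ->.
  by rewrite /flux indic0; under eq_fun do rewrite mul0r; rewrite intg0.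
by rewrite /flux indicT; under eq_fun do rewrite mul1r; rewrite intg_divg.
Qed.

Lemma infinite_split Y O E G1 G2 (p p1 p2 : R) : (0 < volume [set: rV])%E -> open O ->
  convx O -> cyl Y O -> (0 < #|Y|)%N -> isop O E p ->
  lebesgue_measurable G1 -> lebesgue_measurable G2 ->
  pbound predT O G1 p1 -> pbound predT O G2 p2 -> p1 + p2 <= p ->
  (forall z, O z -> E z <-> (G1 `+` G2) z) ->
  volume (G1 `&` O) = +oo%E -> volume (O `\` G1) = +oo%E ->
  #|Y| = 1%N /\ pbound (predC Y) O E 0.
Proof.
move=> nt oO cvO cO Y0 iE mG1 mG2 pG1 pG2 p12 EG vG vC.
have [mE vE pE minE] := iE.
have [i Yi] : exists i, Y i by move: Y0 => /card_gt0P[i Yi]; exists i.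
have Oi k z : O (z + k%:R *: e_ i) <-> O z by exact: cyl_translate cO Yi.
have [V [VV hV]] := translates_limit nt cO Yi oO cvO mG1 pG1.
have mV : lebesgue_measurable V by case: VV => ->; [exact: measurable0|exact: measurableT].
have [eE VE0] := volume_fine vE; set VE := fine (volume (E `&` O)) in eE VE0.
(* [Ek k] and [E] differ by the symmetric difference of [G1] and its translate; volume at least 2 VE
   + 1 for the latter leaves at least VE + 1 for [Ek k]. *)
have [n0 hn0] := translates_diverge (VE + VE + 1) oO mG1 VV vG vC hV.
pose Ek k := nsh i k G1 `+` G2.
have mEk k : lebesgue_measurable (Ek k) by apply: measurableY => //; exact: measurable_nsh.
have key k : (n0 <= k)%N -> #|Y| = 1%N /\ pbound (predC Y) O (Ek k) 0.
  move=> /hn0 h.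
  apply: (isop_larger nt oO cO Y0 iE (mEk k)).
    apply: le_pbound p12 _; apply: setY_pbound => //; first exact: measurable_nsh.
    exact: pbound_sh.
  have fk : (volume ((nsh i k G1 `+` G1) `&` O) < +oo)%E.
    have := translate_volume (k%:R : R) nt oO (fun z s => cyl_translate z s cO Yi) mG1 pG1 (isT : predT i).
    by move=> h'; apply: le_lt_trans h' _; rewrite ltry.
  apply/andP; split; last first.
    apply: (@le_lt_trans _ _ (volume ((nsh i k G1 `+` G1) `&` O) + volume (E `&` O))%E).
      apply: le_trans (volumeU_le _ _); apply: le_volume => z; rewrite /Ek /setY/= => -[zE Oz].
      have := EG z Oz; rewrite /setY/=.
      by have [?|?] := pselect (G1 z); have [?|?] := pselect (G2 z); have [?|?] := pselect (nsh i k G1 z); tauto.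
    by apply: lte_add_pinfty => //; have /andP[] := vE.
  have : (volume ((nsh i k G1 `+` G1) `&` O) <= volume (Ek k `&` O) + volume (E `&` O))%E.
    apply: le_trans (volumeU_le _ _); apply: le_volume => z; rewrite /Ek /setY/= => -[zE Oz].
    have := EG z Oz; rewrite /setY/=.
    by have [?|?] := pselect (G1 z); have [?|?] := pselect (G2 z); have [?|?] := pselect (nsh i k G1 z); tauto.
  move=> /(le_trans h); rewrite eE; case: (volume (Ek k `&` O)) => [x| |]; last by [].
    by rewrite -EFinD lee_fin lte_fin; lra.
  by rewrite ltry.
have Y1 : #|Y| = 1%N by have [] := key n0 (leqnn _).
split => //.
have mVG : lebesgue_measurable (V `+` G2) by exact: measurableY.
(* [Ek k] and the symmetric difference of [V] and [G2] differ by that of the translate of [G1] and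
   [V], whose volume tends to 0 on bounded sets; so the flux of a fixed field passes to the
   limit. *)
have pVG : pbound (predC Y) O (V `+` G2) 0.
  move=> X vX; have [c [M [c0 hc]]] := flux_dist vX.
  apply/ler_addgt0Pr => e e0; rewrite add0r.
  have [n1 hn1] := hV M _ (divr_gt0 e0 c0).
  have [_ pk] := key _ (leq_maxl n0 n1); have hk := hn1 _ (leq_maxr n0 n1).
  have := pk X vX; have := hc _ _ (mEk (maxn n0 n1)) mVG.
  have -> : Ek (maxn n0 n1) `+` (V `+` G2) = nsh i (maxn n0 n1) G1 `+` V.
    by rewrite /Ek [V `+` G2]setYC setYA -[_ `+` G2 `+` G2]setYA setYK setY0.
  have : c * fine (volume ((nsh i (maxn n0 n1) G1 `+` V) `&` (O `&` [set z | `|z| <= M]))) <= e.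
    rewrite mulrC -ler_pdivlMr// -lee_fin fineK// ge0_fin_numE ?volume_ge0//.
    by apply: le_lt_trans hk _; rewrite ltry.
  by move=> h1 h2 h3; move: (le_trans h2 h1); rewrite ler_norml => /andP[]; lra.
(* The rest is mod 2 algebra, in which zero bounds add up to zero: [G2] is V + (V + G2), a translate
   of [G1] is Ek + G2, and [E] is G1 + G2 in [O]. *)
have p2' : pbound (predC Y) O G2 0.
  rewrite -[G2](set0Y) -(setYK V) -setYA -[0]addr0.
  by apply: setY_pbound => //; exact: trivial_pbound.
have [_ pn] := key n0 (leqnn _).
have p1' : pbound (predC Y) O G1 0.
  have h : pbound (predC Y) O (nsh i n0 G1) 0.
    rewrite -[nsh i n0 G1](setY0) -(setYK G2) setYA -[0]addr0.
    exact: setY_pbound nt (mEk n0) mG2 pn p2'.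
  have Oi' z : O (z - n0%:R *: e_ i) <-> O z by rewrite -(Oi n0 (z - _)) subrK.
  have := pbound_sh Oi' (measurable_nsh i n0 mG1) h.
  by rewrite /nsh shsh addNr sh0.
apply: (pbound_eq (measurableY mG1 mG2) mE); first by move=> z /EG ->.
by rewrite -[0]addr0; exact: setY_pbound nt mG1 mG2 p1' p2'.
Qed.

End translates.

(** * Lifting a part of the boundary *)

Section lifting.
Context (R : realType) (d : nat).
Local Notation rV := 'rV[R]_d.
Implicit Types (A B C F G H L W O U V : set rV) (z w u p : rV).

Lemma lconst_eq A B z : (exists2 r : R, 0 < r & forall w, `|z - w| < r -> (A w <-> B w)) ->
  lconst A z -> lconst B z.
Proof.
move=> [r r0 AB] [r' r'0 h]; exists (Num.min r r'); first by rewrite lt_min r0.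
move=> w; rewrite lt_min => /andP[zw zw'].
by rewrite -(AB _ zw) (h _ zw') AB// subrr normr0.
Qed.

Lemma lconstY A B z : lconst A z -> lconst B z -> lconst (A `+` B) z.
Proof.
move=> [r r0 h] [r' r'0 h']; exists (Num.min r r'); first by rewrite lt_min r0.
by move=> w; rewrite lt_min => /andP[/h ? /h' ?]; rewrite /setY/=; tauto.
Qed.

Lemma lconst_trivial A z : A = set0 \/ A = setT -> lconst A z.
Proof. by case=> ->; exists 1. Qed.

Lemma lconstC A z : lconst A z -> lconst (~` A) z.
Proof. by move=> [r r0 h]; exists r => // w /h wz; split => nA /wz. Qed.

Lemma open_lconst A U : open U -> (forall z, U z -> lconst A z) -> open (U `&` A).
Proof.
move=> /rv_openP oU lA; apply/rv_openP => z [Uz Az].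
have [r r0 hr] := oU z Uz; have [r' r'0 hr'] := lA z Uz.
exists (Num.min r r'); first by rewrite lt_min r0.
by move=> w; rewrite lt_min => /andP[/hr ? /hr' ?]; split => //; tauto.
Qed.

Lemma line_continuous p u : continuous (fun t : R => p + t *: u).
Proof.
move=> t; apply: cvgD; first exact: cvg_cst.
by apply: cvgZr_tmp; exact: cvg_id.
Qed.

Lemma convex_comb_lt (a b c s : R) : a < c -> b < c -> 0 <= s <= 1 -> (1 - s) * a + s * b < c.
Proof.
move=> ac bc /andP[s0 s1]; have [->|sn0] := eqVneq s 0; first by rewrite subr0 mul1r mul0r addr0.
have sp : 0 < s by rewrite lt_neqAle eq_sym sn0.
have : s * b < s * c by rewrite ltr_pM2l.
have : (1 - s) * a <= (1 - s) * c by rewrite ler_wpM2l ?subr_ge0// ltW.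
lra.
Qed.

Lemma convx_nball (x : rV) (r : R) : convx (nball x r).
Proof.
move=> u w a; rewrite /nball/= => xu xw /[dup] a01 /andP[a0 a1].
have -> : x - ((1 - a) *: u + a *: w) = (1 - a) *: (x - u) + a *: (x - w).
  by apply/rowP => i; rewrite !mxE; ring.
apply: le_lt_trans (ler_normD _ _) _; rewrite !normrZ (ger0_norm a0) ger0_norm ?subr_ge0//.
exact: convex_comb_lt.
Qed.

Lemma lconst_convx A U x y : open U -> convx U -> (forall z, U z -> lconst A z) ->
  U x -> U y -> A x -> A y.
Proof.
move=> oU cU lA Ux Uy Ax.
pose f (t : R) : rV := x + t *: (y - x).
have cf : continuous f by exact: line_continuous.
have Uf t : `[0, 1]%classic t -> U (f t).
  rewrite /= in_itv/= => t01; rewrite (_ : f t = (1 - t) *: x + t *: y); first exact: cU.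
  by rewrite /f; apply/rowP => i; rewrite !mxE; ring.
have := @segment_connected R 0 1 (`[0, 1] `&` (f @^-1` (U `&` A))).
move=> H; suff : (`[0, 1] `&` (f @^-1` (U `&` A))) 1.
  by move=> [_ [_]]; rewrite /f scale1r addrC subrK.
rewrite H; first by rewrite /= in_itv/= lexx ler01.
- exists 0; split; first by rewrite /= in_itv/= lexx ler01.
  by rewrite /preimage/= /f scale0r addr0.
- exists (f @^-1` (U `&` A)) => //; apply: open_comp; first by move=> t _; exact: cf.
  exact: open_lconst.
- exists (f @^-1` (~` (U `&` ~` A))).
    apply: closed_comp; first by move=> t _; exact: cf.
    by apply: open_closedC; apply: open_lconst => // z /lA; exact: lconstC.
  apply/seteqP; split => t [t01]; first by move=> [Uft Aft]; split => //= -[_ nA].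
  move=> /= nUA; split => //; split; first exact: Uf.
  by apply: contrapT => nA; apply: nUA; split => //; exact: Uf.
Qed.

Lemma lebesgue_number L (V : bool -> set rV) : compact L -> (forall b, open (V b)) ->
  (forall z, L z -> exists b, V b z) ->
  exists2 r : R, 0 < r & forall z, L z -> exists b, forall w, `|z - w| < r -> V b w.
Proof.
move=> cL oV LV.
have H : \forall r \near (0 : R)^'+, forall z, L z -> exists b, forall w, `|z - w| < r -> V b w.
  move: cL => /compact_near_coveringP/near_covering_withinP.
  move=> /(_ _ (0 : R)^'+ (fun r z => exists b, forall w, `|z - w| < r -> V b w)); apply.
  move=> x Lx; have [b Vbx] := LV x Lx; have [e e0 he] := (rv_openP (V b)).1 (oV b) x Vbx.
  near=> y r => Ly; exists b => w yw; apply: he.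
  apply: le_lt_trans (ler_distD y _ _) _.
  have h1 : `|x - y| < e / 2.
    by apply/rv_ball_norm; near: y; apply: nbhsx_ballx; rewrite divr_gt0.
  have h2 : r <= e / 2 by near: r; apply: nbhs_right_le; rewrite divr_gt0.
  by move: yw => /= yw; lra.
have [r [r0 hr]] : exists r, 0 < r /\
    forall z, L z -> exists b, forall w, `|z - w| < r -> V b w.
  near (0 : R)^'+ => r; exists r; split => //; near: r; exact: H.
by exists r.
Unshelve. all: by end_near. Qed.

(** A neighbourhood of the segment from [p] to [z]; being convex, it is a domain on which two
    solutions can be compared. *)
Definition tube p z (r : R) : set rV :=
  [set w | exists2 t : R, 0 <= t <= 1 & `|p + t *: (z - p) - w| < r].

Lemma open_tube p z (r : R) : open (tube p z r).
Proof.
apply/rv_openP => w [t t01 hw]; exists (r - `|p + t *: (z - p) - w|); first by rewrite subr_gt0.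
by move=> u wu; exists t => //; have := ler_distD w (p + t *: (z - p)) u; lra.
Qed.

Lemma tube_base p z (r : R) : 0 < r -> tube p z r p.
Proof. by move=> r0; exists 0; rewrite ?lexx ?ler01// scale0r addr0 subrr normr0. Qed.

Lemma tube_end p z (r : R) w : `|z - w| < r -> tube p z r w.
Proof. by move=> zw; exists 1; rewrite ?lexx ?ler01// scale1r [p + _]addrC subrK. Qed.

Lemma convx_tube p z (r : R) : convx (tube p z r).
Proof.
move=> x y s [t /andP[t0 t1] hx] [t' /andP[t'0 t'1] hy] /andP[s0 s1].
have s1' : 0 <= 1 - s by rewrite subr_ge0.
exists ((1 - s) * t + s * t'); first by apply/andP; split; nra.
have -> : p + ((1 - s) * t + s * t') *: (z - p) - ((1 - s) *: x + s *: y) =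
   (1 - s) *: (p + t *: (z - p) - x) + s *: (p + t' *: (z - p) - y).
  by apply/rowP => i; rewrite !mxE; ring.
apply: le_lt_trans (ler_normD _ _) _; rewrite !normrZ (ger0_norm s0) (ger0_norm s1').
by apply: convex_comb_lt => //; rewrite s0.
Qed.

Lemma sub_tube p z (r : R) w : tube p w (r - `|z - w|) `<=` tube p z r.
Proof.
move=> u [t /andP[t0 t1] hu]; exists t; first by rewrite t0.
have -> : p + t *: (z - p) - u = t *: (z - w) + (p + t *: (w - p) - u).
  by apply/rowP => i; rewrite !mxE; ring.
apply: le_lt_trans (ler_normD _ _) _; rewrite normrZ (ger0_norm t0).
have : t * `|z - w| <= `|z - w| by rewrite ler_piMl.
by move: hu; lra.
Qed.

Section solutions.
Context (O E F1 F2 : set rV).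
Context (oO : open O) (cO : convx O) (cF1 : closed F1) (cF2 : closed F2).
Context (F12 : F1 `&` F2 = set0) (mE : lebesgue_measurable E).
Context (EF : forall z, O z -> ~ F1 z -> ~ F2 z -> lconst E z).

(* On a convex open set two solutions differ at most by complementation. *)
Let sol U G := forall z, U z ->
  (~ F2 z -> lconst G z) /\ (~ F1 z -> lconst (E `+` G) z).

Let sub_sol U V G : U `<=` V -> sol V G -> sol U G.
Proof. by move=> UV sG z /UV; exact: sG. Qed.

Let eq_sol U G H : open U -> (forall z, U z -> G z <-> H z) -> sol U G -> sol U H.
Proof.
move=> /rv_openP oU GH sG z Uz; have [r r0 hr] := oU z Uz; have [s1 s2] := sG z Uz; split.
  by move=> /s1; apply: lconst_eq; exists r => // w /hr/GH.
by move=> /s2; apply: lconst_eq; exists r => // w /hr/GH; rewrite /setY/=; tauto.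
Qed.

(** Off [F2] both sets are locally constant. At a point of [F2], which is off [F1], one uses G + H =
    (E + G) + (E + H) mod 2. *)
Let sol_diff U G H z : sol U G -> sol U H -> U z -> lconst (G `+` H) z.
Proof.
move=> sG sH Uz; have [g1 g2] := sG z Uz; have [h1 h2] := sH z Uz.
have [F2z|nF2] := pselect (F2 z); last by apply: lconstY; [exact: g1|exact: h1].
have nF1 : ~ F1 z by move=> F1z; have : (F1 `&` F2) z by []; rewrite F12.
have -> : G `+` H = (E `+` G) `+` (E `+` H).
  by rewrite setYA [E `+` G]setYC -[G `+` E `+` E]setYA setYK setY0.
by apply: lconstY; [exact: g2|exact: h2].
Qed.

Let sol_agree U G H x y : open U -> convx U -> sol U G -> sol U H -> U x -> U y ->
  (G x <-> H x) -> (G y <-> H y).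
Proof.
move=> oU cU sG sH Ux Uy GHx.
have lc z : U z -> lconst (~` (G `+` H)) z by move=> Uz; apply: lconstC; exact: sol_diff sG sH Uz.
have : (~` (G `+` H)) y.
  by apply: (lconst_convx oU cU lc Ux Uy); rewrite /setY/=; tauto.
rewrite /setY/=; have [?|?] := pselect (G y); have [?|?] := pselect (H y); tauto.
Qed.

Let solC U G : sol U G -> sol U (~` G).
Proof.
move=> sG z /sG[s1 s2]; split => [/s1|/s2]; first exact: lconstC.
by rewrite -setYTC setYA setYTC; exact: lconstC.
Qed.

(** Where [F1] is absent [E] itself is a solution, and where [F2] is absent the empty set is. *)
Let local_sol U : U `<=` O -> (U `&` F1 = set0 \/ U `&` F2 = set0) -> exists G, sol U G.
Proof.
move=> UO [] UF; [exists E|exists set0] => z Uz.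
  have nF1 : ~ F1 z by move=> F1z; have : (U `&` F1) z by []; rewrite UF.
  split => [nF2|_]; first by apply: EF => //; exact: UO.
  by rewrite setYK; apply: lconst_trivial; left.
have nF2 : ~ F2 z by move=> F2z; have : (U `&` F2) z by []; rewrite UF.
split => [_|nF1]; first by apply: lconst_trivial; left.
by rewrite setY0; apply: EF => //; exact: UO.
Qed.

Let sol_glue U V G H : open U -> open V -> sol U G -> sol V H ->
  (forall z, U z -> V z -> (G z <-> H z)) -> sol (U `|` V) ((G `&` U) `|` (H `&` V)).
Proof.
move=> oU oV sG sH GH z [Uz|Vz].
  apply: (eq_sol (U := U) oU _ sG) => // w Uw; split; first by left.
  by case=> [[]//|[Hw Vw]]; exact/GH.
apply: (eq_sol (U := V) oV _ sH) => // w Vw; split; first by right.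
by case=> [[Gw Uw]|[]//]; exact/GH.
Qed.

(** Continuation along the segment. Balls below the Lebesgue number avoid [F1] or [F2] and so carry
    a solution; each is complemented if necessary to match, at its centre, the solution built so
    far, and is then glued on. A last complement normalises the solution to exclude [p]. *)
Let tube_sol p z : O p -> O z -> exists r G, [/\ 0 < r, tube p z r `<=` O,
  sol (tube p z r) G & ~ G p].
Proof.
move=> Op Oz.
pose f (t : R) : rV := p + t *: (z - p).
pose V (b : bool) := O `&` ~` (if b then F1 else F2).
have oV b : open (V b) by apply: openI => //; apply: closed_openC; case: b.
have cL : compact (f @` `[0, 1]).
  by apply: continuous_compact; [apply: continuous_subspaceT; exact: line_continuous|exact: segment_compact].
have Of t : 0 <= t <= 1 -> O (f t).
  move=> t01; rewrite (_ : f t = (1 - t) *: p + t *: z); first exact: cO.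
  by rewrite /f; apply/rowP => i; rewrite !mxE; ring.
have LV x : (f @` `[0, 1]) x -> exists b, V b x.
  move=> [t]; rewrite /= in_itv/= => t01 <-.
  have [F1t|nF1] := pselect (F1 (f t)); last by exists true; split => //; exact: Of.
  exists false; split; first exact: Of.
  by move=> F2t; have : (F1 `&` F2) (f t) by []; rewrite F12.
have [r0 r00 hr0] := lebesgue_number cL oV LV.
pose r := r0 / 3; have r_gt0 : 0 < r by rewrite divr_gt0.
have ballV t : 0 <= t <= 1 -> exists b, nball (f t) (2 * r) `<=` V b.
  move=> t01; have [|b hb] := hr0 (f t); first by exists t => //=; rewrite in_itv.
  by exists b => w hw; apply: hb; move: hw; rewrite /nball/= /r; lra.
have ballS t : 0 <= t <= 1 -> exists G, sol (nball (f t) (2 * r)) G.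
  move=> t01; have [b hb] := ballV t t01; apply: local_sol; first by move=> w /hb[].
  case: b hb => hb; [left|right]; rewrite -subset0 => w [/hb[_ nF] Fw]; exact: nF.
pose n := (Num.truncn (`|z - p| / r)).+1.
have n0 : 0 < n%:R :> R by rewrite ltr0n.
have zn : `|z - p| / n%:R <= r.
  by rewrite ler_pdivrMr// mulrC -ler_pdivrMr// ltW// truncnS_gt.
pose tk k : R := k%:R / n%:R.
have tk01 k : (k <= n)%N -> 0 <= tk k <= 1.
  by move=> kn; rewrite divr_ge0//= ler_pdivrMr// mul1r ler_nat.
have main k : (k <= n)%N -> exists G, sol (tube p (f (tk k)) r) G.
  elim: k => [_|k IH kn].
    have [|G sG] := ballS 0; first by rewrite lexx ler01.
    exists G; apply: sub_sol sG => w [t _].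
    rewrite /f /tk mul0r !scale0r !addr0 subrr scaler0 addr0 /nball/=; lra.
  have [G sG] := IH (ltnW kn); have [H sH] := ballS (tk k) (tk01 _ (ltnW kn)).
  have end_in : tube p (f (tk k)) r (f (tk k)) by apply: tube_end; rewrite subrr normr0.
  have ctr_in : nball (f (tk k)) (2 * r) (f (tk k)) by rewrite /nball/= subrr normr0; lra.
  wlog GH : H sH / G (f (tk k)) <-> H (f (tk k)).
    move=> W; have [h|h] := pselect (G (f (tk k)) <-> H (f (tk k))); first exact: W sH h.
    apply: (W (~` H)); first exact: solC.
    by rewrite /setC/=; have [?|?] := pselect (G (f (tk k))); have [?|?] := pselect (H (f (tk k))); tauto.
  have oT := @open_tube p (f (tk k)) r; have oB := @open_nball _ _ (f (tk k)) (2 * r).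
  exists ((G `&` tube p (f (tk k)) r) `|` (H `&` nball (f (tk k)) (2 * r))).
  apply: sub_sol (sol_glue oT oB sG sH _); last first.
    move=> w Tw Bw.
    have cI : convx (tube p (f (tk k)) r `&` nball (f (tk k)) (2 * r)).
      move=> x y s [x1 x2] [y1 y2] s01; split; first exact: convx_tube.
      exact: convx_nball.
    apply: (sol_agree (openI oT oB) cI (x := f (tk k))) => //.
    - by apply: sub_sol sG => u [].
    - by apply: sub_sol sH => u [].
  have ff (t s : R) : p + t *: (f s - p) = f (t * s).
    by rewrite /f; apply/rowP => i; rewrite !mxE; ring.
  move=> w [t /andP[t0 t1]]; rewrite ff => hw.
  have /andP[u0 u1] := tk01 _ kn.
  (* If the foot of [w] on the segment comes before [f (tk k)], then [w] is in the old tube;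
     otherwise the foot is within [r] of that point, which puts [w] in the ball of radius
     [2 * r]. *)
  have [le|gt] := leP (t * tk k.+1) (tk k).
    left; have [k0|kpos] := eqVneq (tk k) 0.
      exists 0; rewrite ?lexx ?ler01// scale0r addr0.
      have e0 : t * tk k.+1 = 0 by apply/eqP; rewrite eq_le -{1}k0 le mulr_ge0.
      by move: hw; rewrite e0 /f scale0r addr0.
    have kp : 0 < tk k by rewrite lt_neqAle eq_sym kpos; have /andP[] := tk01 _ (ltnW kn).
    exists (t * tk k.+1 / tk k); first by rewrite divr_ge0 ?mulr_ge0//= ?ler_pdivrMr ?mul1r// ltW.
    by rewrite ff divfK.
  right; rewrite /nball/=.
  have -> : f (tk k) - w = (tk k - t * tk k.+1) *: (z - p) + (f (t * tk k.+1) - w).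
    by rewrite /f; apply/rowP => i; rewrite !mxE; ring.
  apply: le_lt_trans (ler_normD _ _) _; rewrite normrZ ltr0_norm ?subr_lt0// opprB.
  have step : tk k.+1 - tk k = n%:R^-1 by rewrite /tk -mulrBl -natr1 addrC addKr mul1r.
  have h1 : t * tk k.+1 - tk k <= n%:R^-1.
    by rewrite -step lerB// ler_piMl.
  have : (t * tk k.+1 - tk k) * `|z - p| <= r.
    by apply: le_trans zn; rewrite mulrC ler_wpM2l.
  by lra.
have [G] := main n (leqnn n); rewrite /tk divff ?gt_eqF// /f scale1r addrC subrK => sG.
have TO : tube p z r `<=` O.
  move=> w [t t01 hw]; have [b hb] := ballV t t01; have [] // := hb w.
  by rewrite /nball/=; move: hw; rewrite -/(f t); lra.
have [Gp|nGp] := pselect (G p); last by exists r, G; split.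
by exists r, (~` G); split => //; exact: solC.
Qed.

(** The solutions along different tubes are all normalised at the base point [p], so they agree
    where they overlap along a common segment; hence their union [G2] is a solution near each
    point. *)
Lemma sign_lift : exists G, [/\ lebesgue_measurable G,
  forall z, O z -> ~ F2 z -> lconst G z & forall z, O z -> ~ F1 z -> lconst (E `+` G) z].
Proof.
have [[p Op]|O0] := pselect (O !=set0); last first.
  exists set0; split=> [|z Oz|z Oz]; first exact: measurable0.
  - by exfalso; apply: O0; exists z.
  - by exfalso; apply: O0; exists z.
pose G2 : set rV := [set z | O z /\ exists r G, [/\ 0 < r, sol (tube p z r) G, ~ G p & G z]].
have sG2 : sol O G2.
  move=> z Oz; have [r [G [r0 TO sG nGp]]] := tube_sol Op Oz.
  suff H : sol (nball z r) G2 by apply: H; rewrite /nball/= subrr normr0.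
  have sB : sol (nball z r) G by apply: sub_sol sG => w; exact: tube_end.
  apply: (eq_sol (@open_nball _ _ z r) _ sB) => w zw.
  pose r' := r - `|z - w|; have r'0 : 0 < r' by rewrite subr_gt0.
  have sw : sol (tube p w r') G by apply: sub_sol sG; exact: sub_tube.
  split=> [Gw|[Ow [r1 [G1 [r10 s1 nG1p G1w]]]]].
    by split; [apply: TO; exact: tube_end|exists r', G].
  pose m := Num.min r1 r'; have m0 : 0 < m by rewrite lt_min r10.
  have mono (a b : R) : a <= b -> tube p w a `<=` tube p w b.
    by move=> ab u [t t01 h]; exists t => //; exact: lt_le_trans ab.
  have Tw : tube p w m w by apply: tube_end; rewrite subrr normr0.
  have GG1 : G p <-> G1 p by tauto.
  suff [_] : G w <-> G1 w by apply.
  apply: (sol_agree (@open_tube p w m) (@convx_tube p w m) _ _ (tube_base p w m0) Tw GG1).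
  - by apply: sub_sol sw; apply: mono; rewrite ge_min lexx orbT.
  - by apply: sub_sol s1; apply: mono; rewrite ge_min lexx.
exists G2; split; last 2 first.
- by move=> z /sG2[].
- by move=> z /sG2[].
(* For measurability: off [F2] the set [G2] is open, off [F1] it is [E] plus an open set mod 2, and
   these two regions cover [O]. *)
have oF1 : open (O `\` F1) by apply: openI => //; exact: closed_openC.
have oF2 : open (O `\` F2) by apply: openI => //; exact: closed_openC.
have o2 : open ((O `\` F2) `&` G2) by apply: open_lconst => // z [/sG2[h _] ?]; exact: h.
have o1 : open ((O `\` F1) `&` (E `+` G2)) by apply: open_lconst => // z [/sG2[_ h] ?]; exact: h.
rewrite (_ : G2 = ((O `\` F2) `&` G2) `|`
    ((O `\` F1) `&` (E `+` ((O `\` F1) `&` (E `+` G2))))).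
  apply: (@measurableU _ (lebesgue_space R d)); first exact: measurable_open.
  apply: (@measurableI _ (lebesgue_space R d)); first exact: measurable_open.
  by apply: measurableY => //; exact: measurable_open.
apply/seteqP; split => z.
  move=> G2z; have [Oz _] := G2z; have [F2z|nF2] := pselect (F2 z); last by left.
  have nF1 : ~ F1 z by move=> F1z; have : (F1 `&` F2) z by []; rewrite F12.
  by right; rewrite /setY/=; have [?|?] := pselect (E z); tauto.
case=> [[]//|[[Oz nF1]]]; rewrite /setY/=.
by have [?|?] := pselect (E z); have [?|?] := pselect (G2 z); tauto.
Qed.

End solutions.

End lifting.

(** * Conclusion *)

Section conclusion.
Context (R : realType) (d : nat).
Local Notation rV := 'rV[R]_d.
Implicit Types (A B C E F G H L O U V : set rV) (z w u x : rV) (J Y : pred 'I_d).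

(** What a standard representative provides in addition to closedness; it turns statements up to
    null sets into pointwise ones. *)
Definition full E := forall z, E z -> ~ near_null E z.

Lemma closed_near_null E z : closed E -> ~ E z -> near_null E z.
Proof.
move=> cE nE; have [r r0 hr] := (rv_openP (~` E)).1 (closed_openC cE) z nE.
exists r => //; rewrite (_ : E `&` nball z r = set0) ?measure0//.
by rewrite -subset0 => w [Ew /hr].
Qed.

Lemma lconst_interior E z : E z -> ~ interior E z -> ~ lconst E z.
Proof.
move=> Ez nE [r r0 h]; apply: nE; apply/interiorP; exists r => // w /h hw; exact/hw.
Qed.

Lemma boundary_closed E z : closed E -> boundary E z <-> ~ lconst E z.
Proof.
move=> cE; rewrite /boundary -(closure_id E).1//; split=> [[Ez nE]|nl].
  exact: lconst_interior.
split.
  apply: contrapT => nE; apply: nl.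
  have [r r0 hr] := (rv_openP (~` E)).1 (closed_openC cE) z nE.
  by exists r => // w /hr.
move=> /interiorP[r r0 h]; apply: nl; exists r => // w zw; split => // _.
  by apply: h; rewrite subrr normr0.
exact: h.
Qed.

(** Near [z] both [E] and its complement have positive volume, by [full] and closedness, and there
    [A] coincides with one of the two. *)
Lemma not_lconst_volume O E A z : (0 < volume [set: rV])%E -> open O -> closed E -> full E ->
  O z -> ~ lconst E z -> lconst (E `+` A) z ->
  (0 < volume (A `&` O))%E /\ (0 < volume (O `\` A))%E.
Proof.
move=> nt oO cE fE Oz nl [r' r'0 h]; have [r0 r00 hO] := (rv_openP O).1 oO z Oz.
pose r := Num.min r0 r'; have r_gt0 : 0 < r by rewrite lt_min r00.
have hr w : nball z r w -> O w /\ ((E `+` A) w <-> (E `+` A) z).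
  by rewrite /nball/= lt_min => /andP[/hO ? /h].
have z_in : nball z r z by rewrite /nball/= subrr normr0.
have v1 : (0 < volume (E `&` nball z r))%E.
  rewrite lt_neqAle volume_ge0 andbT eq_sym; apply/eqP => v0; apply: nl.
  have out w : nball z r w -> ~ E w.
    move=> zw Ew; apply: (fE w Ew); exists (r - `|z - w|); first by rewrite subr_gt0.
    apply: le_null v0 => u [Eu wu]; split => //; rewrite /nball/=.
    by have := ler_distD w z u; move: wu; rewrite /nball/=; lra.
  by exists r => // w zw; split => ?; exfalso; [exact: (out w)|exact: (out z)].
have oE : open (nball z r `\` E) by apply: openI; [exact: open_nball|exact: closed_openC].
have v2 : (0 < volume (nball z r `\` E))%E.
  apply: volume_open_gt0 nt oE _; apply: contrapT => e; apply: nl.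
  have inE w : nball z r w -> E w.
    by move=> zw; apply: contrapT => nE; apply: e; exists w.
  by exists r => // w zw; split => _; exact: inE.
have [EAz|nEAz] := pselect ((E `+` A) z); split.
- apply: sub_volume_gt0 v2 => w [zw nE]; have [Ow EA] := hr w zw.
  by move: (EA.2 EAz); rewrite /setY/=; tauto.
- apply: sub_volume_gt0 v1 => w [Ew zw]; have [Ow EA] := hr w zw.
  by move: (EA.2 EAz); rewrite /setY/=; tauto.
- apply: sub_volume_gt0 v1 => w [Ew zw]; have [Ow EA] := hr w zw.
  by split => //; apply: contrapT => nA; apply: nEAz; apply/EA; left.
- apply: sub_volume_gt0 v2 => w [zw nE]; have [Ow EA] := hr w zw.
  by split => // Aw; apply: nEAz; apply/EA; right.
Qed.

Lemma pboundC J O G (p : R) : (0 < volume [set: rV])%E -> lebesgue_measurable G ->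
  pbound J O G p -> pbound J O (~` G) p.
Proof.
move=> nt mG pG; rewrite -setYTC -[p]addr0; apply: setY_pbound => //.
  exact: measurableT.
by apply: trivial_pbound; right.
Qed.

Lemma disconnected_boundary Y O E F1 F2 (p : R) z1 z2 : (0 < volume [set: rV])%E -> open O ->
  convx O -> cyl Y O -> (0 < #|Y|)%N -> isop O E p -> closed E -> full E ->
  closed F1 -> closed F2 -> F1 `&` F2 = set0 ->
  (forall z, O z -> ~ F1 z -> ~ F2 z -> lconst E z) ->
  O z1 -> ~ lconst E z1 -> ~ F2 z1 -> O z2 -> ~ lconst E z2 -> ~ F1 z2 ->
  #|Y| = 1%N /\ pbound (predC Y) O E 0.
Proof.
move=> nt oO cvO cO Y0 iE cE fE cF1 cF2 F12 EF Oz1 nl1 nF2 Oz2 nl2 nF1.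
have [mE vE pE minE] := iE.
have [G2 [mG2 l2 l1]] := sign_lift oO cvO cF1 cF2 F12 mE EF.
pose G1 := E `+` G2.
have mG1 : lebesgue_measurable G1 by exact: measurableY.
have EG1 : E `+` G1 = G2 by rewrite /G1 setYA setYK set0Y.
have E12 : E = G1 `+` G2 by rewrite /G1 -setYA setYK setY0.
have EG z : O z -> E z <-> (G1 `+` G2) z by rewrite -E12.
have [p1 [p2 [pG1 pG2 p12]]] := split_perimeter nt cF1 cF2 F12 mG1 mG2 mE EG l1 l2 pE.
(* At [z1], which is off [F2], the set [G2] is locally constant, so the jump of [E] there is a jump
   of [G1]; symmetrically for [z2] and [G2]. *)
have [v1 v1'] : (0 < volume (G1 `&` O))%E /\ (0 < volume (O `\` G1))%E.
  by apply: (not_lconst_volume nt oO cE fE Oz1 nl1); rewrite EG1; exact: l2.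
have [v2 v2'] : (0 < volume (G2 `&` O))%E /\ (0 < volume (O `\` G2))%E.
  by apply: (not_lconst_volume nt oO cE fE Oz2 nl2); exact: l1.
have vEf : (volume (E `&` O) < +oo)%E by have /andP[] := vE.
(* If [G1] has finite volume then so has [G2], which differs from [E] by [G1]. *)
have [f1|f1] := ltP (volume (G1 `&` O)) +oo%E.
  exfalso; apply: (no_split nt oO cO Y0 iE mG1 mG2 pG1 pG2 p12).
  - apply: le_trans (volumeU_le _ _); apply: le_volume => z; rewrite {1}E12 /setY/=; tauto.
  - by rewrite v1.
  - rewrite v2/=; apply: (@le_lt_trans _ _ (volume (E `&` O) + volume (G1 `&` O))%E).
      apply: le_trans (volumeU_le _ _); apply: le_volume => z; rewrite -{1}EG1 /setY/=; tauto.
    exact: lte_add_pinfty.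
(* [E] is also the symmetric difference of the two complements, to which the same argument
   applies. *)
have [f1'|f1'] := ltP (volume (O `\` G1)) +oo%E.
  have mC A : lebesgue_measurable A -> lebesgue_measurable (~` A).
    exact: (@measurableC _ (lebesgue_space R d)).
  exfalso; apply: (no_split nt oO cO Y0 iE (mC _ mG1) (mC _ mG2) (pboundC nt mG1 pG1) (pboundC nt mG2 pG2) p12).
  - apply: le_trans (volumeU_le _ _); apply: le_volume => z; rewrite {1}E12 /setY/=; tauto.
  - by rewrite setIC v1' f1'.
  - rewrite setIC v2'/=; apply: (@le_lt_trans _ _ (volume (E `&` O) + volume (O `\` G1))%E).
      apply: le_trans (volumeU_le _ _); apply: le_volume => z; rewrite -{1}EG1 /setY/=.
      by have [?|?] := pselect (E z); have [?|?] := pselect (G1 z); tauto.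
    exact: lte_add_pinfty.
apply: (infinite_split nt oO cvO cO Y0 iE mG1 mG2 pG1 pG2 p12 EG).
- by apply/eqP; rewrite -leye_eq.
- by apply/eqP; rewrite -leye_eq.
Qed.

(** If [w] were outside the closed set [E], then [E] would be null near [w]; invariance along the
    segment carries this to [z], against [full]. *)
Lemma full_invariant J O E z w : (0 < volume [set: rV])%E -> open O -> convx O ->
  lebesgue_measurable E -> closed E -> full E -> pbound J O E 0 -> O z -> O w ->
  (forall i, ~~ J i -> z 0 i = w 0 i) -> E z -> E w.
Proof.
move=> nt oO cvO mE cE fE pE Oz Ow zw Ez; apply: contrapT => nEw; apply: (fE z Ez).
have nw := closed_near_null cE nEw.
have -> : z = w - (w - z) by rewrite subKr.
apply: near_null_sh nw _; rewrite subKr.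
apply: (inv_null_segment nt oO cvO mE pE) => //; last by rewrite addrC subrK.
by move=> i /zw h; rewrite !mxE h subrr.
Qed.

(** This shows that a half-infinite cylinder has infinite volume: a translate of it contains the
    original and a disjoint open set besides, while volume is invariant. *)
Lemma translate_absurd H U u : (0 < volume [set: rV])%E -> lebesgue_measurable H ->
  open U -> U !=set0 -> U `&` H = set0 -> U `<=` sh u H -> H `<=` sh u H ->
  (volume H < +oo)%E -> False.
Proof.
move=> nt mH oU U0 UH UsH HsH fH.
have vU := volume_open_gt0 nt oU U0.
have : (volume H + volume U <= volume H)%E.
  rewrite -{2}(volume_sh u H) -measureU//; last by rewrite setIC.
  - by apply: le_volume => z [/HsH|/UsH].
  - exact: measurable_open.
have fin : volume H \is a fin_num by rewrite ge0_fin_numE ?volume_ge0.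
by rewrite -{2}[volume H]adde0 leeD2lE// leNgt vU.
Qed.

(* The set of heights of a region that is constant on cross sections has no gap,
   since the parts above and below a gap would split E. *)
Lemma zero_horizontal_slab i0 C E (p : R) : (0 < volume [set: rV])%E -> convx C -> closed C ->
  interior C !=set0 -> cyl (pred1 i0) C -> closed E -> E `<=` C -> full E ->
  isop (interior C) E p -> pbound (predC (pred1 i0)) (interior C) E 0 ->
  exists a b : R, a <= b /\ E = C `&` [set z : 'rV[R]_d | a <= z 0 i0 <= b].
Proof.
move=> nt cC clC [x0 Ox0] cylC cE EC fE iE pE.
set O := interior C in Ox0 iE pE *.
have oO : open O by exact: open_interior.
have cvO : convx O by exact: convx_interior.
have cO : cyl (pred1 i0) O by exact: cyl_interior.
have mO := measurable_open oO.
have [mE vE pE' minE] := iE.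
have Y0 : (0 < #|pred1 i0|)%N by rewrite card1.
(* A line parallel to the axis through an interior point; it meets every height inside [O], so [A]
   records the heights that belong to [E]. *)
pose at_ (s : R) : rV := x0 + (s - x0 0 i0) *: e_ i0.
have at_i s : at_ s 0 i0 = s by rewrite !mxE !eqxx/= mulr1 addrC subrK.
have O_at s : O (at_ s) by apply/(cyl_translate x0 _ cO (eqxx i0)).
pose A (s : R) := E (at_ s).
have EA z : O z -> E z <-> A (z 0 i0).
  move=> Oz; split; apply: (full_invariant nt oO cvO mE cE fE pE) => //.
  - by move=> i /negPn/eqP ->; rewrite at_i.
  - by move=> i /negPn/eqP ->; rewrite at_i.
have mI B B' : lebesgue_measurable B -> lebesgue_measurable B' -> lebesgue_measurable (B `&` B').
  exact: (@measurableI _ (lebesgue_space R d)).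
have vEf : (volume (E `&` O) < +oo)%E by have /andP[] := vE.
have A_open s : ~ A s -> exists2 e : R, 0 < e & forall t, `|s - t| < e -> ~ A t.
  move=> nA; have [r r0 hr] := (rv_openP (~` E)).1 (closed_openC cE) _ nA.
  exists r => // t st; apply: hr; apply: le_lt_trans st.
  have -> : at_ s - at_ t = (s - t) *: e_ i0 by apply/rowP => i; rewrite !mxE; ring.
  exact: norm_e.
have A0 : exists s, A s.
  apply: contrapT => h; have /andP[+ _] := vE; rewrite (_ : E `&` O = set0) ?measure0 ?ltxx//.
  by rewrite -subset0 => z [Ez Oz]; apply: h; exists (z 0 i0); apply/(EA z Oz).
have piece s (B : set rV) : A s -> open B -> B (at_ s) -> (0 < volume ((E `&` B) `&` O))%E.
  move=> As oB Bs; rewrite lt_neqAle volume_ge0 andbT eq_sym; apply/eqP => v0.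
  have [r r0 hr] := (rv_openP (B `&` O)).1 (openI oB oO) (at_ s) (conj Bs (O_at s)).
  apply: (fE _ As); exists r => //; apply: le_null v0 => w [Ew /hr[Bw Ow]].
  by split.
have oC b : open [set z : rV | z 0 i0 < b] by exact: open_coord_lt.
have oC' b : open [set z : rV | b < z 0 i0].
  apply/rv_openP => z /= zb; exists (z 0 i0 - b); first by rewrite subr_gt0.
  by move=> w zw; have := le_lt_trans (le_coord (z - w) i0) zw; rewrite !mxE ltr_norml => /andP[]; lra.
have A_convex s1 s2 s3 : s1 <= s2 -> s2 <= s3 -> A s1 -> A s3 -> A s2.
  move=> s12 s23 As1 As3; apply: contrapT => nA.
  have [e e0 he] := A_open s2 nA.
  have gap (z : rV) : O z -> `|s2 - z 0 i0| < e -> ~ E z by move=> Oz /he h /(EA z Oz).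
  have lt12 : s1 < s2 by rewrite lt_neqAle s12 andbT; apply/eqP => h; apply: nA; rewrite -h.
  have lt23 : s2 < s3 by rewrite lt_neqAle s23 andbT; apply/eqP => h; apply: nA; rewrite h.
  (* The heights within [e] of [s2] are missing from [E], so these disjoint closed half spaces can
     play the role of two parts of the boundary. *)
  pose F1 : set rV := ~` [set z : rV | s2 - e < z 0 i0].
  pose F2 : set rV := ~` [set z : rV | z 0 i0 < s2 + e].
  pose G1 := E `&` [set z : rV | z 0 i0 < s2]; pose G2 := E `&` [set z : rV | s2 < z 0 i0].
  have mG1 : lebesgue_measurable G1 by apply: mI => //; exact: measurable_open.
  have mG2 : lebesgue_measurable G2 by apply: mI => //; exact: measurable_open.
  have F12 : F1 `&` F2 = set0.
    by rewrite -subset0 => z [/= /negP + /negP]; rewrite -!leNgt; lra.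
  have EG z : O z -> E z <-> (G1 `+` G2) z.
    move=> Oz; rewrite /setY /G1 /G2/=; split; last by tauto.
    move=> Ez; case: (ltgtP (z 0 i0) s2) => h; [by left; split => // -[] //|by right; split => // -[] //|].
    by exfalso; apply: (gap z Oz) => //; rewrite h subrr normr0.
  have nl (B : set rV) z : open B -> O z -> B z -> forall G, (forall w, O w -> B w -> ~ G w) -> lconst G z.
    move=> oB Oz Bz G h; have [r r0 hr] := (rv_openP (B `&` O)).1 (openI oB oO) z (conj Bz Oz).
    by exists r => // w /hr[Bw Ow]; split => ?; exfalso; [exact: (h w)|exact: (h z)].
  have l1 z : O z -> ~ F1 z -> lconst G1 z.
    move=> Oz /contrapT Bz; apply: (nl _ z (oC' (s2 - e)) Oz Bz) => w Ow /= Bw [Ew /= ws].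
    by apply: (gap w Ow) => //; rewrite ltr_norml; apply/andP; split; lra.
  have l2 z : O z -> ~ F2 z -> lconst G2 z.
    move=> Oz /contrapT Bz; apply: (nl _ z (oC (s2 + e)) Oz Bz) => w Ow /= Bw [Ew /= ws].
    by apply: (gap w Ow) => //; rewrite ltr_norml; apply/andP; split; lra.
  have [p1 [p2 [pG1 pG2 p12]]] := split_perimeter nt (open_closedC (oC' _)) (open_closedC (oC _)) F12 mG1 mG2 mE EG l1 l2 pE'.
  apply: (no_split nt oO cO Y0 iE mG1 mG2 pG1 pG2 p12).
  - apply: le_trans (volumeU_le _ _); apply: le_volume => z [Ez Oz].
    by have := (EG z Oz).1 Ez; rewrite /setY/=; tauto.
  - rewrite (piece s1)//=; last by rewrite at_i.
    by apply: le_lt_trans vEf; apply: le_volume => z [[]].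
  - rewrite (piece s3)//=; last by rewrite at_i.
    by apply: le_lt_trans vEf; apply: le_volume => z [[]].
have [s0 As0] := A0.
(* The sign treats upward and downward rays together: a ray of heights in [A] would put a half
   cylinder into [E]. *)
have infinite (sg : R) : sg = 1 \/ sg = -1 -> ~ (forall s, 0 <= sg * (s - s0) -> A s).
  move=> hsg hA.
  pose f z : R := sg * (z 0 i0 - s0).
  have sg2 : sg * sg = 1 by case: hsg => ->; ring.
  have f_sh z (t : R) : f (z + (sg * t) *: e_ i0) = f z + t.
    rewrite /f !mxE !eqxx/= mulr1 addrAC mulrDr mulrA sg2 mul1r//.
  have fcont z w : `|f z - f w| <= `|z - w|.
    rewrite /f -mulrBr normrM (_ : `|sg| = 1) ?mul1r; last by case: hsg => ->; rewrite ?normrN normr1.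
    by have := le_coord (z - w) i0; rewrite !mxE; congr (`|_| <= _); ring.
  (* [U] is the layer of height one next to the half cylinder [H]; translation by one along the axis
     absorbs it. *)
  pose H := O `&` ~` [set z | f z < 0]; pose U := O `&` [set z | (-1 < f z) && (f z < 0)].
  have oU : open U.
    apply: openI => //; apply/rv_openP => z /= /andP[z1 z2].
    exists (Num.min (f z + 1) (- f z)); first by rewrite lt_min; apply/andP; split; lra.
    move=> w; rewrite lt_min => /andP[w1 w2]; have := fcont z w.
    by rewrite ler_norml => /andP[? ?]; apply/andP; split; lra.
  have oN : open [set z | f z < 0].
    apply/rv_openP => z /= z2; exists (- f z); first by lra.
    by move=> w w2; have := fcont z w; rewrite ler_norml => /andP[? ?]; lra.
  have mH : lebesgue_measurable H.
    by apply: mI => //; apply: (@measurableC _ (lebesgue_space R d)); exact: measurable_open.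
  have O_sh z : O (z + (sg * 1) *: e_ i0) <-> O z by exact: cyl_translate cO (eqxx i0).
  apply: (@translate_absurd H U ((sg * 1) *: e_ i0) nt mH oU).
  - exists (at_ (s0 + sg * (- (1 / 2)))); split; first exact: O_at.
    have -> : [set z | (-1 < f z) && (f z < 0)] (at_ (s0 + sg * (- (1 / 2)))) =
      (-1 < - (1 / 2) :> R) && (- (1 / 2) < 0 :> R) :> Prop.
      by rewrite /= /f at_i [s0 + _]addrC addrK mulrA sg2 mul1r.
    by apply/andP; split; lra.
  - by rewrite -subset0 => z [[_ /= /andP[_ h]] [_]]; apply.
  - move=> z [Oz /andP[h1 h2]]; split; first exact/O_sh.
    by rewrite /= f_sh; apply/negP; rewrite -leNgt; lra.
  - move=> z [Oz /negP]; rewrite -leNgt => h; split; first exact/O_sh.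
    by rewrite /= f_sh; apply/negP; rewrite -leNgt; lra.
  - apply: le_lt_trans vEf; apply: le_volume => z [Oz /negP]; rewrite -leNgt => h.
    by split => //; apply/(EA z Oz); exact: hA.
pose S : set R := [set s | A s].
have ubS : has_ubound S.
  apply: contrapT => nub; apply: (infinite 1); first by left.
  move=> s; rewrite mul1r subr_ge0 => s0s; apply: contrapT => nA.
  apply: nub; exists s => t At; rewrite leNgt; apply/negP => st.
  by apply: nA; apply: A_convex s0s (ltW st) As0 At.
have lbS : has_lbound S.
  apply: contrapT => nlb; apply: (infinite (-1)); first by right.
  move=> s; rewrite mulN1r opprB subr_ge0 => s0s; apply: contrapT => nA.
  apply: nlb; exists s => t At; rewrite leNgt; apply/negP => st.
  by apply: nA; apply: A_convex (ltW st) s0s At As0.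
have S0 : S !=set0 by exists s0.
pose a := inf S; pose b := sup S.
have Aab s : A s -> a <= s <= b.
  by move=> As; rewrite ge_inf//= ub_le_sup.
have Aa : A a.
  apply: contrapT => nA; have [e e0 he] := A_open a nA.
  have [t At ta] := inf_adherent e0 (conj S0 lbS).
  have /andP[at' _] := Aab t At; apply: (he t) => //.
  by rewrite -/a in ta; rewrite ltr_norml; apply/andP; split; lra.
have Ab : A b.
  apply: contrapT => nA; have [e e0 he] := A_open b nA.
  have [t At ta] := sup_adherent e0 (conj S0 ubS).
  have /andP[_ tb] := Aab t At; apply: (he t) => //.
  by rewrite -/b in ta; rewrite ltr_norml; apply/andP; split; lra.
have AP s : A s <-> a <= s <= b.
  by split => [/Aab//|/andP[h1 h2]]; exact: A_convex h1 h2 Aa Ab.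
have /andP[ab _] := Aab _ Ab.
exists a, b; split => //; apply/seteqP; split => z.
  move=> Ez; split; first exact: EC.
  (* Near a point at a height outside [a, b] the set [E] has no points in [O], so it lies there in
     the null boundary of [C], against [full]. *)
  apply: contrapT => nz; apply: (fE z Ez).
  have [e e0 he] : exists2 e : R, 0 < e & forall t, `|z 0 i0 - t| < e -> ~ A t.
    by apply: A_open => /AP.
  exists e => //; apply: le_null (convex_boundary_null cC clC (ex_intro _ x0 Ox0)) => w [Ew zw].
  split; first exact: EC.
  move=> Ow; apply: (he (w 0 i0)); last by apply/(EA w Ow).
  by have := le_lt_trans (le_coord (z - w) i0) zw; rewrite !mxE.
move=> [Cz /= zab]; apply: contrapT => nE.
have [r r0 hr] := (rv_openP (~` E)).1 (closed_openC cE) z nE.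
(* Moved slightly towards this interior point of the same height, [z] enters [O] at a height in [A]
   and hence in [E], yet stays in the ball that misses [E]. *)
pose y := at_ (z 0 i0).
pose D := `|z - y| + 1; have D0 : 0 < D by rewrite ltr_wpDl.
pose s := Num.min 1 (r / 2 / D).
have sp : 0 < s by rewrite lt_min ltr01 !divr_gt0.
have s1 : s <= 1 by rewrite ge_min lexx.
have sD : s * D <= r / 2 by rewrite -ler_pdivlMr// ge_min lexx orbT.
pose w := (1 - s) *: z + s *: y.
have s01 : 0 < s <= 1 by rewrite sp.
have Ow : O w by apply: convx_interior_dilate => //; exact: O_at.
apply: (hr w).
  have -> : z - w = s *: (z - y) by rewrite /w; apply/rowP => i; rewrite !mxE; ring.
  rewrite normrZ gtr0_norm//; move: sD; rewrite /D; lra.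
apply/(EA w Ow)/AP; suff -> : w 0 i0 = z 0 i0 by [].
have -> : w 0 i0 = (1 - s) * z 0 i0 + s * y 0 i0 by rewrite [LHS]mxE [X in X + _]mxE [X in _ + X]mxE.
by rewrite at_i; ring.
Qed.

Lemma cylinder_dichotomy Y C E : (0 < volume [set: rV])%E -> convx C -> closed C ->
  interior C !=set0 -> cyl Y C -> (0 < #|Y|)%N -> isoperimetric_region C E ->
  closed E -> full E ->
  connected (closure (boundary E `&` interior C)) \/
  exists i0, Y =1 pred1 i0 /\
    exists a b : R, a <= b /\ E = C `&` [set z : 'rV[R]_d | a <= z 0 i0 <= b].
Proof.
move=> nt cC clC C0 cylC Y0 hE cE fE.
have [?|nc] := pselect (connected (closure (boundary E `&` interior C))); [by left|right].
have [p iE] := isoperimetric_isop hE cC clC C0 cylC Y0.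
have [mE EC _ _] := hE.
set S := boundary E `&` interior C in nc.
have [F [F0 SF [F1 F2]]] := (connectedPn _).1 nc.
have clS : closed (closure S) by exact: closed_closure.
have SE z : interior C z -> ~ lconst E z -> S z.
  by move=> Oz nl; split => //; apply/boundary_closed.
have cF b : closed (F b).
  rewrite (_ : F b = closure S `&` closure (F b)); first by apply: closedI => //; exact: closed_closure.
  apply/seteqP; split => z.
    move=> Fz; split; last exact: subset_closure.
    by rewrite SF; case: b Fz; [right|left].
  rewrite SF => -[[Ff|Ft] cz]; case: b cz => // cz; exfalso.
    by have : (F false `&` closure (F true)) z by []; rewrite F2.
  by have : (closure (F false) `&` F true) z by []; rewrite F1.
have F12 : F false `&` F true = set0.
  by rewrite -subset0 => z [Ff Ft]; rewrite -F1; split => //; exact: subset_closure.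
(* Points of [F b] are only limits of boundary points inside the cylinder; as the other part is
   closed, some of these boundary points avoid it. *)
have pt b : exists z, [/\ interior C z, ~ lconst E z & ~ F (~~ b) z].
  have [x Fx] := F0 b.
  have nx : (~` F (~~ b)) x.
    move=> Fx'; have : (F false `&` F true) x by case: b Fx Fx'.
    by rewrite F12.
  have : closure S x by rewrite SF; case: b Fx {nx}; [right|left].
  have /open_nbhs_nbhs/[swap]/[apply] := conj (closed_openC (cF (~~ b))) nx.
  by move=> [z [[bz Oz] nz]]; exists z; split => //; apply/boundary_closed.
have [z1 [Oz1 nl1 nF1]] := pt false; have [z2 [Oz2 nl2 nF2]] := pt true.
have EF z : interior C z -> ~ F false z -> ~ F true z -> lconst E z.
  move=> Oz nf nt'; apply: contrapT => /(SE z Oz)/subset_closure.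
  by rewrite SF => -[].
have [Y1 pE] := disconnected_boundary nt (@open_interior _ C) (convx_interior cC)
  (cyl_interior cylC) Y0 iE cE fE (cF _) (cF _) F12 EF Oz1 nl1 nF1 Oz2 nl2 nF2.
have [i0 Yi0] : exists i, Y i by move: Y0 => /card_gt0P[i Yi]; exists i.
have YE : Y =1 pred1 i0.
  move=> i; apply/idP/eqP => [Yi|->//].
  by have /card_le1_eqP := eq_leq Y1; apply.
exists i0; split => //.
apply: (zero_horizontal_slab nt cC clC C0 _ cE EC fE iE).
- by move=> z w zw; apply: cylC => i nY; apply: zw; move: nY; rewrite YE.
- by apply: sub_pbound pE => i /=; rewrite YE.
Qed.

End conclusion.

(** * The convex cylinder over a convex body *)

Section cylinder_over_convex_body.
Context (R : realType) (m q : nat).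
Implicit Types (K : set 'rV[R]_m) (E : set 'rV[R]_(m + q)).

Local Notation C K := (prod_set K [set: 'rV[R]_q]).

Lemma norm_lsubmx (z : 'rV[R]_(m + q)) : `|lsubmx z| <= `|z|.
Proof. by apply/rv_normP => // i; rewrite mxE; exact: le_coord. Qed.

Lemma cylinder_convx K : convex_body K -> convx (C K).
Proof.
move=> [_ cK _] x y s [Kx _] [Ky _] /andP[s0 s1]; split => //.
have /set_mem := cK (lsubmx y) (lsubmx x) (Itv01 s0 s1) (mem_set Ky) (mem_set Kx).
by congr K; apply/rowP => i; rewrite !mxE addrC.
Qed.

Lemma cylinder_closed K : convex_body K -> closed (C K).
Proof.
move=> [cK _ _]; have clK : closed K by exact: compact_closed (@norm_hausdorff _ _) cK.
rewrite -(setCK (C K)); apply: open_closedC; apply/rv_openP => z nz.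
have nKz : (~` K) (lsubmx z) by move=> Kz; apply: nz.
have [r r0 hr] := (rv_openP (~` K)).1 (closed_openC clK) _ nKz.
exists r => // w zw [Kw _]; apply: (hr (lsubmx w)) Kw.
by apply: le_lt_trans zw; rewrite -raddfB; exact: norm_lsubmx.
Qed.

Lemma cylinder_interior K : convex_body K -> interior (C K) !=set0.
Proof.
move=> [_ _ [k /interiorP[r r0 hr]]]; exists (row_mx k 0); apply/interiorP; exists r => // w zw.
split => //; apply: hr; apply: le_lt_trans zw.
by rewrite -[k in X in X <= _](row_mxKl k (0 : 'rV_q)) -raddfB; exact: norm_lsubmx.
Qed.

Definition axis : pred 'I_(m + q) := fun i => (m <= i)%N.

Lemma cyl_cylinder K : cyl axis (C K).
Proof.
move=> z w zw [Kz _]; split => //; rewrite (_ : lsubmx w = lsubmx z)//.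
by apply/rowP => i; rewrite !mxE zw// /axis -ltnNge /=.
Qed.

(** A null neighbourhood makes all density quotients at small radii 0, so the point would have
    density zero. Euclidean balls lie in the sup-norm balls of the same radius. *)
Lemma standard_representative_full d (E : set 'rV[R]_d) : standard_representative E -> full E.
Proof.
move=> [_ _ h0] z Ez [r r0 v0]; apply: (h0 z) => //.
apply: cvg_near_cst; near=> s.
rewrite (_ : volume (E `&` eball z s) = 0%E) ?mul0r//; apply: le_null v0 => w [Ew]; split => //.
rewrite /nball/= distrC; apply: le_lt_trans (_ : enorm (w - z) < r).
  apply/rv_normP => [|i]; first exact: sqrtr_ge0.
  rewrite -sqrtr_sqr ler_sqrt ?sumr_ge0// => [|j _]; last exact: sqr_ge0.
  by rewrite (bigD1 i)//= lerDl sumr_ge0// => j _; exact: sqr_ge0.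
by apply: lt_le_trans (_ : s <= r) => //; near: s; exact: nbhs_right_le.
Unshelve. all: by end_near. Qed.

End cylinder_over_convex_body.

Unset Implicit Arguments.

Theorem theorem3p6 (R : realType) (m q : nat) (hm : (1 <= m)%N) (hq : (1 <= q)%N)
    (alpha : R) (halpha : 0 < alpha <= 1)
    (K : set 'rV[R]_m) (hK : convex_body K)
    (C : set 'rV[R]_(m + q)) (hC : C = prod_set K setT)
    (hreg : boundary_of_class_holder 2 alpha C)
    (E : set 'rV[R]_(m + q))
    (hE : isoperimetric_region C E) (hrep : standard_representative E) :
  connected (closure (boundary E `&` interior C)) \/
  (q = 1%N /\ exists a b : R, a <= b /\ E = slab K a b).
Proof.
have fE := standard_representative_full hrep; have [cE _ _] := hrep.
have nt : (0 < volume [set: 'rV[R]_(m + q)])%E.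
  by have [_ _ /andP[v0 _] _] := hE; apply: sub_volume_gt0 v0.
have axis0 : (0 < #|@axis m q|)%N.
  by apply/card_gt0P; exists (rshift m (Ordinal hq)); rewrite unfold_in /axis /= leq_addr.
have cC : convx C by rewrite hC; exact: cylinder_convx.
have clC : closed C by rewrite hC; exact: cylinder_closed.
have iC : interior C !=set0 by rewrite hC; exact: cylinder_interior.
have cylC : cyl (@axis m q) C by rewrite hC; exact: cyl_cylinder.
case: (cylinder_dichotomy nt cC clC iC cylC axis0 hE cE fE) => [?|]; first by left.
move=> [i0 [YE [a [b [ab EE]]]]]; right.
have all_i0 (k : 'I_q) : rshift m k = i0.
  by apply/eqP; have := YE (rshift m k); rewrite /axis /= leq_addr => <-.
have q1 : q = 1%N.
  apply/eqP; rewrite eqn_leq hq andbT leqNgt; apply/negP => q2.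
  have := etrans (all_i0 (Ordinal hq)) (esym (all_i0 (Ordinal q2))).
  by move=> /(congr1 val) /= /eqP; rewrite eqn_add2l.
split => //; exists a, b; split => //; rewrite EE hC /slab.
apply/seteqP; split => z; first by move=> [[Kz _] /= zab]; split => //= j; rewrite mxE in_itv/= all_i0.
by move=> [Kz zab]; split => //=; have := zab (Ordinal hq); rewrite mxE in_itv/= all_i0.
Qed.
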